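(* Let $V$ be a quasi-vertex operator algebra over $\mathbf{C}$. The map $$P: M\otimes_{\mathbf{C}}V^{(2)}\to M(V),\qquad P(f\otimes v)=\sum_{n\ge0}\frac1{n!}\left(-\frac{2\pi i}{12}\right)^nE_2^n f\; L(1)^nv$$ (the sum being finite, and the right-hand side viewed as a $V$-valued function on the upper half-plane) is an $M$-linear isomorphism of graded spaces.
   Context: Vertex algebra over $\mathbf{C}$: a vector space $V$ with a nonzero vector $\mathbf 1$ and bilinear products $(a,b)\mapsto a(n)b$, $n\in\mathbf{Z}$, such that $a(n)b=0$ for $n\gg0$ (depending on $a,b$), $a(n)\mathbf 1=0$ for $n\ge0$, $a(-1)\mathbf 1=a$, and for all $a,b,c\in V$, $r,s,t\in\mathbf{Z}$: $\sum_{i\ge0}\binom ri (a(t+i)b)(r+s-i)c=\sum_{i\ge0}(-1)^i\binom ti\{a(r+t-i)b(s+i)c-(-1)^t b(s+t-i)a(r+i)c\}$. A quasi-vertex operator algebra (QVOA) is a vertex algebra with a grading $V=\bigoplus_{n\in\mathbf{Z}}V_n$ such that $\dim V_n<\infty$, $V_n=0$ for $n\ll0$, $a(n)b\in V_{k+\ell-n-1}$ for $a\in V_k,b\in V_\ell$, together with operators $L(-1),L(0),L(1)$ on $V$ with $L(-1)a=a(-2)\mathbf 1$, $L(0)a=ka$ for $a\in V_k$, $L(1)V_k\subseteq V_{k-1}$, $[L(m),L(n)]=(m-n)L(m+n)$ for $m,n\in\{0,\pm1\}$, and for $a\in V_k$: $[L(-1),a(n)]=(L(-1)a)(n)=-n\,a(n-1)$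 and $[L(1),a(n)]=(L(1)a)(n)+(2k-n-2)a(n+1)$. $V^{(2)}$ is $V$ with doubled grading: $V^{(2)}_{2n}=V_n$. Let $\mathcal H$ be the upper half-plane, $\Gamma=\mathrm{SL}_2(\mathbf{Z})$, $q=e^{2\pi i\tau}$, $F_NV=\bigoplus_{n\le N}V_n$. For $\gamma=\left(\begin{smallmatrix}a&b\\c&d\end{smallmatrix}\right)\in\Gamma$ put $j=c\tau+d$, and for $f:\mathcal H\to F_NV$ put $f||_k\gamma(\tau)=j^{-k}\,j^{2L(0)}e^{cjL(1)}f(\gamma\tau)$. $M_k(V)$: holomorphic $f:\mathcal H\to F_NV$ (some $N$) with $f||_k\gamma=f$ for all $\gamma\in\Gamma$ and $q$-expansion in $F_NV[[q]]$. $M(V)=\bigoplus_{k\in\mathbf{Z}}M_k(V)$, an $M$-module by pointwise multiplication, graded by weight $k$. $M=\mathbf{C}[E_4,E_6]=\bigoplus_k M_{2k}$ is the graded algebra of holomorphic modular forms for $\Gamma$, with $E_4=1+240\sum_{n\ge1}\sigma_3(n)q^n$, $E_6=1-504\sum_{n\ge1}\sigma_5(n)q^n$; $E_2=1-24\sum_{n\ge1}\sigma_1(n)q^n$. $M\otimes V^{(2)}$ has the tensor product grading. *)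

(* Defs.v *)
From HB Require Import structures.
From mathcomp Require Import all_boot all_order all_algebra.
From mathcomp Require Import generic_quotient ring_quotient.
From mathcomp Require Import all_classical all_reals all_analysis.
From mathcomp Require Import complex freeg ring lra zify.

Set Implicit Arguments.
Unset Strict Implicit.
Unset Printing Implicit Defensive.

Import Order.TTheory GRing.Theory Num.Theory.
Import numFieldNormedType.Exports.
Local Open Scope classical_set_scope.
Local Open Scope ring_scope.
Local Open Scope complex_scope.

Section Span.
Variables (K : fieldType) (V : lmodType K).
Implicit Types S : set V.

Definition lspan S : set V :=
  [set v | exists s : seq (K * V),
     (forall x, x \in s -> S x.2) /\ v = \sum_(x <- s) x.1 *: x.2].

Lemma sub_span S v : S v -> lspan S v.
Proof.
move=> Sv; exists [:: (1, v)]; split=> [x|].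
  by rewrite inE => /eqP ->.
by rewrite big_seq1 scale1r.
Qed.

Lemma span0 S : lspan S 0.
Proof. by exists [::]; split => //; rewrite big_nil. Qed.

Lemma spanD S u v : lspan S u -> lspan S v -> lspan S (u + v).
Proof.
move=> [s [Ss ->]] [t [St ->]]; exists (s ++ t); rewrite big_cat; split=> // x.
by rewrite mem_cat => /orP[/Ss|/St].
Qed.

Lemma spanZ S c v : lspan S v -> lspan S (c *: v).
Proof.
move=> [s [Ss ->]]; exists [seq (c * x.1, x.2) | x <- s]; split.
  by move=> x /mapP[y /Ss Sy ->].
by rewrite scaler_sumr big_map; apply: eq_bigr => x _ /=; rewrite scalerA.
Qed.

Lemma span_ind S (P : V -> Prop) : P 0 -> (forall u v, P u -> P v -> P (u + v)) ->
  (forall c v, S v -> P (c *: v)) -> forall v, lspan S v -> P v.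
Proof.
move=> P0 PD PZ v [s [Ss ->]]; elim: s Ss => [|x s IHs] Ss.
  by rewrite big_nil.
rewrite big_cons; apply: PD.
  by apply: PZ; apply: Ss; rewrite mem_head.
by apply: IHs => y ys; apply: Ss; rewrite inE ys orbT.
Qed.

Definition in_span S : {pred V} := fun v => `[< lspan S v >].

Lemma in_spanP S v : reflect (lspan S v) (v \in in_span S).
Proof. exact: asboolP. Qed.

Lemma in_span_submod_closed S : GRing.submod_closed (in_span S).
Proof.
split=> [|c u v /in_spanP Su /in_spanP Sv]; apply/in_spanP; first exact: span0.
exact/spanD/Sv/spanZ.
Qed.

HB.instance Definition _ S :=
  GRing.isSubmodClosed.Build K V (in_span S) (in_span_submod_closed S).

End Span.

Section Tensor.
Variables (K : fieldType) (A B : lmodType K).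

(* The tensor product of two vector spaces: the free space on A * B modulo the
   subspace spanned by the bilinearity relations. *)
Definition tens_rel : set {freeg (A * B) / K} :=
  [set x | [\/ exists a a' b, x = << (a + a', b) >> - << (a, b) >> - << (a', b) >>,
              exists a b b', x = << (a, b + b') >> - << (a, b) >> - << (a, b') >>,
              exists c a b, x = << (c *: a, b) >> - c *: << (a, b) >>
            | exists c a b, x = << (a, c *: b) >> - c *: << (a, b) >>]].

Definition tensor := Quotient.quot (in_span tens_rel).
HB.instance Definition _ := GRing.Zmodule.on tensor.
HB.instance Definition _ : EqQuotient _ _ tensor := EqQuotient.on tensor.
HB.instance Definition _ := ZmodQuotient.on tensor.

Local Open Scope quotient_scope.

Definition tproj : {freeg (A * B) / K} -> tensor := \pi_tensor.

Lemma tproj_eq x y : tproj x = tproj y <-> lspan tens_rel (x - y).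
Proof.
split=> [/eqP|/in_spanP h]; last apply/eqP.
  by rewrite -Quotient.idealrBE => /in_spanP.
by rewrite -Quotient.idealrBE.
Qed.

Lemma tprojD x y : tproj (x + y) = tproj x + tproj y.
Proof. exact: raddfD. Qed.

Lemma treprK t : tproj (repr t) = t.
Proof. exact: reprK. Qed.

Definition tscale (c : K) (t : tensor) : tensor := tproj (c *: repr t).

Lemma tprojZ c x : tproj (c *: x) = tscale c (tproj x).
Proof.
by apply/tproj_eq; rewrite -scalerBr; apply/spanZ/tproj_eq; rewrite treprK.
Qed.

Lemma tscaleA c d t : tscale c (tscale d t) = tscale (c * d) t.
Proof. by rewrite -[t]treprK -!tprojZ scalerA. Qed.

Lemma tscale1 t : tscale 1 t = t.
Proof. by rewrite -[t]treprK -!tprojZ scale1r. Qed.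

Lemma tscaleDr c t u : tscale c (t + u) = tscale c t + tscale c u.
Proof. by rewrite -[t]treprK -[u]treprK -tprojD -!tprojZ scalerDr tprojD. Qed.

Lemma tscaleDl t c d : tscale (c + d) t = tscale c t + tscale d t.
Proof. by rewrite -[t]treprK -!tprojZ scalerDl tprojD. Qed.

HB.instance Definition _ := GRing.Zmodule_isLmodule.Build K tensor
  tscaleA tscale1 tscaleDr tscaleDl.

Lemma tprojZr c x : tproj (c *: x) = c *: tproj x. Proof. exact: tprojZ. Qed.

Definition tens (a : A) (b : B) : tensor := tproj << (a, b) >>.

(* Universal property: a bilinear f factors as (tlift f) (tens a b) = f a b. *)
Section Lift.
Variables (W : lmodType K) (f : A -> B -> W).

Definition tlift (t : tensor) : W := fglift (fun p => f p.1 p.2) (repr t).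

Hypothesis linl : forall b, linear (f^~ b).
Hypothesis linr : forall a, linear (f a).

Let F : {freeg (A * B) / K} -> W := fglift (fun p => f p.1 p.2).

Let FU p : F << p >> = f p.1 p.2.
Proof. by rewrite /F liftU scale1r. Qed.

Let FB x y : F (x - y) = F x - F y.
Proof. exact: lift_is_additive. Qed.

Let F0 : F 0 = 0.
Proof. by rewrite -(subrr 0) FB subrr. Qed.

Let FD x y : F (x + y) = F x + F y.
Proof. by rewrite -[y in LHS]opprK -[- y]add0r !FB F0 add0r opprK. Qed.

Let FZ c x : F (c *: x) = c *: F x.
Proof.
rewrite -[x]freeg_sumE scaler_sumr !(big_morph F FD F0) scaler_sumr.
apply: eq_bigr => p _; rewrite (_ : c *: _ = << c * coeff p x *g p >>).
  by rewrite /F !liftU scalerA.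
by apply/eqP/freeg_eqP => y; rewrite coeffZ !coeffU mulrA.
Qed.

Let lin_D (U : lmodType K) (g : U -> W) : linear g ->
  (forall u v, g (u + v) = g u + g v) /\ (forall c u, g (c *: u) = c *: g u).
Proof.
move=> lg; have gD u v : g (u + v) = g u + g v by have := lg 1 u v; rewrite !scale1r.
have g0 : g 0 = 0 by apply: (addrI (g 0)); rewrite -gD !addr0.
by split=> // c u; have := lg c u 0; rewrite g0 !addr0.
Qed.

Let F_rel x : lspan tens_rel x -> F x = 0.
Proof.
elim/span_ind => [|u v Fu Fv|c v vI]; first exact: F0.
  by rewrite FD Fu Fv addr0.
rewrite FZ (_ : F v = 0) ?scaler0 //.
case: vI => [[a [a' [b ->]]]|[a [b [b' ->]]]|[d [a [b ->]]]|[d [a [b ->]]]].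
- by rewrite !FB !FU /= (lin_D (linl b)).1 addrAC addrK subrr.
- by rewrite !FB !FU /= (lin_D (linr a)).1 addrAC addrK subrr.
- by rewrite FB FZ !FU /= (lin_D (linl b)).2 subrr.
- by rewrite FB FZ !FU /= (lin_D (linr a)).2 subrr.
Qed.

Let tliftE x : tlift (tproj x) = F x.
Proof.
by apply/eqP; rewrite -subr_eq0 -[_ - _]/(F _ - _) -FB F_rel //; apply/tproj_eq;
   rewrite treprK.
Qed.

Lemma tlift_is_linear : linear tlift.
Proof.
move=> c t u; rewrite -[t]treprK -[u]treprK -tprojZr -tprojD.
by rewrite !tliftE FD FZ.
Qed.

Lemma tlift_tens a b : tlift (tens a b) = f a b.
Proof. by rewrite tliftE FU. Qed.

End Lift.

Lemma tensDl a a' b : tens (a + a') b = tens a b + tens a' b.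
Proof.
rewrite /tens -tprojD; apply/tproj_eq/sub_span/Or41.
by exists a, a', b; rewrite opprD addrA.
Qed.

Lemma tensDr a b b' : tens a (b + b') = tens a b + tens a b'.
Proof.
rewrite /tens -tprojD; apply/tproj_eq/sub_span/Or42.
by exists a, b, b'; rewrite opprD addrA.
Qed.

Lemma tensZl c a b : tens (c *: a) b = c *: tens a b.
Proof. by rewrite /tens -tprojZr; apply/tproj_eq/sub_span/Or43; exists c, a, b. Qed.

Lemma tensZr c a b : tens a (c *: b) = c *: tens a b.
Proof. by rewrite /tens -tprojZr; apply/tproj_eq/sub_span/Or44; exists c, a, b. Qed.

Lemma tensor_span t : lspan [set x | exists a b, x = tens a b] t.
Proof.
rewrite -[t]treprK -[repr t]freeg_sumE.
elim/big_ind: _ => [||p _].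
  by rewrite -(scale0r 0) tprojZr scale0r; apply: span0.
  by move=> x y sx sy; rewrite tprojD; apply: spanD.
rewrite (_ : << _ *g p >> = coeff p (repr t) *: << p >>); last first.
  by apply/eqP/freeg_eqP => y; rewrite coeffZ !coeffU mul1r.
by rewrite tprojZr; apply/spanZ/sub_span; exists p.1, p.2; case: p.
Qed.

End Tensor.

(* Cauchy product of two series with geometrically small terms; only used to
   show that the q-expansion of a product of modular forms converges. *)
Section CauchyProductBound.
Variables (F : numFieldType) (a b : nat -> F) (K M r : F).
Hypotheses (r0 : 0 <= r) (r1 : r <= 1).
Hypothesis aK : forall n, `|a n| <= K * r ^+ (3 * n).
Hypothesis bM : forall n, `|b n| <= M * r ^+ (3 * n).

Lemma cauchy_coefE N : \sum_(n < N) \sum_(i < n.+1) a i * b (n - i)%N =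
  \sum_(i < N) a i * \sum_(j < N - i) b j.
Proof.
elim: N => [|N IHN]; first by rewrite !big_ord0.
rewrite big_ord_recr /= IHN [RHS]big_ord_recr /= subSn // subnn big_ord1.
rewrite big_ord_recr /= subnn addrA; congr (_ + _).
rewrite -big_split /=; apply: eq_bigr => i _.
by rewrite -mulrDr subSn 1?ltnW // big_ord_recr.
Qed.

Lemma cauchy_bound_ge0 : 0 <= K /\ 0 <= M.
Proof.
split; first by have := le_trans (normr_ge0 _) (aK 0); rewrite muln0 expr0 mulr1.
by have := le_trans (normr_ge0 _) (bM 0); rewrite muln0 expr0 mulr1.
Qed.

Lemma cauchy_bound N : `|(\sum_(i < N) a i) * (\sum_(i < N) b i) -
    \sum_(n < N) \sum_(i < n.+1) a i * b (n - i)%N|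
   <= K * M * (N%:R * r ^+ N) ^+ 2 * r ^+ N.
Proof.
have [K0 M0] := cauchy_bound_ge0.
rewrite cauchy_coefE mulr_suml -sumrB; apply: le_trans (ler_norm_sum _ _ _) _.
have tail (i : 'I_N) : \sum_(j < N) b j - \sum_(j < N - i) b j =
    \sum_(N - i <= j < N) b j.
  rewrite -!(big_mkord xpredT b) (@big_cat_nat _ _ _ (N - i)%N 0%N N) ?leq_subr //=.
  by rewrite addrAC subrr add0r.
apply: (@le_trans _ _ (\sum_(i < N) K * M * (N%:R * r ^+ (3 * N)))); last first.
  rewrite sumr_const card_ord -mulr_natl le_eqVlt; apply/orP; left; apply/eqP.
  by rewrite mulnC exprM; ring.
apply: ler_sum => i _; rewrite -mulrBr tail normrM.
have -> : K * M * (N%:R * r ^+ (3 * N)) =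
   (K * r ^+ (3 * i)) * (N%:R * (M * r ^+ (3 * (N - i)))).
  have -> : (3 * N = 3 * i + 3 * (N - i))%N by rewrite -mulnDr subnKC // ltnW.
  by rewrite exprD; ring.
apply: ler_pM => //; apply: le_trans (ler_norm_sum _ _ _) _.
apply: (@le_trans _ _ (\sum_(N - i <= j < N) M * r ^+ (3 * (N - i)))).
  rewrite big_nat [leRHS]big_nat; apply: ler_sum => j /andP[Nj _].
  apply: le_trans (bM j) _; apply: ler_wpM2l => //.
  by apply: ler_wiXn2l => //; rewrite leq_mul2l Nj.
rewrite sumr_const_nat subKn; last exact: ltnW.
rewrite -[leLHS]mulr_natl.
apply: ler_wpM2r; first by rewrite mulr_ge0 // exprn_ge0.
by rewrite ler_nat ltnW.
Qed.

Hypothesis r_geo : (fun N => K * M * (N%:R * r ^+ N) ^+ 2 * r ^+ N : F^o) @ \oo --> (0 : F^o).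

Lemma cvg_cauchy_product (A B : F) :
  series (a : nat -> F^o) @ \oo --> (A : F^o) ->
  series (b : nat -> F^o) @ \oo --> (B : F^o) ->
  series (fun n => \sum_(i < n.+1) a i * b (n - i)%N : F^o) @ \oo --> (A * B : F^o).
Proof.
move=> aA bB.
have AB : (fun N => series (a : nat -> F^o) N * series (b : nat -> F^o) N) @ \oo
   --> (A * B : F^o) by exact: cvgM.
have D0 : (fun N => series (a : nat -> F^o) N * series (b : nat -> F^o) N -
   series (fun n => \sum_(i < n.+1) a i * b (n - i)%N : F^o) N) @ \oo --> (0 : F^o).
  apply/cvgr0Pnorm_lt => e e0.
  have /(@cvgr0Pnorm_lt _ _ _ _ _)/(_ e e0) := r_geo; apply: filterS => N.
  apply: le_lt_trans; rewrite /series /= !big_mkord.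
  apply: le_trans (cauchy_bound N) _.
  have [K0 M0] := cauchy_bound_ge0.
  by rewrite ger0_norm // !mulr_ge0 // ?exprn_ge0 ?mulr_ge0 // exprn_ge0.
rewrite (_ : series _ = (fun N => series (a : nat -> F^o) N * series (b : nat -> F^o) N) -
   (fun N => series (a : nat -> F^o) N * series (b : nat -> F^o) N -
   series (fun n => \sum_(i < n.+1) a i * b (n - i)%N : F^o) N)); last first.
  by apply/funext => N; rewrite !fctE /= opprB addrC subrK.
by rewrite -[A * B]subr0; exact: cvgB.
Qed.

End CauchyProductBound.

Section CauchyProduct.
Variable R : realType.
Local Notation C := R[i].
Variables (a b : nat -> C) (A B : C) (K M : C) (r : R).
Hypotheses (r0 : 0 < r) (r1 : r < 1).
Hypothesis aK : forall n, `|a n| <= K * r%:C ^+ (3 * n).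
Hypothesis bM : forall n, `|b n| <= M * r%:C ^+ (3 * n).
Hypothesis aA : series (a : nat -> C^o) @ \oo --> (A : C^o).
Hypothesis bB : series (b : nat -> C^o) @ \oo --> (B : C^o).

Let rC0 : 0 <= r%:C :> C. Proof. by rewrite lecR ltW. Qed.
Let rC1 : r%:C <= 1 :> C. Proof. by rewrite (@lecR _ _ 1) ltW. Qed.
Let K0 : 0 <= K. Proof. by have [] := cauchy_bound_ge0 aK bM. Qed.
Let M0 : 0 <= M. Proof. by have [] := cauchy_bound_ge0 aK bM. Qed.

Let Nr N : N%:R * r ^+ N <= (1 - r)^-1.
Proof.
have h : 0 < 1 - r by rewrite subr_gt0.
rewrite -[leRHS]mul1r ler_pdivlMr //.
apply: (@le_trans _ _ ((\sum_(i < N) r ^+ i) * (1 - r))).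
  apply: ler_wpM2r; first exact: ltW.
  rewrite mulr_natl -[N in _ *+ N]card_ord -sumr_const; apply: ler_sum => i _.
  by apply: ler_wiXn2l; [exact: ltW|exact: ltW|exact/ltnW].
by rewrite mulrC -opprB mulNr -subrX1 opprB lerBlDr lerDl exprn_ge0 // ltW.
Qed.

Lemma cauchy_product : series (fun n => \sum_(i < n.+1) a i * b (n - i)%N : C^o) @ \oo --> (A * B : C^o).
Proof.
refine (@cvg_cauchy_product C a b K M r%:C rC0 rC1 aK bM _ A B aA bB).
apply/cvgr0Pnorm_lt => e e0.
set D := K * M * ((1 - r)^-1 ^+ 2)%:C.
have DR : D \is Num.real by rewrite !realM ?ger0_real //= lecR sqr_ge0.
have eR : e \is Num.real by rewrite gtr0_real.
have := @cvg_geometric R (complex.Re D) r.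
rewrite ger0_norm; last exact: ltW.
move=> /(_ r1)/cvgr0Pnorm_lt/(_ (complex.Re e)).
have e0' : 0 < complex.Re e by rewrite -ltcR RRe_real.
move=> /(_ e0'); apply: filterS => N /= /(le_lt_trans (ler_norm _)) gN.
have KM0 : 0 <= K * M by apply: mulr_ge0.
rewrite ger0_norm; last first.
  apply: mulr_ge0; last exact: exprn_ge0.
  by apply: mulr_ge0 => //; apply: exprn_ge0; apply: mulr_ge0 => //; apply: exprn_ge0.
apply: (@le_lt_trans _ _ (D * (r ^+ N)%:C)).
  rewrite rmorphXn /=; apply: ler_wpM2r; first exact: exprn_ge0.
  apply: ler_wpM2l => //.
  have -> : N%:R * r%:C ^+ N = (N%:R * r ^+ N)%:C by rewrite rmorphM rmorphXn /= rmorph_nat.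
  rewrite -rmorphXn lecR; apply: lerXn2r; rewrite ?nnegrE ?Nr //.
    by apply: mulr_ge0 => //; apply: exprn_ge0; apply: ltW.
  by rewrite invr_ge0 subr_ge0 ltW.
by rewrite -(RRe_real DR) -(RRe_real eR) -rmorphM ltcR.
Qed.

End CauchyProduct.

Lemma det_mx2 (A : comNzRingType) (g : 'M[A]_2) : \det g = g 0 0 * g 1 1 - g 0 1 * g 1 0.
Proof.
rewrite (expand_det_row _ 0) !big_ord_recl big_ord0.
rewrite /cofactor !det_mx11 !mxE addr0 expr0 mul1r expr1 mulN1r mulrN.
have l0 : fintype.lift ord0 ord0 = 1 :> 'I_2 by apply: val_inj.
have l1 : fintype.lift 1 ord0 = 0 :> 'I_2 by apply: val_inj.
by rewrite -[0]/ord0 !l0 l1.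
Qed.

Section Modular.
Variable R : realType.
Local Notation C := R[i].

(* Topological notions are taken on R[i]^o, which carries the normed-module
   structure; R[i] itself carries no topology. *)
Record upper_half := UpperHalf {
  uh_val :> C;
  uh_valP : 0 < complex.Im uh_val }.
HB.instance Definition _ := [isSub for uh_val].
HB.instance Definition _ := [Choice of upper_half by <:].
Local Notation H := upper_half.

Record SL2Z := MkSL2Z {
  sl2_val :> 'M[int]_2;
  sl2_valP : \det sl2_val == 1 }.
HB.instance Definition _ := [isSub for sl2_val].

Definition autj (g : SL2Z) (tau : H) : C :=
  (g 1 0)%:~R * (tau : C) + (g 1 1)%:~R.

Definition mobius_fun (g : SL2Z) (tau : H) : C :=
  ((g 0 0)%:~R * (tau : C) + (g 0 1)%:~R) / autj g tau.

Lemma det_SL2Z (g : SL2Z) : g 0 0 * g 1 1 - g 0 1 * g 1 0 = 1.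
Proof. by have /eqP := sl2_valP g; rewrite det_mx2. Qed.

Lemma intr_complex (m : int) : m%:~R = (m%:~R : R)%:C.
Proof. by rewrite rmorph_int. Qed.

Lemma Im_div (x y z t : R) :
  complex.Im ((x +i* y) / (z +i* t)) = (y * z - x * t) / (z ^+ 2 + t ^+ 2).
Proof.
have -> : (z +i* t)^-1 = (z / (z ^+ 2 + t ^+ 2)) -i* (t / (z ^+ 2 + t ^+ 2)) by [].
by rewrite [LHS]/= mulrBl mulrN !mulrA addrC.
Qed.

Lemma mobius_Im (g : SL2Z) (tau : H) : 0 < complex.Im (mobius_fun g tau).
Proof.
rewrite /mobius_fun /autj !intr_complex; case: tau => -[x y] y0.
rewrite [uh_val _]/=.
have dg : (g 0 0)%:~R * (g 1 1)%:~R - (g 0 1)%:~R * (g 1 0)%:~R = 1 :> R.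
  by rewrite -!intrM -intrB det_SL2Z.
move: dg; set a : R := (g 0 0)%:~R; set b : R := (g 0 1)%:~R.
set c : R := (g 1 0)%:~R; set d : R := (g 1 1)%:~R => dg.
have E (p q : R) : p%:C * (x +i* y) + q%:C = (p * x + q) +i* (p * y).
  by apply/eqP; rewrite eq_complex /= !mul0r subr0 !addr0 !eqxx.
rewrite !E Im_div.
have -> : a * y * (c * x + d) - (a * x + b) * (c * y) = y.
  by transitivity (y * (a * d - b * c)); [ring|rewrite dg mulr1].
rewrite divr_gt0 // lt0r paddr_eq0 ?sqr_ge0 // addr_ge0 ?sqr_ge0 // andbT.
rewrite !sqrf_eq0 mulf_eq0 (gt_eqF y0) orbF; apply/negP => /andP[/[swap]/eqP c0].
rewrite c0 mul0r add0r => /eqP d0; move: dg; rewrite c0 d0 !mulr0 subrr.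
by move/eqP; rewrite eq_sym oner_eq0.
Qed.

Definition mobius (g : SL2Z) (tau : H) : H := UpperHalf (mobius_Im g tau).

Definition cexp (z : C) : C :=
  (expR (complex.Re z))%:C * (cos (complex.Im z) +i* sin (complex.Im z)).

Definition qpar (tau : H) : C := cexp ((2 * pi)%:C * 'i * (tau : C)).

(* Extension by zero to the plane, so that complex differentiability at a point
   of the open half-plane can be expressed by [derivable]. *)
Definition ext_uh (f : H -> C) (z : C) : C :=
  if insub z is Some tau then f tau else 0.

Definition holomorphic (f : H -> C) : Prop :=
  forall tau : H, derivable (ext_uh f : C^o -> C^o) (tau : C) 1.

Definition qseries (f : H -> C) (a : nat -> C) : Prop :=
  forall tau : H,
    series (fun n => a n * qpar tau ^+ n : C^o) @ \oo --> (f tau : C^o).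

(* Holomorphic modular forms of weight k for SL_2(Z); holomorphy at the cusp is
   the existence of a convergent expansion in nonnegative powers of q. *)
Definition modular_form (k : int) (f : H -> C) : Prop :=
  [/\ holomorphic f,
      forall (g : SL2Z) (tau : H), f (mobius g tau) = autj g tau ^ k * f tau
    & exists a : nat -> C, qseries f a].

Lemma holomorphicM f g : holomorphic f -> holomorphic g ->
  holomorphic (fun tau => f tau * g tau).
Proof.
move=> hf hg tau.
have -> : (ext_uh (fun tau : H => f tau * g tau) : C^o -> C^o) =
   (ext_uh f : C^o -> C^o) * (ext_uh g : C^o -> C^o).
  apply/funext => z; rewrite /ext_uh [RHS]/GRing.mul /=; case: insubP => //.
  by rewrite mulr0.
exact: (@derivableM C C^o).
Qed.

Lemma norm_cexp z : `|cexp z| = (expR (complex.Re z))%:C.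
Proof.
rewrite /cexp normrM ![`|_|]normc_def /= expr0n addr0 sqrtr_sqr cos2Dsin2.
by rewrite sqrtr1 mulr1 ger0_norm // expR_ge0.
Qed.

Lemma norm_qpar (tau : H) : `|qpar tau| = (expR (- (2 * pi * complex.Im (tau : C))))%:C.
Proof.
rewrite /qpar norm_cexp; case: tau => -[x y] y0 /=; congr ((expR _)%:C).
by rewrite !(mul0r, mulr0, mulr1, subr0, sub0r, addr0, oppr0, mulNr, add0r).
Qed.

Lemma qseries_bound f a (tau : H) : qseries f a ->
  exists K : C, forall n, `|a n * qpar tau ^+ n| <=
    K * (expR (- (2 * pi * (complex.Im (tau : C) / 4))))%:C ^+ (3 * n).
Proof.
case: tau => -[x y] y0 fa.
have y4 : 0 < complex.Im (x +i* (y / 4)) by rewrite /= divr_gt0.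
have /cvgP/cvg_series_cvg_0/cvgP/cvg_seq_bounded := fa (UpperHalf y4).
set r := expR _ => -[M [Mr bM]].
exists (M + 1) => n; have {bM} := bM (M + 1) _ n I.
rewrite ltrDl ltr01 => /(_ isT) /=; rewrite !normrM !normrX !norm_qpar /=.
rewrite -/r => aM.
have -> : expR (- (2 * pi * y)) = r * r ^+ 3.
  rewrite -exprS -expRM_natl; congr expR => /=.
  by field.
by rewrite rmorphM rmorphXn /= exprMn -exprM mulrA; apply: ler_wpM2r => //; apply: exprn_ge0; rewrite lecR expR_ge0.
Qed.

Lemma qseriesM f g a b : qseries f a -> qseries g b ->
  qseries (fun tau => f tau * g tau) (fun n => \sum_(i < n.+1) a i * b (n - i)%N).
Proof.
move=> fa gb tau.
have [K aK] := qseries_bound tau fa; have [M bM] := qseries_bound tau gb.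
have := @cauchy_product R _ _ (f tau) (g tau) K M _ _ _ aK bM (fa tau) (gb tau).
rewrite (_ : (fun n => \sum_(i < n.+1) _) = (fun n => (\sum_(i < n.+1) a i * b (n - i)%N) * qpar tau ^+ n)).
  apply; first exact: expR_gt0.
  rewrite expR_lt1 oppr_lt0; apply: mulr_gt0; last by rewrite divr_gt0 // uh_valP.
  by rewrite mulr_gt0 // pi_gt0.
apply/funext => n; rewrite mulr_suml; apply: eq_bigr => i _.
by rewrite mulrACA -exprD subnKC // -ltnS.
Qed.

Lemma autj_neq0 g (tau : H) : autj g tau != 0.
Proof.
apply/eqP => j0; have := mobius_Im g tau.
by rewrite /mobius_fun j0 invr0 mulr0 ltxx.
Qed.

Lemma modular_formM k l f g : modular_form k f -> modular_form l g ->
  modular_form (k + l) (fun tau => f tau * g tau).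
Proof.
move=> [hf mf [a fa]] [hg mg [b gb]]; split; first exact: holomorphicM.
  by move=> s tau; rewrite mf mg mulrACA -expfzDr // autj_neq0.
by eexists; apply: (qseriesM fa gb).
Qed.

(* The algebra M of modular forms is the sum of the spaces of weight 2k; the
   spaces of odd weight vanish (apply the modularity law to - 1). By a classical
   theorem M = C[E_4, E_6]. *)
Definition even_forms : set (H -> C^o) :=
  [set f | exists k : int, modular_form (2 * k) f].

Lemma span_formsM f g : lspan even_forms f -> lspan even_forms g ->
  lspan even_forms (fun tau => f tau * g tau).
Proof.
move=> + gM; elim/span_ind => [|u v IHu IHv|c u [k uk]].
- rewrite (_ : (fun _ => _) = 0); first exact: span0.
  by apply/funext => tau; rewrite mul0r.
- rewrite (_ : (fun _ => _) = (fun tau => u tau * g tau) + (fun tau => v tau * g tau)).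
    exact: spanD.
  by apply/funext => tau; rewrite mulrDl.
elim/span_ind: gM => [|v w IHv IHw|d v [l vl]].
- rewrite (_ : (fun _ => _) = 0); first exact: span0.
  by apply/funext => tau; rewrite mulr0.
- rewrite (_ : (fun _ => _) = (fun tau => (c *: u) tau * v tau) + (fun tau => (c *: u) tau * w tau)).
    exact: spanD.
  by apply/funext => tau; rewrite mulrDr.
rewrite (_ : (fun _ => _) = (c * d) *: (fun tau => u tau * v tau)).
  by apply/spanZ/sub_span; exists (k + l); rewrite mulrDr; apply: modular_formM.
by apply/funext => tau; rewrite !fctE -scalerAl -scalerAr scalerA.
Qed.

Record modforms := ModForms {
  mf_val :> H -> C^o;
  mf_valP : mf_val \in in_span even_forms }.
HB.instance Definition _ := [isSub for mf_val].
HB.instance Definition _ := [Choice of modforms by <:].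
HB.instance Definition _ := [SubChoice_isSubLmodule of modforms by <:].

Lemma mf_mul_subproof (g f : modforms) :
  (fun tau => g tau * f tau) \in in_span even_forms.
Proof.
by apply/in_spanP/span_formsM; apply/in_spanP; apply: mf_valP.
Qed.

Definition mf_mul (g f : modforms) : modforms := ModForms (mf_mul_subproof g f).

Definition E2 (tau : H) : C :=
  1 - 24 * lim (series (fun n : nat =>
    (\sum_(d <- divisors n.+1) d)%:R * qpar tau ^+ n.+1 : C^o) @ \oo).
End Modular.

Section QVOA.
Variables (R : realType).
Local Notation C := R[i].

(* Generalized binomial coefficient r (r - 1) ... (r - i + 1) / i!, r in Z. *)
Definition binz (r : int) (i : nat) : C :=
  (\prod_(k < i) (r%:~R - k%:R)) / i`!%:R.

(* [vprod n a b] is a(n)b. All sums \sum_(i \in [set: nat]) below have finitely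
   many nonzero terms: by [vprod_trunc] here and by [opL1_nilpotent] for the
   exponentials of L(1). *)
Record vertex_algebra (V : lmodType C) := VertexAlgebra {
  vac : V;
  vprod : int -> {bilinear V -> V -> V};
  vac_neq0 : vac != 0;
  vprod_trunc : forall a b, exists N : int, forall n, N <= n -> vprod n a b = 0;
  vprod_vac : forall a n, 0 <= n -> vprod n a vac = 0;
  vprod_vacN1 : forall a, vprod (-1) a vac = a;
  borcherds : forall (a b c : V) (r s t : int),
    \sum_(i \in [set: nat])
       binz r i *: vprod (r + s - i%:Z) (vprod (t + i%:Z) a b) c =
    \sum_(i \in [set: nat])
       ((-1) ^+ i * binz t i) *:
         (vprod (r + t - i%:Z) a (vprod (s + i%:Z) b c)
          - (-1) ^ t *: vprod (s + t - i%:Z) b (vprod (r + i%:Z) a c)) }.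

(* A Z-grading is given by its projections; the piece of degree n is the image
   (equivalently the fixed space) of the n-th projection. *)
Record grading (V : lmodType C) := Grading {
  hproj : int -> {linear V -> V};
  hproj_idem : forall m n v, hproj m (hproj n v) = if m == n then hproj n v else 0;
  hproj_fin : forall v, finite_set [set n | hproj n v != 0];
  hproj_sum : forall v, \sum_(n \in [set: int]) hproj n v = v }.

Definition piece (V : lmodType C) (G : grading V) (n : int) : set V :=
  [set v | hproj G n v = v].

(* opLm1, opL0, opL1 are L(-1), L(0), L(1). The brackets [L(m), L(n)] not listed
   follow by antisymmetry. *)
Record qvoa (V : lmodType C) := QVOA {
  qva : vertex_algebra V;
  qgr : grading V;
  piece_findim : forall n, exists s : seq V, piece qgr n `<=` lspan [set` s];
  piece_bounded : exists N : int, forall n, n < N -> piece qgr n `<=` [set 0];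
  vprod_piece : forall k l n a b, piece qgr k a -> piece qgr l b ->
    piece qgr (k + l - n - 1) (vprod qva n a b);
  opLm1 : {linear V -> V};
  opL0 : {linear V -> V};
  opL1 : {linear V -> V};
  Lm1_vac : forall a, opLm1 a = vprod qva (-2) a (vac qva);
  L0_piece : forall k a, piece qgr k a -> opL0 a = k%:~R *: a;
  L1_piece : forall k a, piece qgr k a -> piece qgr (k - 1) (opL1 a);
  bracket_L1_Lm1 : forall v, opL1 (opLm1 v) - opLm1 (opL1 v) = 2 *: opL0 v;
  bracket_L1_L0 : forall v, opL1 (opL0 v) - opL0 (opL1 v) = opL1 v;
  bracket_L0_Lm1 : forall v, opL0 (opLm1 v) - opLm1 (opL0 v) = opLm1 v;
  bracket_Lm1_vprod : forall k a, piece qgr k a -> forall n b,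
    opLm1 (vprod qva n a b) - vprod qva n a (opLm1 b) = vprod qva n (opLm1 a) b;
  vprod_Lm1 : forall k a, piece qgr k a -> forall n b,
    vprod qva n (opLm1 a) b = (- n%:~R) *: vprod qva (n - 1) a b;
  bracket_L1_vprod : forall k a, piece qgr k a -> forall n b,
    opL1 (vprod qva n a b) - vprod qva n a (opL1 b) =
    vprod qva n (opL1 a) b + (2 * k - n - 2)%:~R *: vprod qva (n + 1) a b }.

Variables (V : lmodType C) (Q : qvoa V).
Local Notation H := (upper_half R).

(* The grading of V^(2). *)
Definition doubled_piece (n : int) : set V :=
  if (2 %| n)%Z then piece (qgr Q) (n %/ 2)%Z else [set 0].

(* filt N is F_N V, the sum of the pieces of degree <= N. *)
Definition filt (N : int) : set V := [set v | forall n, N < n -> hproj (qgr Q) n v = 0].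

(* e^(t L(1)) and j^(2 L(0)). *)
Definition expL1 (t : C) (v : V) : V :=
  \sum_(n \in [set: nat]) (t ^+ n / n`!%:R) *: iter n (opL1 Q) v.

Definition pow2L0 (j : C) (v : V) : V :=
  \sum_(n \in [set: int]) j ^ (2 * n) *: hproj (qgr Q) n v.

(* The action f ||_k g. *)
Definition slash (k : int) (f : H -> V) (g : SL2Z) (tau : H) : V :=
  let j := autj g tau in
  j ^ (- k) *: pow2L0 j (expL1 ((g 1 0)%:~R * j) (f (mobius g tau))).

(* M_k(V). Since F_N V is finite dimensional, holomorphy of an F_N V-valued
   function and convergence of a series in F_N V mean holomorphy and convergence
   of all coordinates, i.e. after composition with every linear functional. *)
Definition modular_V (k : int) : set (H -> V) :=
  [set f | exists N : int,
    [/\ forall tau, filt N (f tau),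
        forall phi : {linear V -> C^o}, holomorphic (phi \o f),
        forall (g : SL2Z) (tau : H), slash k f g tau = f tau
      & exists a : nat -> V, (forall n, filt N (a n)) /\
          forall phi : {linear V -> C^o}, qseries (phi \o f) (phi \o a)]].

(* M(V), as a space of functions. The sum of the M_k(V) is direct: if the f_k in
   M_k(V) add up to 0, then \sum_k (c tau + d)^k f_k(tau) = 0 for all coprime
   c, d. *)
Definition modforms_V : set (H -> V) := lspan (\bigcup_k modular_V k).

Local Notation M := (modforms R).
(* The M-module structure on the tensor product of M and V, by multiplication on
   the left factor. *)
Definition tensor_act (g : M) : tensor M V -> tensor M V :=
  tlift (fun f v => tens (mf_mul g f) v).

(* The degree n part of the tensor product of M and V^(2). *)
Definition tensor_piece (n : int) : set (tensor M V) :=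
  lspan [set x | exists k l f v,
    [/\ k + l = n, modular_form k (f : M), doubled_piece l v & x = tens f v]].

Lemma tensor_act_is_linear g : linear (tensor_act g).
Proof.
apply: tlift_is_linear => [v|f] c x y; last by rewrite tensDr tensZr.
rewrite -tensZl -tensDl; congr tens; apply: val_inj; apply/funext => tau /=.
by rewrite !fctE mulrDr scalerAr.
Qed.

Lemma tensor_act_tens g f v : tensor_act g (tens f v) = tens (mf_mul g f) v.
Proof.
apply: tlift_tens => [w|h] c x y; last by rewrite tensDr tensZr.
rewrite -tensZl -tensDl; congr tens; apply: val_inj; apply/funext => tau /=.
by rewrite !fctE mulrDr scalerAr.
Qed.

Lemma opL1_nilpotent v : exists N, forall n, (N <= n)%N -> iter n (opL1 Q) v = 0.
Proof.
have L1n0 n : iter n (opL1 Q) 0 = 0 by elim: n => //= n ->; rewrite linear0.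
have L1nD n u w : iter n (opL1 Q) (u + w) = iter n (opL1 Q) u + iter n (opL1 Q) w.
  by elim: n => //= n ->; rewrite linearD.
rewrite -(hproj_sum (qgr Q) v); elim/big_ind: _ => [|u w [m um] [n wn]|k _].
- by exists 0%N => n _; apply: L1n0.
- exists (maxn m n) => p; rewrite geq_max => /andP[mp np].
  by rewrite L1nD um // wn // addr0.
have [N low] := piece_bounded Q; set w := hproj _ _ _.
have wk n : piece (qgr Q) (k - n%:Z) (iter n (opL1 Q) w).
  elim: n => [|n IHn] /=; first by rewrite subr0 /piece /= hproj_idem eqxx.
  rewrite (_ : k - n.+1%:Z = k - n%:Z - 1); last by rewrite -addn1 PoszD opprD addrA.
  exact: L1_piece.
exists (absz ((k : int) - N + 1)) => n kn; apply: (low ((k : int) - n%:Z)); last exact: wk.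
by move: kn; clear; move: (k : int) => {}k; lia.
Qed.

End QVOA.

(* Main.v *)
From HB Require Import structures.
Require Import Defs.
From mathcomp Require Import all_boot all_order all_algebra.
From mathcomp Require Import all_classical all_reals all_analysis.
From mathcomp Require Import complex ring lra zify.
Set Implicit Arguments.
Unset Strict Implicit.
Unset Printing Implicit Defensive.
Import Order.TTheory GRing.Theory Num.Theory.
Import numFieldNormedType.Exports.
Local Open Scope classical_set_scope.
Local Open Scope ring_scope.
Local Open Scope complex_scope.

(** Put alpha = - 2 pi i / 12, so that P(f (x) v) = f exp (alpha E2 L(1)) v.

    The point is the quasi-modularity of E2. For g in SL_2(Z) with bottom row
    (c, d) and j = c tau + d,
        E2(g tau) = j^2 E2(tau) + (12 / (2 pi i)) c j        (E2_mobius),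
    that is, c j + alpha E2(g tau) = j^2 alpha E2(tau) (slash_E2). Together with
    j^(2 L(0)) exp (j^2 s L(1)) = exp (s L(1)) j^(2 L(0)) (pow2L0_expL1) it says that
    F -> exp (- alpha E2 L(1)) F turns the condition F ||_k g = F into
    G(g tau) = j^(k - 2 L(0)) G(tau). The components of such a G are ordinary modular
    forms with values in the finite-dimensional pieces V_n, of weight k - 2 n. So P
    maps the piece of degree k of the tensor product into M_k(V) (modular_Pval), and
    onto it (modular_V_image). Injectivity is pointwise (Pmap_inj): the exponential
    is invertible, and a tensor is determined by its values in V (tensor_eval_inj).
    Holomorphy is deduced from the q-expansions throughout (qseries_holomorphic).

    The transformation of E2 under - 1 / tau is Eisenstein's. Up to the factor
    pi^2 / 3, E2(tau) is the sum over m of the sums over n of 1 / (m tau + n)^2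
    (G2_E2), and tau^-2 E2(- 1 / tau) is the same double series summed in the other
    order. It does not converge absolutely, but it does after subtraction of the
    telescoping terms 1 / (x - 1/2) - 1 / (x + 1/2) with x = m tau + n; the two orders
    then agree (zsums_exchange), and the telescoping terms contribute nothing in one
    order and cotangents, of limits pi i and - pi i, in the other (G2_inv). Lambert
    series identify the iterated sum with the q-series (lambert_sigma).

    Two classical expansions enter. That of pi^2 / sin^2 (zsums_sqr) is proved by
    Herglotz' trick, and at z = 1/2 it yields the constant term pi^2 / 3. That of the
    cotangent (zsums_cot) follows by comparing derivatives along a path that starts
    at 1/2. *)

(** * Complex sequences and series *)

(** The topology of C is carried by its regular module. *)
Notation tends u l := ((fun n : nat => u n : _^o) @ \oo --> (l : _^o)).
Notation sums u l := (series (fun n : nat => u n : _^o) @ \oo --> (l : _^o)).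

Section ComplexSequences.
Variable R : realType.
Local Notation C := R[i].
Implicit Types (z w : C) (u v : nat -> C).

(** The order on C is only partial; estimates are carried out on this real modulus. *)
Definition cn z : R := complex.Re `|z|.

Lemma cnE z : `|z| = (cn z)%:C.
Proof. by rewrite /cn RRe_real // normr_real. Qed.

Lemma cn_ge0 z : 0 <= cn z.
Proof. by rewrite -lecR -cnE normr_ge0. Qed.

Lemma cn0 : cn 0 = 0. Proof. by rewrite /cn normr0. Qed.
Lemma cn1 : cn 1 = 1. Proof. by rewrite /cn normr1. Qed.
Lemma cnN z : cn (- z) = cn z. Proof. by rewrite /cn normrN. Qed.
Lemma cnM z w : cn (z * w) = cn z * cn w.
Proof. by apply: complexI; rewrite rmorphM /= -!cnE normrM. Qed.
Lemma cnX z n : cn (z ^+ n) = cn z ^+ n.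
Proof. by apply: complexI; rewrite rmorphXn /= -!cnE normrX. Qed.
Lemma cnV z : cn z^-1 = (cn z)^-1.
Proof. by apply: complexI; rewrite fmorphV /= -!cnE normfV. Qed.
Lemma cnD z w : cn (z + w) <= cn z + cn w.
Proof. by rewrite -lecR rmorphD /= -!cnE ler_normD. Qed.
Lemma cnB z w : cn (z - w) <= cn z + cn w.
Proof. by rewrite -(cnN w) cnD. Qed.
Lemma cn_eq0 z : (cn z == 0) = (z == 0).
Proof. by rewrite -(inj_eq (@complexI R)) -cnE normr_eq0. Qed.
Lemma cn_gt0 z : (0 < cn z) = (z != 0).
Proof. by rewrite lt0r cn_eq0 cn_ge0 andbT. Qed.
Lemma cn_sum (I : Type) (r : seq I) (P : pred I) (F : I -> C) :
  cn (\sum_(i <- r | P i) F i) <= \sum_(i <- r | P i) cn (F i).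
Proof.
elim/big_rec2: _ => [|i y x _ h]; first by rewrite cn0.
by apply: le_trans (cnD _ _) _; rewrite lerD2l.
Qed.
Lemma cn_leD z w : cn z - cn w <= cn (z + w).
Proof. by rewrite lerBlDr -{1}(addrK w z); apply: cnB. Qed.

Lemma cn_sqr z : cn z ^+ 2 = complex.Re z ^+ 2 + complex.Im z ^+ 2.
Proof. by apply: complexI; rewrite rmorphXn /= -cnE -add_Re2_Im2. Qed.

Lemma cn_real (x : R) : cn x%:C = `|x|.
Proof. by apply/eqP; rewrite -(@eqrXn2 _ 2) ?cn_ge0 // cn_sqr /= expr0n addr0 real_normK // num_real. Qed.

Lemma cn_nat n : cn n%:R = n%:R.
Proof. by rewrite -(rmorph_nat (real_complex R)) cn_real ger0_norm. Qed.

Lemma cn_int (m : int) : cn m%:~R = `|m|%:~R.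
Proof. by rewrite intr_complex cn_real intr_norm. Qed.

Lemma cn_i : cn 'i = 1.
Proof. by apply/eqP; rewrite -(@eqrXn2 _ 2) ?cn_ge0 // cn_sqr /= expr0n expr1n add0r. Qed.

Lemma cn_Re z : `|complex.Re z| <= cn z.
Proof. by rewrite -ler_sqr ?nnegrE ?cn_ge0 // cn_sqr real_normK ?num_real // lerDl sqr_ge0. Qed.
Lemma cn_Im z : `|complex.Im z| <= cn z.
Proof. by rewrite -ler_sqr ?nnegrE ?cn_ge0 // cn_sqr real_normK ?num_real // lerDr sqr_ge0. Qed.
Lemma cn_ReIm z : cn z <= `|complex.Re z| + `|complex.Im z|.
Proof.
rewrite [z in leLHS]complexE; apply: le_trans (cnD _ _) _.
by rewrite cnM cn_i mul1r !cn_real.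
Qed.

(** Transfers complex limits to R, where squeezing is available. *)
Lemma tendsP u (l : C) :
  tends u l <-> ((fun n => cn (u n - l)) @ \oo --> (0 : R)).
Proof.
split=> [/cvgrPdist_lt h|/cvgr0Pnorm_lt h].
  apply/cvgr0Pnorm_lt => e e0.
  have := h e%:C; rewrite (@ltcR _ 0) => /(_ e0); apply: filterS => n.
  by rewrite distrC cnE ltcR ger0_norm ?cn_ge0.
apply/cvgrPdist_lt => e e0.
have [r er] : exists r, e = r%:C by exists (complex.Re e); rewrite RRe_real // gtr0_real.
have r0 : 0 < r by rewrite -ltcR -er.
have := h _ r0; apply: filterS => n.
by rewrite distrC cnE er ltcR ger0_norm ?cn_ge0.
Qed.

Lemma tends_bound u (l : C) (e : nat -> R) :
  (forall n, cn (u n - l) <= e n) -> e @ \oo --> (0 : R) -> tends u l.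
Proof.
move=> ue e0; apply/tendsP.
apply: (@squeeze_cvgr _ _ _ _ (cst 0) e) => //; last exact: cvg_cst.
by apply: nearW => n; rewrite cn_ge0 ue.
Qed.

Lemma tends_unique u (l l' : C) : tends u l -> tends u l' -> l = l'.
Proof.
move=> ul ul'; exact: (@norm_cvg_unique _ C^o _ _ _ _ ul ul').
Qed.

Lemma tends_cn u (l : C) : tends u l -> (fun n => cn (u n)) @ \oo --> cn l.
Proof.
move=> /tendsP h; apply/cvgrPdist_lt => e e0.
move/cvgr0Pnorm_lt : h => /(_ e e0); apply: filterS => n.
rewrite ger0_norm ?cn_ge0 //; apply: le_lt_trans.
have := cn_leD (u n) (- l); have := cn_leD l (- u n).
by rewrite !cnN -[cn (l - u n)]cnN opprB ler_norml; lra.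
Qed.

Lemma tends_cn_le u (l : C) (B : R) : tends u l -> (forall n, cn (u n) <= B) -> cn l <= B.
Proof.
by move=> /tends_cn h uB; apply: (cvgr_to_le h); apply: nearW.
Qed.

Lemma tends_cst (l : C) : tends (fun=> l) l. Proof. exact: cvg_cst. Qed.
Arguments tends_cst l : clear implicits.
Lemma tendsD u v (l m : C) : tends u l -> tends v m -> tends (fun n => u n + v n) (l + m).
Proof. exact: cvgD. Qed.
Lemma tendsB u v (l m : C) : tends u l -> tends v m -> tends (fun n => u n - v n) (l - m).
Proof. exact: cvgB. Qed.
Lemma tendsM u v (l m : C) : tends u l -> tends v m -> tends (fun n => u n * v n) (l * m).
Proof. by move=> ul vm; apply: (@cvgM C nat \oo) ul vm. Qed.
Lemma tendsZ c u (l : C) : tends u l -> tends (fun n => c * u n) (c * l).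
Proof. by move=> ul; apply: tendsM ul; apply: tends_cst. Qed.
Lemma tendsS u (l : C) : tends (fun n => u n.+1) l <-> tends u l.
Proof. by rewrite -(cvg_shiftS (u : nat -> C^o)). Qed.
Lemma tends_sub u (l : C) (k : nat -> nat) : (forall n, n <= k n)%N ->
  tends u l -> tends (fun n => u (k n)) l.
Proof.
move=> nk ul; apply: (@cvg_comp _ _ _ k u \oo \oo) => //.
by move=> A [N _ NA]; exists N => // n /= Nn; apply: NA => /=; apply: leq_trans (nk n).
Qed.

Lemma tends_ReIm u (l : C) : (fun n => complex.Re (u n)) @ \oo --> complex.Re l ->
  (fun n => complex.Im (u n)) @ \oo --> complex.Im l -> tends u l.
Proof.
have nn (p : nat -> R) a : p @ \oo --> a -> (fun n => `|p n - a|) @ \oo --> (0 : R).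
  move=> /cvgrPdist_lt h; apply/cvgr0Pnorm_lt => e /h; apply: filterS => n.
  by rewrite normr_id distrC.
move=> /nn hR /nn hI.
have h0 : (fun n => `|complex.Re (u n) - complex.Re l| + `|complex.Im (u n) - complex.Im l|) @ \oo --> (0 : R).
  by rewrite -[0 : R]addr0; apply: cvgD.
apply: (tends_bound _ h0) => n; apply: le_trans (cn_ReIm _) _.
by rewrite !raddfB.
Qed.

(** Absolute convergence together with an explicit bound, which then passes to
    the sums of dominated series. *)
Definition bsums (a : nat -> R) B := (forall n, 0 <= a n) /\
  forall N, \sum_(n < N) a n <= B.

Lemma bsums_cvg (a : nat -> R) B : bsums a B -> cvgn (series a).
Proof.
move=> [a0 aB]; apply: nondecreasing_is_cvgn.
  by apply: nondecreasing_series => n _ _; apply: a0.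
by exists B => _ [N _ <-]; rewrite /series /= big_mkord.
Qed.

Lemma bsumsZ c (a : nat -> R) B : 0 <= c -> bsums a B -> bsums (fun n => c * a n) (c * B).
Proof.
move=> c0 [a0 aB]; split=> [n|N]; first by rewrite mulr_ge0.
by rewrite -mulr_sumr ler_wpM2l.
Qed.

Lemma bsums_ge0 (a : nat -> R) B : bsums a B -> 0 <= B.
Proof. by move=> [_ /(_ 0%N)]; rewrite big_ord0. Qed.

(** The tail sequence is the limit minus the partial sums. *)
Lemma bsums_tail (a : nat -> R) B : bsums a B ->
  exists t : nat -> R, [/\ t @ \oo --> (0 : R),
    (forall N, t N <= B) &
    forall N M, (N <= M)%N -> \sum_(N <= n < M) a n <= t N].
Proof.
move=> aB; have cv := bsums_cvg aB.
exists (fun N => limn (series a) - series a N); split.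
- rewrite -(subrr (limn (series a))).
  by apply: cvgB => //; apply: cvg_cst.
- case: aB => a0 aB N; apply: (@le_trans _ _ (limn (series a))).
    by rewrite gerBl /series /= sumr_ge0.
  by apply: limr_le => //; apply: nearW => n; rewrite /series /= big_mkord.
move=> N M NM; case: aB => a0 _.
have -> : \sum_(N <= n < M) a n = series a M - series a N.
  by rewrite sub_series_geq.
rewrite lerD2r; apply: nondecreasing_cvgn_le => //.
by apply: nondecreasing_series => n _ _; apply: a0.
Qed.

(** Real and imaginary parts are dominated by the modulus, so both converge
    absolutely. *)
Lemma sums_bounded u (a : nat -> R) B : bsums a B -> (forall n, cn (u n) <= a n) ->
  exists l : C, sums u l.
Proof.
move=> aB ua; have cv := bsums_cvg aB.
have cvr (p : C -> R) : (forall z, `|p z| <= cn z) -> cvgn (series (fun n => p (u n))).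
  move=> pn; apply: normed_cvg; apply: series_le_cvg cv => n //=.
  - exact: aB.1.
  - exact: le_trans (pn _) (ua n).
exists (limn (series (fun n => complex.Re (u n))) +i* limn (series (fun n => complex.Im (u n)))).
apply: tends_ReIm => /=.
- rewrite (_ : (fun _ => _) = series (fun n => complex.Re (u n))); first exact: (cvr _ (@cn_Re)).
  by apply/funext => n; rewrite /series /= raddf_sum.
- rewrite (_ : (fun _ => _) = series (fun n => complex.Im (u n))); first exact: (cvr _ (@cn_Im)).
  by apply/funext => n; rewrite /series /= raddf_sum.
Qed.

Lemma sums_cn_le u (l : C) (a : nat -> R) B : bsums a B -> (forall n, cn (u n) <= a n) ->
  sums u l -> cn l <= B.
Proof.
move=> [_ aB] ua ul; apply: (tends_cn_le ul) => N; rewrite /series /= big_mkord.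
by apply: le_trans (cn_sum _ _ _) _; apply: le_trans (aB N); apply: ler_sum.
Qed.

Lemma sums_tail u (l : C) (a t : nat -> R) :
  (forall N M, (N <= M)%N -> \sum_(N <= n < M) a n <= t N) ->
  (forall n, cn (u n) <= a n) -> sums u l ->
  forall N, cn (l - \sum_(n < N) u n) <= t N.
Proof.
move=> at_ ua ul N.
have -> : \sum_(n < N) u n = series (u : nat -> C^o) N by rewrite /series /= big_mkord.
have h : tends (fun M => series (u : nat -> C^o) (M + N)%N - series (u : nat -> C^o) N)
    (l - series (u : nat -> C^o) N).
  apply: tendsB; last exact: (tends_cst _).
  by apply: (tends_sub _ ul) => n; rewrite leq_addr.
apply: (tends_cn_le h) => M.
rewrite sub_series_geq ?leq_addl //; apply: le_trans (cn_sum _ _ _) _.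
by apply: le_trans (at_ N _ (leq_addl M N)); apply: ler_sum.
Qed.

Lemma tends_ext u v (l : C) : u =1 v -> tends u l -> tends v l.
Proof. by move=> uv; have -> : v = u by apply/funext => n; rewrite uv. Qed.

Lemma sums_ext u v (l : C) : u =1 v -> sums u l -> sums v l.
Proof. by move=> uv; have -> : v = u by apply/funext => n; rewrite uv. Qed.

Lemma sumsE u (l : C) : sums u l <-> tends (fun N => \sum_(n < N) u n) l.
Proof.
by split; apply: tends_ext => N; rewrite /series /= big_mkord.
Qed.

(** The sum over m < M, n < N differs from the sum of the first M rows by at most
    A times the N-th tail of b. This bound is uniform in M, so it also bounds the
    distance from the sum of the first N columns to X. *)
Lemma sums_exchange (f : nat -> nat -> C) (a b : nat -> R) A B
    (r s : nat -> C) (X : C) :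
  bsums a A -> bsums b B -> (forall m n, cn (f m n) <= a m * b n) ->
  (forall m, sums (f m) (r m)) -> (forall n, sums (f^~ n) (s n)) ->
  sums r X -> sums s X.
Proof.
move=> aA bB fab fr fs rX.
have [t [t0 tB bt]] := bsums_tail bB.
apply/sumsE; apply: (@tends_bound _ _ (fun N => A * t N)); last first.
  by rewrite -[0](mulr0 A); apply: cvgM t0; apply: cvg_cst.
move=> N.
have hM : tends (fun M => \sum_(n < N) \sum_(m < M) f m n - \sum_(m < M) r m)
                (\sum_(n < N) s n - X).
  apply: tendsB; last exact/sumsE.
  elim: N => [|N IHN].
    by rewrite big_ord0; apply: (tends_ext _ (tends_cst 0)) => M; rewrite big_ord0.
  rewrite big_ord_recr; apply: (tends_ext _ (tendsD IHN ((sumsE _ _).1 (fs N)))) => M.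
  by rewrite big_ord_recr.
apply: (tends_cn_le hM) => M; rewrite exchange_big /= -sumrB.
apply: le_trans (cn_sum _ _ _) _.
have tN : 0 <= t N by apply: le_trans (bt N N (leqnn _)); rewrite big_geq.
apply: (@le_trans _ _ (\sum_(m < M) a m * t N)); last first.
  by rewrite -mulr_suml ler_wpM2r // aA.2.
apply: ler_sum => m _; rewrite -cnN opprB.
apply: (@sums_tail _ _ (fun n => a m * b n) (fun N => a m * t N) _ (fab m) (fr m)).
move=> N' M' NM; rewrite -mulr_sumr ler_wpM2l ?aA.1 //; exact: bt.
Qed.

End ComplexSequences.

Arguments tends_cst {R} l.

(** * Estimates for exponential, sine and hyperbolic sine *)

Section RealEstimates.
Variable R : realType.
Implicit Types x y : R.

Lemma mean_value0 (f df : R -> R) x : (forall t : R, is_derive t 1 f (df t)) ->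
  exists2 c, `|c| <= `|x| & f x - f 0 = df c * x.
Proof.
move=> fd.
have fc a b : {within `[a, b], continuous f}.
  apply: continuous_subspaceT => t.
  by apply/differentiable_continuous/derivable1_diffP; apply: (@ex_derive _ _ _ _ _ _ _ (fd t)).
have [x0|x0] := leP 0 x.
  have [c] := @MVT_segment R f df 0 x x0 (fun t _ => fd t) (fc _ _).
  by rewrite in_itv /= subr0 => /andP[c0 cx] h; exists c => //; rewrite !ger0_norm.
have [c] := @MVT_segment R f df x 0 (ltW x0) (fun t _ => fd t) (fc _ _).
rewrite in_itv /= sub0r => /andP[c0 cx] h; exists c.
  by rewrite !ler0_norm ?lerN2 // ltW.
by rewrite -opprB h mulrN opprK.
Qed.

Lemma sin_le x : `|sin x| <= `|x|.
Proof.
have [c _] := @mean_value0 sin cos x (fun t => is_derive_sin t).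
rewrite sin0 subr0 => ->; rewrite normrM ler_piMl //; exact: cos_max.
Qed.

Lemma cos_ge x : 1 - cos x <= x ^+ 2 / 2.
Proof.
have -> : 1 - cos x = 2 * sin (x / 2) ^+ 2.
  have {1}-> : x = (x / 2) *+ 2 by rewrite -mulr_natr divfK ?pnatr_eq0.
  by rewrite cos_mulr2n cos2sin2; ring.
have := sin_le (x / 2); rewrite -ler_sqr ?nnegrE // !real_normK ?num_real //; lra.
Qed.

Lemma sin_sub_le x : `|sin x - x| <= `|x| ^+ 3 / 2.
Proof.
have [c cx] := @mean_value0 sin cos x (fun t => is_derive_sin t).
rewrite sin0 subr0 => ->; rewrite -[x in - x]mul1r -mulrBl normrM.
have : `|cos c - 1| <= `|x| ^+ 2 / 2.
  rewrite distrC ger0_norm ?subr_ge0 ?cos_le1 //; apply: le_trans (cos_ge _) _.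
  by rewrite ler_pM2r // -[c ^+ 2]real_normK ?num_real // ler_sqr ?nnegrE.
by move=> h; rewrite exprSr mulrAC ler_wpM2r.
Qed.

(** Here sin y = 2 sin (y/2) cos (y/2) and sin (y/2) = (y/2) cos c, where both
    cosines are taken at angles up to pi/4, so their squares are at least 1/2. *)
Lemma sin_ge y : `|y| <= pi / 2 -> `|y| / 2 <= `|sin y|.
Proof.
move=> yp.
have [c cx] := @mean_value0 sin cos (y / 2) (fun t => is_derive_sin t).
rewrite sin0 subr0 => s2.
have p0 := @pi_gt0 R.
have cle (t : R) : `|t| <= pi / 4 -> 2^-1 <= cos t ^+ 2.
  move=> tp.
  have := @cos_mulr2n R t.
  have : 0 <= cos (t *+ 2).
    apply: cos_ge0_pihalf; move: tp; rewrite ler_norml => /andP[]; lra.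
  by rewrite mulr2n; lra.
have y4 : `|y / 2| <= pi / 4 by rewrite normrM normfV (ger0_norm (_ : 0 <= 2)) //; lra.
have c2 := cle _ (le_trans cx y4); have y2 := cle _ y4.
have -> : sin y = (cos c * cos (y / 2)) * y.
  have {1}-> : y = (y / 2) *+ 2 by rewrite -mulr_natr divfK ?pnatr_eq0.
  by rewrite sin_mulr2n s2; field.
rewrite normrM mulrC ler_wpM2r // -ler_sqr ?nnegrE ?invr_ge0 // real_normK ?num_real //.
rewrite exprMn; have := ler_pM (_ : 0 <= 2^-1 :> R) (_ : 0 <= 2^-1 :> R) c2 y2.
by rewrite expr2; apply.
Qed.

Lemma expR_quad x : `|x| <= 1 / 2 -> `|expR x - 1 - x| <= 2 * x ^+ 2.
Proof.
move=> xh; have x12 : x <= 1 / 2 by move: xh; rewrite ler_norml => /andP[].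
have := expR_ge1Dx x => h1; rewrite ger0_norm; last by lra.
have h2 := expR_ge1Dx (- x); have e0 := expR_gt0 x.
have h3 : expR x * (1 - x) <= 1.
  by rewrite -[leRHS](expRxMexpNx_1 x) ler_wpM2l ?expR_ge0 //; lra.
have : (expR x - 1 - x) * (1 - x) <= x ^+ 2 by nra.
have : 0 <= expR x - 1 - x by lra.
nra.
Qed.

Definition sinhR x := (expR x - expR (- x)) / 2.
Definition coshR x := (expR x + expR (- x)) / 2.

Lemma is_derive_sinhR (x : R) : is_derive x 1 sinhR (coshR x).
Proof.
have h1 := is_derive_expR x.
have h2 : is_derive x 1 (expR \o -%R) (- expR (- x)).
  have h := @is_derive1_comp R _ _ _ _ _ (is_derive_expR (- x)) (is_deriveN (is_derive_id x 1)).
  by apply: is_derive_eq; rewrite mulrN1.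
have -> : @sinhR = 2^-1 *: (expR - (expR \o -%R)) :> (R -> R).
  by apply/funext => t; rewrite /sinhR mulrC.
have h3 := is_deriveZ 2^-1 (is_deriveB h1 h2).
by apply: is_derive_eq; rewrite opprK /coshR mulrC.
Qed.

Lemma coshR_ge1 x : 1 <= coshR x.
Proof. by rewrite /coshR; have := expR_ge1Dx x; have := expR_ge1Dx (- x); lra. Qed.

Lemma coshR_quad x : `|x| <= 1 / 2 -> coshR x - 1 <= 2 * x ^+ 2.
Proof.
move=> h; have := expR_quad h; have := @expR_quad (- x); rewrite normrN => /(_ h).
by rewrite !ler_norml sqrrN /coshR; lra.
Qed.

Lemma sinhR_ge x : `|x| <= `|sinhR x|.
Proof.
have [c _] := @mean_value0 sinhR coshR x is_derive_sinhR.
rewrite {2}/sinhR oppr0 subrr mul0r subr0 => ->; rewrite normrM ler_peMl //.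
by rewrite ger0_norm (coshR_ge1, le_trans ler01 (coshR_ge1 _)).
Qed.

Lemma sinhR_sub x : `|x| <= 1 / 2 -> `|sinhR x - x| <= 2 * `|x| ^+ 3.
Proof.
move=> x2; have [c cx] := @mean_value0 sinhR coshR x is_derive_sinhR.
rewrite {2}/sinhR oppr0 subrr mul0r subr0 => ->.
rewrite -[x in - x]mul1r -mulrBl normrM exprSr mulrA ler_wpM2r //.
rewrite ger0_norm ?subr_ge0 ?coshR_ge1 //.
apply: le_trans (coshR_quad (le_trans cx x2)) _; rewrite ler_pM2l //.
by rewrite -[c ^+ 2]real_normK ?num_real // ler_sqr ?nnegrE.
Qed.

Lemma coshR2 x : coshR x ^+ 2 = 1 + sinhR x ^+ 2.
Proof.
rewrite /coshR /sinhR; have := expRxMexpNx_1 x; set a := expR x; set b := expR _.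
move=> ab; have -> : ((a + b) / 2) ^+ 2 = a * b + ((a - b) / 2) ^+ 2 by field.
by rewrite ab.
Qed.

End RealEstimates.

Section ComplexExponential.
Variable R : realType.
Local Notation C := R[i].
Implicit Types (z w v : C).

Lemma ReD z w : complex.Re (z + w) = complex.Re z + complex.Re w. Proof. exact: raddfD. Qed.
Lemma ImD z w : complex.Im (z + w) = complex.Im z + complex.Im w. Proof. exact: raddfD. Qed.
Lemma ReN z : complex.Re (- z) = - complex.Re z. Proof. exact: raddfN. Qed.
Lemma ImN z : complex.Im (- z) = - complex.Im z. Proof. exact: raddfN. Qed.
Lemma ReB z w : complex.Re (z - w) = complex.Re z - complex.Re w. Proof. exact: raddfB. Qed.
Lemma ImB z w : complex.Im (z - w) = complex.Im z - complex.Im w. Proof. exact: raddfB. Qed.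
Lemma Re_mul z w : complex.Re (z * w) =
  complex.Re z * complex.Re w - complex.Im z * complex.Im w.
Proof. by case: z w => [a b] [c d]. Qed.
Lemma Im_mul z w : complex.Im (z * w) =
  complex.Re z * complex.Im w + complex.Im z * complex.Re w.
Proof. by case: z w => [a b] [c d]. Qed.
Lemma Re_half z : complex.Re (z / 2) = complex.Re z / 2.
Proof.
by rewrite -(rmorph_nat (real_complex R)) -fmorphV Re_mul /= mulr0 subr0.
Qed.
Lemma Im_half z : complex.Im (z / 2) = complex.Im z / 2.
Proof.
by rewrite -(rmorph_nat (real_complex R)) -fmorphV Im_mul /= mulr0 add0r.
Qed.

Lemma half_realE : (1 / 2 : R)%:C = 1 / 2 :> C.
Proof. by rewrite rmorphM rmorph1 fmorphV /= rmorph_nat. Qed.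

Lemma complexP z w : complex.Re z = complex.Re w -> complex.Im z = complex.Im w -> z = w.
Proof. by case: z w => [a b] [c d] /= -> ->. Qed.

Lemma cexpE z : cexp z =
  (expR (complex.Re z) * cos (complex.Im z)) +i* (expR (complex.Re z) * sin (complex.Im z)).
Proof. by apply: complexP; rewrite /cexp ?Re_mul ?Im_mul /= ?mul0r ?subr0 ?addr0. Qed.

Lemma cexpD z w : cexp (z + w) = cexp z * cexp w.
Proof.
rewrite !cexpE ReD ImD expRD cosD sinD; apply: complexP; rewrite ?Re_mul ?Im_mul /=; ring.
Qed.

Lemma cexp0 : cexp 0 = 1 :> C.
Proof. by rewrite cexpE /= expR0 cos0 sin0 mulr1 mulr0. Qed.

Lemma cn_cexp z : cn (cexp z) = expR (complex.Re z).
Proof. by apply: complexI; rewrite -cnE norm_cexp. Qed.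

Lemma cexp_neq0 z : cexp z != 0.
Proof. by rewrite -cn_gt0 cn_cexp expR_gt0. Qed.

Lemma cexpN z : cexp (- z) = (cexp z)^-1.
Proof.
by apply: (mulfI (cexp_neq0 z)); rewrite -cexpD subrr cexp0 divff // cexp_neq0.
Qed.

Lemma cexpMn z n : cexp (n%:R * z) = cexp z ^+ n.
Proof.
by elim: n => [|n IHn]; rewrite ?mul0r ?cexp0 // -natr1 mulrDl mul1r cexpD IHn exprSr.
Qed.

(** First-order Taylor estimate; it is what makes the exponential, and every
    power series in it, complex differentiable. *)
Lemma cexp_quad z : cn z <= 1 / 2 -> cn (cexp z - 1 - z) <= 3 * cn z ^+ 2.
Proof.
move=> z2; apply: le_trans (cn_ReIm _) _.
rewrite !(ReB, ImB) cexpE /= subr0 cn_sqr.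
have xz := cn_Re z; have yz := cn_Im z.
move: (complex.Re z) (complex.Im z) xz yz => x y xz yz.
have x2 := le_trans xz z2; have y2 := le_trans yz z2.
have ex := expR_quad x2.
have cy : `|cos y - 1| <= y ^+ 2 / 2.
  by rewrite distrC ger0_norm ?subr_ge0 ?cos_le1 // cos_ge.
have sy := sin_sub_le y; have sy1 := sin_le y.
have e1 : `|expR x - 1| <= 2 * `|x|.
  have -> : expR x - 1 = (expR x - 1 - x) + x by ring.
  apply: le_trans (ler_normD _ _) _.
  have : 2 * x ^+ 2 <= `|x|.
    by rewrite -[x ^+ 2]real_normK ?num_real //; have := normr_ge0 x; nra.
  lra.
have h1 : `|expR x * cos y - 1 - x| <= 2 * x ^+ 2 + 3 / 2 * (y ^+ 2 / 2).
  have -> : expR x * cos y - 1 - x = (expR x - 1 - x) * cos y + (1 + x) * (cos y - 1) by ring.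
  apply: le_trans (ler_normD _ _) _; rewrite !normrM; apply: lerD.
    by apply: le_trans ex; rewrite ler_piMr // cos_max.
  apply: ler_pM => //; apply: le_trans (ler_normD _ _) _; rewrite normr1; lra.
have h2 : `|expR x * sin y - y| <= (x ^+ 2 + y ^+ 2) + y ^+ 2 / 4.
  have -> : expR x * sin y - y = (expR x - 1) * sin y + (sin y - y) by ring.
  apply: le_trans (ler_normD _ _) _; rewrite normrM; apply: lerD.
    apply: (@le_trans _ _ (2 * `|x| * `|y|)); first exact: ler_pM.
    rewrite -[x ^+ 2]real_normK ?num_real // -[y ^+ 2]real_normK ?num_real //.
    by have := sqr_ge0 (`|x| - `|y|); rewrite sqrrB; lra.
  apply: le_trans sy _; rewrite exprS -[y ^+ 2]real_normK ?num_real //.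
  have := normr_ge0 y; nra.
have := sqr_ge0 x; have := sqr_ge0 y; lra.
Qed.

Lemma cexp_lip z : cn z <= 1 / 2 -> cn (cexp z - 1) <= 3 * cn z.
Proof.
move=> h; have := cexp_quad h; have := cn_ge0 z => z0.
rewrite -{2}[cexp z - 1](subrK z) => hq; apply: le_trans (cnD _ _) _.
have : 3 * cn z ^+ 2 <= 3 / 2 * cn z by nra.
by lra.
Qed.

Definition csinh v := (cexp v - cexp (- v)) / 2.

Lemma Re_csinh v : complex.Re (csinh v) = sinhR (complex.Re v) * cos (complex.Im v).
Proof. by rewrite /csinh Re_half ReB !cexpE /= ReN ImN cosN /sinhR; ring. Qed.
Lemma Im_csinh v : complex.Im (csinh v) = coshR (complex.Re v) * sin (complex.Im v).
Proof. by rewrite /csinh Im_half ImB !cexpE /= ReN ImN sinN /coshR; ring. Qed.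

(** |sinh (x + i y)|^2 = sinh^2 x + sin^2 y. *)
Lemma csinh_ge v : `|complex.Im v| <= pi / 2 -> cn v / 2 <= cn (csinh v).
Proof.
move=> vp; rewrite -ler_sqr ?nnegrE ?divr_ge0 ?cn_ge0 //.
rewrite exprMn !cn_sqr Re_csinh Im_csinh.
move: (complex.Re v) (complex.Im v) vp => x y vp.
rewrite [(sinhR x * _) ^+ 2]exprMn [(coshR x * _) ^+ 2]exprMn coshR2 cos2sin2.
have -> : sinhR x ^+ 2 * (1 - sin y ^+ 2) + (1 + sinhR x ^+ 2) * sin y ^+ 2 = sinhR x ^+ 2 + sin y ^+ 2 by ring.
have h1 : x ^+ 2 <= sinhR x ^+ 2.
  by have := sinhR_ge x; rewrite -ler_sqr ?nnegrE // !real_normK ?num_real.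
have h2 : (y / 2) ^+ 2 <= sin y ^+ 2.
  have := sin_ge vp; rewrite -ler_sqr ?nnegrE ?divr_ge0 // real_normK ?num_real //.
  by rewrite exprMn real_normK ?num_real // -exprMn.
have := sqr_ge0 x; rewrite exprMn in h2; lra.
Qed.

(** The function being odd, the error is cubic and not just quadratic; the
    cancellation of poles below depends on it. *)
Lemma csinh_sub v : cn v <= 1 / 2 -> cn (csinh v - v) <= 4 * cn v ^+ 3.
Proof.
move=> v2; apply: le_trans (cn_ReIm _) _.
rewrite !(ReB, ImB) Re_csinh Im_csinh exprS cn_sqr.
have xz := cn_Re v; have yz := cn_Im v.
move: (complex.Re v) (complex.Im v) (cn v) xz yz v2 => x y r xz yz v2.
have x2 := le_trans xz v2; have y2 := le_trans yz v2.
have sx := sinhR_sub x2; have cx := coshR_quad x2.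
have cy : `|cos y - 1| <= y ^+ 2 / 2.
  by rewrite distrC ger0_norm ?subr_ge0 ?cos_le1 // cos_ge.
have sy := sin_sub_le y; have sy1 := sin_le y.
have e3 (t : R) : `|t| ^+ 3 = `|t| * t ^+ 2 by rewrite exprS real_normK ?num_real.
rewrite !e3 in sx sy.
have h1 : `|sinhR x * cos y - x| <= `|x| * (2 * (x ^+ 2 + y ^+ 2)).
  have -> : sinhR x * cos y - x = (sinhR x - x) * cos y + x * (cos y - 1) by ring.
  apply: le_trans (ler_normD _ _) _; rewrite !normrM.
  apply: (@le_trans _ _ (2 * (`|x| * x ^+ 2) + `|x| * (y ^+ 2 / 2))).
    apply: lerD; last exact: ler_wpM2l.
    by apply: le_trans sx; rewrite ler_piMr // cos_max.
  by have := normr_ge0 x; have := sqr_ge0 y; nra.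
have h2 : `|coshR x * sin y - y| <= `|y| * (2 * (x ^+ 2 + y ^+ 2)).
  have -> : coshR x * sin y - y = (coshR x - 1) * sin y + (sin y - y) by ring.
  apply: le_trans (ler_normD _ _) _; rewrite !normrM.
  rewrite (ger0_norm (_ : 0 <= coshR x - 1)) ?subr_ge0 ?coshR_ge1 //.
  apply: (@le_trans _ _ (2 * x ^+ 2 * `|y| + `|y| * y ^+ 2 / 2)).
    by apply: lerD => //; apply: ler_pM => //; rewrite subr_ge0 coshR_ge1.
  by have := normr_ge0 y; have := sqr_ge0 y; nra.
have s0 : 0 <= 2 * (x ^+ 2 + y ^+ 2) by rewrite mulr_ge0 // addr_ge0 // sqr_ge0.
apply: le_trans (lerD h1 h2) _; rewrite -mulrDl.
apply: (@le_trans _ _ ((2 * r) * (2 * (x ^+ 2 + y ^+ 2)))); last by lra.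
by apply: ler_wpM2r => //; lra.
Qed.

(** Near 0 the difference is (v - sinh v) (v + sinh v) / (v sinh v)^2, whose
    numerator and denominator both have order 4; away from 0 the two terms are
    bounded separately. *)
Lemma csinh_pole v : v != 0 -> `|complex.Im v| <= pi / 2 ->
  cn ((csinh v ^+ 2)^-1 - (v ^+ 2)^-1) <= 48.
Proof.
move=> v0 vp; have sg := csinh_ge vp.
have c0 : 0 < cn v by rewrite cn_gt0.
have s0 : 0 < cn (csinh v) by lra.
have s0' : csinh v != 0 by rewrite -cn_gt0.
have [v2|v2] := leP (cn v) (1 / 2).
  have -> : (csinh v ^+ 2)^-1 - (v ^+ 2)^-1 = - (csinh v - v) * (csinh v + v) / (csinh v ^+ 2 * v ^+ 2).
    by field; rewrite v0.
  rewrite 2!cnM cnN cnV (cnM (_ ^+ 2)) !cnX ler_pdivrMr; last by rewrite mulr_gt0 // exprn_gt0.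
  have h := csinh_sub v2; have hs := cnD (csinh v - v) (v + v).
  have h2 : cn (csinh v + v) <= cn (csinh v - v) + 2 * cn v.
    have -> : csinh v + v = (csinh v - v) + (v + v) by ring.
    by apply: le_trans hs _; rewrite lerD2l mulr_natl mulr2n cnD.
  have h3 : 4 * cn v ^+ 3 <= cn v.
    by rewrite exprSr mulrA ler_piMl ?cn_ge0 //; nra.
  have a0 := cn_ge0 (csinh v - v).
  apply: (@le_trans _ _ ((4 * cn v ^+ 3) * (3 * cn v))).
    by apply: ler_pM => //; rewrite ?cn_ge0 //; lra.
  apply: (@le_trans _ _ (48 * ((cn v / 2) ^+ 2 * cn v ^+ 2))).
    by rewrite le_eqVlt; apply/orP; left; apply/eqP; field.
  rewrite ler_wpM2l // ler_wpM2r ?sqr_ge0 // ler_sqr ?nnegrE ?divr_ge0 ?cn_ge0 //.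
apply: le_trans (cnB _ _) _; rewrite !cnV !cnX.
have h1 : (cn v ^+ 2)^-1 <= 4.
  rewrite -[leRHS]invrK lef_pV2 ?posrE ?exprn_gt0 ?invr_gt0 //.
  by have := ltW v2; rewrite -ler_sqr ?nnegrE ?cn_ge0 //; lra.
have h2 : (cn (csinh v) ^+ 2)^-1 <= 16.
  rewrite -[leRHS]invrK lef_pV2 ?posrE ?exprn_gt0 ?invr_gt0 //.
  have : 1 / 4 <= cn (csinh v) by lra.
  by rewrite -ler_sqr ?nnegrE ?cn_ge0 //; lra.
lra.
Qed.

End ComplexExponential.

(** * Power series in q are holomorphic *)

Section SummableSequences.
Variable R : realType.

Lemma bsums_geo (r : R) : 0 <= r < 1 -> bsums (fun n => r ^+ n) (1 - r)^-1.
Proof.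
move=> /andP[r0 r1]; split=> [n|N]; first exact: exprn_ge0.
have h : 0 < 1 - r by rewrite subr_gt0.
rewrite -[leRHS]mul1r ler_pdivlMr // mulrC -opprB mulNr -subrX1 opprB lerBlDr lerDl.
exact: exprn_ge0.
Qed.

(** Each of the n powers r^i with i < n is at least r^n. *)
Lemma natr_geo_le (r : R) n : 0 <= r < 1 -> n%:R * r ^+ n <= (1 - r)^-1.
Proof.
move=> rr; have /andP[r0 r1] := rr; apply: le_trans ((bsums_geo rr).2 n).
rewrite mulr_natl -[n in _ *+ n]card_ord -sumr_const; apply: ler_sum => i _.
by apply: ler_wiXn2l => //; [exact: ltW|exact/ltnW].
Qed.

Lemma bsums_le (a b : nat -> R) B : (forall n, 0 <= a n <= b n) -> bsums b B -> bsums a B.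
Proof.
move=> ab [b0 bB]; split=> [n|N]; first by have /andP[] := ab n.
by apply: le_trans (bB N); apply: ler_sum => n _; have /andP[] := ab n.
Qed.

(** With r = exp (- t / (k + 1)) one has n^k exp (- t)^n = (n r^n)^k r^n. *)
Lemma bsums_expR k (t : R) : 0 < t ->
  exists B, bsums (fun n => n%:R ^+ k * expR (- t) ^+ n) B.
Proof.
move=> t0; set r := expR (- (t / k.+1%:R)).
have r01 : 0 <= r < 1.
  by rewrite expR_ge0 expR_lt1 oppr_lt0 divr_gt0.
have E : expR (- t) = r ^+ k.+1.
  by rewrite -expRM_natr mulNr divfK ?pnatr_eq0.
exists ((1 - r)^-1 ^+ k * (1 - r)^-1).
apply: bsums_le (bsumsZ _ (bsums_geo r01)); last first.
  by rewrite exprn_ge0 // invr_ge0 subr_ge0 ltW //; case/andP: r01.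
move=> n; rewrite E -exprM mulnC exprM exprSr mulrA -exprMn.
have /andP[r0 _] := r01.
rewrite mulr_ge0 ?exprn_ge0 // ?mulr_ge0 ?exprn_ge0 //=.
rewrite ler_wpM2r ?exprn_ge0 // lerXn2r ?nnegrE ?natr_geo_le //.
  by rewrite mulr_ge0 // exprn_ge0.
by rewrite invr_ge0 subr_ge0 ltW //; case/andP: r01.
Qed.

Lemma bsums_invsqr : bsums (fun n => (n.+1%:R ^+ 2)^-1 : R) 2.
Proof.
split=> [n|N]; first by rewrite invr_ge0 exprn_ge0.
case: N => [|N]; first by rewrite big_ord0.
(* telescoping bound, from 1 / (n + 1)^2 <= 1 / n - 1 / (n + 1) *)
apply: (@le_trans _ _ (2 - N.+1%:R^-1)); last by rewrite gerBl invr_ge0.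
elim: N => [|N IHN]; first by rewrite big_ord1 expr1n invr1; lra.
rewrite big_ord_recr /=; apply: le_trans (lerD IHN (lexx _)) _.
rewrite -addrA lerD2l -subr_ge0.
have n0 : 0 < N.+1%:R :> R by [].
rewrite -[N.+2]addn1 natrD; move: (N.+1%:R) n0 => x x0.
have -> : - (x + 1)^-1 - (- x^-1 + ((x + 1) ^+ 2)^-1) = (x * (x + 1) ^+ 2)^-1.
  by field; rewrite !gt_eqF // ?addr_gt0.
by rewrite invr_ge0 mulr_ge0 ?sqr_ge0 // ltW.
Qed.

Lemma tends_inv_nat (z : R[i]) : tends (fun n => (z + n%:R)^-1) 0.
Proof.
apply/tendsS; rewrite /=.
apply: (@tendsP R (fun n => (z + n.+1%:R)^-1) 0).2.
apply/cvgr0Pnorm_lt => e e0.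
near=> n.
rewrite subr0 ger0_norm ?cn_ge0 // cnV.
have h : cn z + 1 + e^-1 < n.+1%:R.
  near: n; exists (Num.bound (cn z + 1 + e^-1)) => // n /= hn.
  apply: lt_le_trans (archi_boundP _) _.
    by rewrite !addr_ge0 ?cn_ge0 // invr_ge0 ltW.
  by rewrite ler_nat ltnW.
have h2 : e^-1 < cn (z + n.+1%:R).
  have := cn_leD n.+1%:R z; rewrite cn_nat addrC [_ + z]addrC => hh.
  lra.
have e1 : 0 < e^-1 by rewrite invr_gt0.
by rewrite invf_plt ?posrE //; apply: lt_trans h2.
Unshelve. all: by end_near.
Qed.

End SummableSequences.

Section QSeries.
Variable R : realType.
Local Notation C := R[i].
Local Notation H := (upper_half R).

Lemma derivable_quad (f : C -> C) (a L : C) (d K : R) : 0 < d -> 0 <= K ->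
  (forall h, cn h < d -> cn (f (a + h) - f a - h * L) <= K * cn h ^+ 2) ->
  derivable (f : C^o -> C^o) a 1.
Proof.
move=> d0 K0 fq; apply: (@cvgP _ _ (L : C^o)).
apply/cvgrPdist_lt => e e0.
have [r er] : exists r, e = r%:C by exists (complex.Re e); rewrite RRe_real // gtr0_real.
have r0 : 0 < r by rewrite -ltcR -er.
have K1 : 0 < K + 1 by rewrite ltr_wpDl.
near=> h.
have h0 : h != 0 by near: h; exact: nbhs_dnbhs_neq.
have hd : cn h < d.
  by rewrite -ltcR -cnE; near: h; apply: dnbhs0_lt; rewrite (@ltcR _ 0).
have hr : cn h < r / (K + 1).
  by rewrite -ltcR -cnE; near: h; apply: dnbhs0_lt; rewrite (@ltcR _ 0) divr_gt0.
rewrite /= cnE er ltcR.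
have -> : L - h^-1 *: (f (h *: (1 : C^o) + a) - f a) =
    - ((f (a + h) - f a - h * L) / h).
  rewrite /GRing.scale /= mulr1 [h + a]addrC; field.
  by [].
rewrite cnN cnM cnV ltr_pdivrMr ?cn_gt0 //.
apply: le_lt_trans (fq _ hd) _; rewrite expr2 mulrA ltr_pM2r ?cn_gt0 //.
rewrite ltr_pdivlMr // in hr; apply: le_lt_trans hr.
by rewrite mulrC ler_wpM2l ?cn_ge0 // lerDl.
Unshelve. all: by end_near.
Qed.

(** The remainders D_n satisfy D_(n+1) = u D_n + n (u - x)^2 x^(n-1). The factor
    p^2 on the left stands for the exponent n - 2 on the right. *)
Lemma expn_quad (u x : C) (p : R) n : cn u <= p -> cn x <= p ->
  cn (u ^+ n - x ^+ n - n%:R * (u - x) * x ^+ n.-1) * p ^+ 2 <=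
  n%:R ^+ 2 * cn (u - x) ^+ 2 * p ^+ n.
Proof.
move=> up xp; have p0 : 0 <= p := le_trans (cn_ge0 _) up.
elim: n => [|n IHn].
  by rewrite !expr0 subrr !mul0r subr0 cn0 mul0r expr0n /= !mul0r.
have -> : u ^+ n.+1 - x ^+ n.+1 - n.+1%:R * (u - x) * x ^+ n.+1.-1 =
    u * (u ^+ n - x ^+ n - n%:R * (u - x) * x ^+ n.-1)
    + n%:R * (u - x) ^+ 2 * x ^+ n.-1.
  case: n {IHn} => [|n] /=; first by rewrite !expr0 !expr1; ring.
  by rewrite !exprS -[n.+2%:R]natr1; ring.
have a0 : 0 <= n%:R * cn (u - x) ^+ 2 * p ^+ n.+1.
  by rewrite mulr_ge0 ?exprn_ge0 // mulr_ge0 ?exprn_ge0 ?cn_ge0.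
apply: le_trans (ler_wpM2r (sqr_ge0 _) (cnD _ _)) _; rewrite mulrDl.
apply: (@le_trans _ _ (n%:R ^+ 2 * cn (u - x) ^+ 2 * p ^+ n.+1 +
   n%:R * cn (u - x) ^+ 2 * p ^+ n.+1)).
  apply: lerD.
    rewrite (cnM u) -[leLHS]mulrA.
    have -> : n%:R ^+ 2 * cn (u - x) ^+ 2 * p ^+ n.+1 =
      p * (n%:R ^+ 2 * cn (u - x) ^+ 2 * p ^+ n) by rewrite [p ^+ n.+1]exprS; ring.
    by apply: ler_pM => //; [exact: cn_ge0|exact: mulr_ge0 (cn_ge0 _) (sqr_ge0 _)].
  rewrite cnM (cnM n%:R) cn_nat !cnX -[leLHS]mulrA.
  case: n {IHn a0} => [|n] /=; first by rewrite !mul0r.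
  apply: ler_wpM2l; first exact: mulr_ge0 (ler0n _ _) (sqr_ge0 _).
  rewrite -[n.+2]addn2 exprD; apply: ler_wpM2r; first exact: sqr_ge0.
  by rewrite lerXn2r ?nnegrE ?cn_ge0.
rewrite -mulrDl -mulrDl; apply: ler_wpM2r; first exact: exprn_ge0.
apply: ler_wpM2r; first exact: sqr_ge0.
by rewrite -natr1; have : 0 <= n%:R :> R by []; nra.
Qed.

(** 2 pi i *)
Definition c2pi : C := (2 * pi)%:C * 'i.

Lemma qparE (tau : H) : qpar tau = cexp (c2pi * tau). Proof. by []. Qed.

Lemma Re_c2pi z : complex.Re (c2pi * z) = - (2 * pi * complex.Im z).
Proof. by case: z => x y /=; ring. Qed.
Lemma Im_c2pi z : complex.Im (c2pi * z) = 2 * pi * complex.Re z.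
Proof. by case: z => x y /=; ring. Qed.
Lemma cn_c2pi : cn c2pi = 2 * pi.
Proof. by rewrite /c2pi cnM cn_i mulr1 cn_real ger0_norm // mulr_ge0 // pi_ge0. Qed.

Lemma cn_qpar (tau : H) : cn (qpar tau) = expR (- (2 * pi * complex.Im (tau : C))).
Proof. by rewrite qparE cn_cexp Re_c2pi. Qed.

Lemma ext_uhE (f : H -> C) (tau : H) : ext_uh f tau = f tau.
Proof. by rewrite /ext_uh valK. Qed.

(** With s^4 = |q(tau)| the coefficients are O(s^-n). Within distance y/2 of tau,
    where y is the imaginary part of tau, |q| is at most s^2, so the second-order
    remainders of the terms are dominated by n^2 s^n. *)
Lemma qseries_holomorphic f a : qseries f a -> holomorphic (f : H -> C).
Proof.
move=> fa tau; set y := complex.Im (tau : C).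
have y0 : 0 < y := uh_valP tau.
have p0 := @pi_gt0 R.
have [K0 K0b] := qseries_bound tau fa.
have [K KE] : exists K, K0 = K%:C.
  exists (complex.Re K0); rewrite RRe_real // ger0_real //.
  by have := le_trans (normr_ge0 _) (K0b 0); rewrite muln0 expr0 mulr1.
set t := 2 * pi * (y / 4).
have t0 : 0 < t by rewrite !mulr_gt0 // invr_gt0.
set s := expR (- t).
have s0 : 0 < s := expR_gt0 _.
have aK n : cn (a n) * s ^+ n <= K.
  have := K0b n; rewrite cnE KE -/y -/t -/s -rmorphXn -rmorphM lecR cnM cnX cn_qpar.
  have -> : expR (- (2 * pi * complex.Im (tau : C))) = s ^+ 4.
    by rewrite -expRM_natr /t mulNr -/y; congr (expR (- _)); field.
  rewrite -!exprM -(ler_pM2r (_ : 0 < s ^+ (3 * n)) (_ * s ^+ n)) ?exprn_gt0 //.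
  by rewrite -mulrA -exprD -mulSn.
have [B nB] := bsums_expR 2 t0.
have K1 : 0 <= K by apply: le_trans (aK 0%N); rewrite expr0 mulr1 cn_ge0.
set x := qpar tau.
pose b n := K * (n%:R ^+ 2 * s ^+ n).
have bb : bsums b (K * B) := bsumsZ K1 nB.
have s21 : s <= 1 by rewrite expR_le1 oppr_le0 ltW.
have xs : cn x <= s ^+ 2.
  rewrite cn_qpar -/y -expRM_natr ler_expR mulNr lerN2 /t.
  by rewrite -!mulrA !ler_pM2l //; lra.
have anb n : n%:R ^+ 2 * (cn (a n) * (s ^+ 2) ^+ n) <= b n.
  rewrite /b [K * _]mulrCA ler_wpM2l ?sqr_ge0 //.
  rewrite exprAC expr2 mulrA; apply: ler_wpM2r (aK n). by rewrite exprn_ge0 ?ltW.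
have [G aG] : exists G : C, sums (fun n => n%:R * a n * x ^+ n) G.
  apply: (@sums_bounded _ _ b _ bb) => n; apply: le_trans (anb n).
  rewrite !cnM cn_nat cnX -mulrA ler_pM ?mulr_ge0 ?exprn_ge0 ?cn_ge0 //.
    by case: n => [|n]; rewrite ?expr0n // expr2 ler_peMl // ler1n.
  by rewrite ler_wpM2l ?cn_ge0 // lerXn2r ?nnegrE ?cn_ge0 ?exprn_ge0 // ltW.
set d := Num.min (y / 2) ((4 * pi)^-1).
have d0 : 0 < d by rewrite lt_min divr_gt0 //= invr_gt0 mulr_gt0.
apply: (@derivable_quad _ _ (c2pi * G) d (12 * (K * B) * (2 * pi) ^+ 2)) => //.
  by apply: mulr_ge0 (sqr_ge0 _); apply: mulr_ge0 (bsums_ge0 bb).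
move=> h; rewrite lt_min => /andP[hy hp].
have hI : 0 < complex.Im ((tau : C) + h).
  rewrite ImD -/y; have := cn_Im h; rewrite ler_norml => /andP[]; lra.
set th := UpperHalf hI.
rewrite (ext_uhE f th) ext_uhE.
set u := qpar th; have [w wE] : exists w : C, w = c2pi * h by exists (c2pi * h).
have w2 : cn w <= 1 / 2.
  rewrite wE cnM cn_c2pi; move: hp; rewrite -(ltr_pM2l (_ : 0 < 4 * pi)) ?mulr_gt0 //.
  by rewrite divff ?mulf_neq0 ?gt_eqF //; lra.
have uE : u = x * cexp w by rewrite /u /x !qparE wE mulrDr cexpD.
have us : cn u <= s ^+ 2.
  rewrite cn_qpar -expRM_natr ler_expR mulNr lerN2 /t.
  rewrite -!mulrA !ler_pM2l // ImD -/y.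
  have := cn_Im h; rewrite ler_norml => /andP[]; lra.
have s2p : 0 < s ^+ 2 by apply: exprn_gt0.
have ux : cn (u - x) <= s ^+ 2 * (3 * cn w).
  rewrite uE -[x in _ - x]mulr1 -mulrBr cnM ler_pM ?cn_ge0 //.
  exact: cexp_lip.
have term n : cn (a n * u ^+ n - a n * x ^+ n - w * (n%:R * a n * x ^+ n)) <=
    12 * cn w ^+ 2 * b n.
  have -> : a n * u ^+ n - a n * x ^+ n - w * (n%:R * a n * x ^+ n) =
     a n * ((u ^+ n - x ^+ n - n%:R * (u - x) * x ^+ n.-1) +
            n%:R * x ^+ n * (cexp w - 1 - w)).
    case: n => [|n] /=; first by rewrite !expr0; ring.
    by rewrite uE !exprS; ring.
  apply: (@le_trans _ _ (12 * cn w ^+ 2 * (n%:R ^+ 2 * (cn (a n) * (s ^+ 2) ^+ n)))); last first.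
    by rewrite ler_wpM2l // mulr_ge0 // sqr_ge0.
  rewrite cnM [_ * (_ * (cn (a n) * _))]mulrA [_ * (cn (a n) * _)]mulrCA.
  rewrite ler_wpM2l ?cn_ge0 //; apply: le_trans (cnD _ _) _.
  have h1 : cn (u ^+ n - x ^+ n - n%:R * (u - x) * x ^+ n.-1) <=
      9 * cn w ^+ 2 * n%:R ^+ 2 * (s ^+ 2) ^+ n.
    rewrite -(ler_pM2r (_ : 0 < (s ^+ 2) ^+ 2)) ?exprn_gt0 //.
    apply: le_trans (expn_quad n us xs) _.
    have hh : cn (u - x) ^+ 2 <= (s ^+ 2 * (3 * cn w)) ^+ 2.
      by rewrite lerXn2r ?nnegrE ?cn_ge0 // !mulr_ge0 ?cn_ge0 ?ltW.
    have nn0 : 0 <= n%:R ^+ 2 * (s ^+ 2) ^+ n.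
      exact: mulr_ge0 (sqr_ge0 _) (exprn_ge0 _ (ltW s2p)).
    have {}hh := ler_wpM2r nn0 hh.
    have -> : n%:R ^+ 2 * cn (u - x) ^+ 2 * (s ^+ 2) ^+ n =
      cn (u - x) ^+ 2 * (n%:R ^+ 2 * (s ^+ 2) ^+ n) by ring.
    apply: le_trans hh _.
    by rewrite le_eqVlt; apply/orP; left; apply/eqP; ring.
  have h2 : cn (n%:R * x ^+ n * (cexp w - 1 - w)) <=
      3 * cn w ^+ 2 * n%:R ^+ 2 * (s ^+ 2) ^+ n.
    rewrite !cnM cn_nat cnX.
    have -> : 3 * cn w ^+ 2 * n%:R ^+ 2 * (s ^+ 2) ^+ n =
       (n%:R ^+ 2 * (s ^+ 2) ^+ n) * (3 * cn w ^+ 2) by ring.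
    apply: ler_pM; rewrite ?mulr_ge0 ?exprn_ge0 ?cn_ge0 //; last exact: cexp_quad.
    apply: ler_pM; rewrite ?exprn_ge0 ?cn_ge0 //.
      by case: n {h1} => [|n]; rewrite ?expr0n // expr2 ler_peMl // ler1n.
    by rewrite lerXn2r ?nnegrE ?cn_ge0 ?exprn_ge0 // ltW.
  by apply: le_trans (lerD h1 h2) _; rewrite le_eqVlt; apply/orP; left; apply/eqP; ring.
have lim : sums (fun n => a n * u ^+ n - a n * x ^+ n - w * (n%:R * a n * x ^+ n))
    (f th - f tau - h * (c2pi * G)).
  have -> : h * (c2pi * G) = w * G by rewrite wE; ring.
  apply/sumsE; have h1 := (sumsE _ _).1 (fa th); have h2 := (sumsE _ _).1 (fa tau).
  have h3 := tendsZ (c := w) ((sumsE _ _).1 aG).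
  apply: (tends_ext _ (tendsB (tendsB h1 h2) h3)) => N.
  by rewrite !big_split /= !sumrN mulr_sumr.
have := sums_cn_le (bsumsZ (_ : 0 <= 12 * cn w ^+ 2) bb) term lim.
have w0 : 0 <= 12 * cn w ^+ 2 by rewrite mulr_ge0 // sqr_ge0.
move=> /(_ w0) hle; apply: le_trans hle _.
rewrite wE cnM cn_c2pi exprMn le_eqVlt; apply/orP; left; apply/eqP; ring.
Qed.

End QSeries.

(** * Sums over the integers and the expansion of pi^2 / sin^2 *)

Section IntegerSums.
Variable R : realType.
Local Notation C := R[i].
Implicit Types (f g : int -> C) (z w l : C).

(** Series over all integers are read as limits of symmetric partial sums. *)
Definition symz f (k : nat) : C := if k is 0%N then f 0 else f k%:Z + f (- k%:Z).
Definition zpart f N := \sum_(k < N.+1) symz f k.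
Definition zsums f l := tends (zpart f) l.

Lemma zpart0 f : zpart f 0 = f 0. Proof. by rewrite /zpart big_ord1. Qed.
Lemma zpartS f N : zpart f N.+1 = zpart f N + (f N.+1%:Z + f (- N.+1%:Z)).
Proof. by rewrite /zpart big_ord_recr. Qed.

Lemma zsums_sums f l : zsums f l <-> sums (symz f) l.
Proof. by rewrite sumsE /zsums -[X in _ <-> X]tendsS. Qed.

Lemma zsums_ext f g l : f =1 g -> zsums f l -> zsums g l.
Proof. by move=> fg; have -> : g = f by apply/funext => n; rewrite fg. Qed.

Lemma zpart_lin (c d : C) f g N :
  zpart (fun m => c * f m + d * g m) N = c * zpart f N + d * zpart g N.
Proof.
by elim: N => [|N IHN]; rewrite ?zpart0 // !zpartS IHN; ring.
Qed.

Lemma zpartZ (c : C) f N : c * zpart f N = zpart (fun m => c * f m) N.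
Proof. by elim: N => [|N IHN]; rewrite ?zpart0 // !zpartS -IHN; ring. Qed.

Lemma zsums_lin (c d : C) f g l l' : zsums f l -> zsums g l' ->
  zsums (fun m => c * f m + d * g m) (c * l + d * l').
Proof.
move=> fl gl; apply: (tends_ext _ (tendsD (tendsZ (c := c) fl) (tendsZ (c := d) gl))) => N.
by rewrite zpart_lin.
Qed.

Lemma zpart_shift f N :
  zpart (fun m => f (m + 1)) N = zpart f N + f N.+1%:Z - f (- N%:Z).
Proof.
elim: N => [|N IHN]; first by rewrite !zpart0 add0r oppr0 addrAC addrN add0r.
rewrite !zpartS IHN.
have -> : (N.+1%:Z + 1 = N.+2%:Z)%R by lia.
have -> : (- N.+1%:Z + 1 = - N%:Z)%R by lia.
ring.
Qed.

Lemma zpart_tele g N :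
  zpart (fun m => g m - g (m + 1)) N = g (- N%:Z) - g N.+1%:Z.
Proof.
have := zpart_lin 1 (-1) g (fun m => g (m + 1)) N.
rewrite zpart_shift => h; transitivity (1 * zpart g N + -1 * (zpart g N + g N.+1 - g (- N%:Z))).
  rewrite -h; congr zpart; apply/funext => m; ring.
ring.
Qed.

Lemma zpart_even_odd f N :
  zpart (fun m => f (2 * m)) N + zpart (fun m => f (2 * m + 1)) N =
  zpart f N.*2 + f N.*2.+1%:Z.
Proof.
elim: N => [|N IHN]; first by rewrite !zpart0 mulr0 add0r.
rewrite doubleS !zpartS.
have -> : (2 * N.+1%:Z = N.*2.+2%:Z)%R by lia.
have -> : (2 * - N.+1%:Z = - N.*2.+2%:Z)%R by lia.
have -> : (- N.*2.+2%:Z + 1 = - N.*2.+1%:Z)%R by lia.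
have -> : (N.*2.+2%:Z + 1 = N.*2.+3%:Z)%R by lia.
transitivity ((zpart (fun m => f (2 * m)) N + zpart (fun m => f (2 * m + 1)) N) +
   (f N.*2.+2%:Z + f (- N.*2.+2%:Z) + (f N.*2.+3%:Z + f (- N.*2.+1%:Z)))); first by ring.
by rewrite IHN; ring.
Qed.

Definition absR (m : int) : R := `|m|%:~R.

Lemma absR_ge0 m : 0 <= absR m. Proof. by rewrite ler0z. Qed.
Lemma absR_nat (k : nat) : absR k = k%:R. Proof. by []. Qed.
Lemma absRN m : absR (- m) = absR m. Proof. by rewrite /absR normrN. Qed.
Lemma cn_intE (m : int) : cn (m%:~R : C) = absR m. Proof. exact: cn_int. Qed.

Lemma symz_le f (K : R) k : (forall m, cn (f m) <= K / (1 + absR m) ^+ 2) ->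
  cn (symz f k) <= 2 * K * (k.+1%:R ^+ 2)^-1.
Proof.
move=> fK; have K0 : 0 <= K.
  by have := le_trans (cn_ge0 _) (fK 0); rewrite /absR normr0 addr0 expr1n divr1.
case: k => [|k] /=.
  by apply: le_trans (fK 0) _; rewrite /absR normr0 addr0 ler_wpM2r ?invr_ge0 ?sqr_ge0 //; lra.
apply: le_trans (cnD _ _) _; have := lerD (fK k.+1%:Z) (fK (- k.+1%:Z)).
by rewrite absRN absR_nat nat1r => /le_trans; apply; rewrite -mulrDl -mulr2n mulr_natl.
Qed.

Lemma zsums_bounded f (K : R) : (forall m, cn (f m) <= K / (1 + absR m) ^+ 2) ->
  exists2 l, zsums f l & cn l <= 4 * K.
Proof.
move=> fK.
have K0 : 0 <= K.
  by have := le_trans (cn_ge0 _) (fK 0); rewrite /absR normr0 addr0 expr1n divr1.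
have b := bsumsZ (mulr_ge0 (ler0n R 2) K0) (bsums_invsqr R).
have sb k : cn (symz f k) <= 2 * K * (k.+1%:R ^+ 2)^-1 by apply: symz_le.
have [l fl] := sums_bounded b sb.
exists l; first exact/zsums_sums.
by have := sums_cn_le b sb fl; lra.
Qed.

Definition nonint z := forall m : int, z + m%:~R != 0.

(** Integers beyond 2 |z| + 1 are handled by the triangle inequality; finitely
    many remain. *)
Lemma nonint_dist z : nonint z -> exists2 d : R, 0 < d &
  forall m : int, d * (1 + absR m) <= cn (z + m%:~R).
Proof.
move=> zi.
have fin (M : nat) : exists2 d : R, 0 < d & forall m : int, (`|m| < M)%N -> d <= cn (z + m%:~R).
  elim: M => [|M [d d0 dM]]; first by exists 1.
  exists (Num.min d (Num.min (cn (z + M%:Z%:~R)) (cn (z + (- M%:Z)%:~R)))).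
    by rewrite !lt_min d0 !cn_gt0 !zi.
  move=> m; rewrite ltnS leq_eqVlt => /orP[/eqP mM|/dM mM]; last by rewrite !ge_min mM.
  have : m = M%:Z \/ m = - M%:Z by lia.
  by case=> ->; rewrite !ge_min lexx ?orbT.
set M := Num.bound (2 * cn z + 1).
have [d d0 dM] := fin M.
have M1 : 0 < M.+1%:R :> R by [].
exists (Num.min (1 / 2) (d / M.+1%:R)); first by rewrite lt_min divr_gt0 //= divr_gt0.
move=> m; have m1 : 0 < 1 + absR m by rewrite ltr_pwDl ?absR_ge0.
rewrite -ler_pdivlMr // ge_min; apply/orP.
have [/[dup] /dM h mM|mM] := ltnP `|m|%N M.
  right; rewrite ler_pdivlMr //; apply: le_trans h; rewrite mulrAC ler_pdivrMr //.
  rewrite ler_pM2l // -natr1 addrC lerD2r.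
  by rewrite /absR -abszE -[leLHS]/(`|m|%N%:R) ler_nat ltnW.
left; rewrite ler_pdivlMr //.
have h1 : 2 * cn z + 1 < absR m.
  apply: lt_le_trans (archi_boundP _) _; first by rewrite addr_ge0 // mulr_ge0 // cn_ge0.
  by rewrite /absR -abszE -[leRHS]/(`|m|%N%:R) ler_nat.
have := cn_leD m%:~R z; rewrite cn_intE addrC [_ + z]addrC; lra.
Qed.

(** pi^2 / sin^2 (pi z), written in q = exp (2 pi i z). *)
Definition phiq z : C := let q := cexp (c2pi R * z) in c2pi R ^+ 2 * q / (1 - q) ^+ 2.

Lemma cexp_2pi : cexp (c2pi R) = 1.
Proof.
by rewrite cexpE -[c2pi R]mulr1 Re_c2pi Im_c2pi /= !(mulr0, oppr0, mulr1) expR0 !mul1r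
  mulr_natl cos2pi sin2pi.
Qed.

Lemma cexp_pi : cexp (c2pi R / 2) = -1.
Proof.
rewrite cexpE Re_c2pi Im_c2pi -[2^-1]mul1r Re_half Im_half /= mul0r mulr0 oppr0 expR0 !mul1r.
have -> : 2 * pi / 2 = pi :> R by field.
by rewrite cospi sinpi; apply: complexP; rewrite /= ?oppr0.
Qed.

Lemma cexp_shift z (m : int) : cexp (c2pi R * (z + m%:~R)) = cexp (c2pi R * z).
Proof.
have hn (n : nat) w : cexp (c2pi R * (w + n%:R)) = cexp (c2pi R * w).
  by rewrite mulrDr cexpD [_ * n%:R]mulrC cexpMn cexp_2pi expr1n mulr1.
case: (intP m) => [|n|n]; first by rewrite addr0.
  exact: hn.
by rewrite -[in RHS](subrK n.+1%:R z) hn mulrNz.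
Qed.

Lemma nonint_shift z (m : int) : nonint z -> nonint (z + m%:~R).
Proof. by move=> zi n; rewrite -addrA -intrD. Qed.

Lemma phiq_shift z (m : int) : phiq (z + m%:~R) = phiq z.
Proof. by rewrite /phiq cexp_shift. Qed.

Lemma strip z : exists m : int, `|complex.Re (z + m%:~R)| <= 1 / 2.
Proof.
exists (- Num.floor (complex.Re z + 1 / 2)).
rewrite ReD intr_complex /= mulrNz.
have /andP[h1 h2] := floor_itv (complex.Re z + 1 / 2).
by rewrite intrD in h2; rewrite ler_norml; apply/andP; split; lra.
Qed.

Definition ipi : C := (pi : R)%:C * 'i.
Lemma c2piE : c2pi R = ipi + ipi.
Proof. by rewrite /c2pi /ipi rmorphM /= rmorph_nat; ring. Qed.
Lemma Im_ipi z : complex.Im (ipi * z) = pi * complex.Re z.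
Proof. by case: z => x y /=; ring. Qed.
Lemma ipi_neq0 : ipi != 0.
Proof. by rewrite mulf_neq0 // -cn_gt0 ?cn_i // cn_real normr_gt0 gt_eqF // pi_gt0. Qed.

Lemma csinh_strip z : `|complex.Re z| <= 1 / 2 -> cn (ipi * z) / 2 <= cn (csinh (ipi * z)).
Proof.
move=> zs; apply: csinh_ge; rewrite Im_ipi normrM ger0_norm ?pi_ge0 //.
by have := @pi_gt0 R; nra.
Qed.

Lemma one_sub_q z : 1 - cexp (c2pi R * z) = - 2 * cexp (ipi * z) * csinh (ipi * z).
Proof.
rewrite c2piE mulrDl cexpD /csinh cexpN; field.
exact: cexp_neq0.
Qed.

Lemma q_neq1 z : nonint z -> cexp (c2pi R * z) != 1.
Proof.
move=> zi; have [m ms] := strip z.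
rewrite -(cexp_shift z m) eq_sym -subr_eq0 one_sub_q.
apply: mulf_neq0; first by apply: mulf_neq0; rewrite ?oppr_eq0 ?pnatr_eq0 ?cexp_neq0.
rewrite -cn_gt0; apply: lt_le_trans (csinh_strip ms).
by rewrite divr_gt0 // cn_gt0 mulf_neq0 // ipi_neq0.
Qed.

Lemma csinh_neq0 z : nonint z -> csinh (ipi * z) != 0.
Proof.
move=> zi; apply: contraNneq (q_neq1 zi) => s0.
by rewrite eq_sym -subr_eq0 one_sub_q s0 mulr0.
Qed.

Lemma phiq_csinh z : nonint z -> phiq z = ipi ^+ 2 / csinh (ipi * z) ^+ 2.
Proof.
move=> zi; have s0 := csinh_neq0 zi; have e0 := cexp_neq0 (ipi * z).
rewrite /phiq one_sub_q c2piE mulrDl cexpD.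
move: (cexp _) (csinh _) e0 s0 => e s e0 s0; field.
by rewrite e0 s0.
Qed.

(** With w^2 = q this is w / (1 - w)^2 - w / (1 + w)^2 = 4 w^2 / (1 - w^2)^2. *)
Lemma phiq_dup z : nonint z -> phiq (z / 2) + phiq ((z + 1) / 2) = 4 * phiq z.
Proof.
move=> zi; have q1 := q_neq1 zi; move: q1; rewrite /phiq.
have -> : c2pi R * ((z + 1) / 2) = c2pi R * (z / 2) + c2pi R / 2 by field.
have -> : c2pi R * z = c2pi R * (z / 2) + c2pi R * (z / 2) by field.
rewrite !cexpD cexp_pi; set w := cexp _ => w1.
have [a0 b0] : 1 - w != 0 /\ 1 + w != 0.
  apply/andP; rewrite -negb_or -mulf_eq0.
  have -> : (1 - w) * (1 + w) = 1 - w * w by ring.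
  by rewrite subr_eq0 eq_sym.
have c0 : 1 - w * w != 0 by rewrite subr_eq0 eq_sym.
clear w1; clearbody w.
have d0 : 1 - w * -1 != 0 by rewrite mulrN1 opprK.
by field; rewrite a0 c0 /= ?b0 ?d0.
Qed.

Lemma nonint_half z : nonint z -> nonint (z / 2) /\ nonint ((z + 1) / 2).
Proof.
move=> zi; split=> m.
  have -> : z / 2 + m%:~R = (z + (2 * m)%:~R) / 2 by rewrite intrM; field.
  by rewrite mulf_neq0 ?invr_eq0 ?pnatr_eq0.
have -> : (z + 1) / 2 + m%:~R = (z + (2 * m + 1)%:~R) / 2 by rewrite intrD intrM; field.
by rewrite mulf_neq0 ?invr_eq0 ?pnatr_eq0.
Qed.

Lemma cn_invsqr_le (x : C) (a : R) : 0 < a -> a <= cn x -> cn (x ^+ 2)^-1 <= (a ^+ 2)^-1.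
Proof.
move=> a0 ax; rewrite cnV cnX lef_pV2 ?posrE ?exprn_gt0 //; last exact: lt_le_trans ax.
by rewrite lerXn2r ?nnegrE ?cn_ge0 // ltW.
Qed.

Lemma zsums_sqr_ex z : nonint z -> exists l, zsums (fun m => ((z + m%:~R) ^+ 2)^-1) l.
Proof.
move=> /nonint_dist[d d0 dz].
have [|l hl _] := @zsums_bounded (fun m => ((z + m%:~R) ^+ 2)^-1) ((d ^+ 2)^-1).
  move=> m; have m1 : 0 < 1 + absR m by rewrite ltr_pwDl ?absR_ge0.
  by rewrite -invfM -exprMn; apply: cn_invsqr_le (dz m); rewrite mulr_gt0.
by exists l.
Qed.

Lemma tends_invsqr_nat z : tends (fun n => ((z + n%:R) ^+ 2)^-1) 0.
Proof.
rewrite -(mulr0 0); apply: (tends_ext _ (tendsM (tends_inv_nat z) (tends_inv_nat z))) => n.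
by rewrite -invfM expr2.
Qed.

Lemma tends_invsqr_natN z : tends (fun n => ((z - n%:R) ^+ 2)^-1) 0.
Proof.
by apply: (tends_ext _ (tends_invsqr_nat (- z))) => n; rewrite -[z - _]opprB sqrrN addrC.
Qed.

Lemma Re_nat n : complex.Re (n%:R : C) = n%:R.
Proof. by rewrite -(rmorph_nat (real_complex R)). Qed.

Lemma strip_dist z (k : nat) : `|complex.Re z| <= 1 / 2 -> k.+1%:R / 2 <= cn (z + k.+1%:R) /\
  k.+1%:R / 2 <= cn (z - k.+1%:R).
Proof.
have k1 : 1 <= k.+1%:R :> R by rewrite ler1n.
rewrite ler_norml => /andP[h1 h2]; split.
  have := cn_Re (z + k.+1%:R); rewrite ReD Re_nat.
  rewrite ler_norml; lra.
have := cn_Re (z - k.+1%:R); rewrite ReB Re_nat.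
rewrite ler_norml; lra.
Qed.

(** Herglotz' trick: the difference h of the two sides is periodic and bounded,
    the poles at the integers cancelling, and 4 h(z) = h(z/2) + h((z+1)/2). So
    every bound on h can be halved, and h = 0. *)
Lemma zsums_sqr z : nonint z -> zsums (fun m => ((z + m%:~R) ^+ 2)^-1) (phiq z).
Proof.
have Fex (w : C) : exists l, nonint w -> zsums (fun m => ((w + m%:~R) ^+ 2)^-1) l.
  have [wi|nwi] := pselect (nonint w); last by exists 0.
  by have [l hl] := zsums_sqr_ex wi; exists l.
have [F FP] := boolp.choice Fex.
pose h w := phiq w - F w.
have F1 w : nonint w -> F (w + 1) = F w.
  move=> wi; have w1i : nonint (w + 1) := nonint_shift 1 wi.
  apply: (tends_unique (FP _ w1i)); rewrite -[F w]addr0 -[_ + 0]subr0.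
  have := tendsB (tendsD (FP w wi) ((tendsS _ _).2 (tends_invsqr_nat w))) (tends_invsqr_natN w).
  apply: tends_ext => N /=.
  have := zpart_shift (fun m => ((w + m%:~R) ^+ 2)^-1) N.
  rewrite /= mulrNz => <-; congr zpart; apply/funext => m.
  by rewrite intrD addrA addrAC.
have h_shift w (m : int) : nonint w -> h (w + m%:~R) = h w.
  have hn (n : nat) u : nonint u -> h (u + n%:R) = h u.
    move=> ui; elim: n => [|n IHn]; first by rewrite addr0.
    rewrite -natr1 addrA -IHn /h F1; last exact: (nonint_shift n).
    by rewrite (phiq_shift _ 1).
  move=> wi; case: (intP m) => [|n|n]; first by rewrite addr0.
    exact: hn.
  rewrite -[in RHS](subrK n.+1%:R w) hn ?mulrNz //.
  by have := nonint_shift (- n.+1%:Z) wi; rewrite mulrNz.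
have h_dup w : nonint w -> h (w / 2) + h ((w + 1) / 2) = 4 * h w.
  move=> wi; have [w0i w1i] := nonint_half wi.
  suff Fd : F (w / 2) + F ((w + 1) / 2) = 4 * F w.
    by rewrite /h addrACA -opprD phiq_dup // Fd mulrBr.
  apply: (tends_unique (tendsD (FP _ w0i) (FP _ w1i))).
  have hs : tends (fun N => zpart (fun m => ((w + m%:~R) ^+ 2)^-1) N.*2 +
      ((w + N.*2.+1%:R) ^+ 2)^-1) (F w + 0).
    apply: tendsD.
      by apply: (tends_sub _ (FP _ wi)) => n; rewrite -addnn leq_addr.
    apply: (@tends_sub _ (fun n => ((w + n%:R) ^+ 2)^-1) _ (fun n => n.*2.+1)).
      by move=> n; rewrite -addnn -addnS leq_addr.
    exact: tends_invsqr_nat.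
  rewrite addr0 in hs; apply: (tends_ext _ (tendsZ (c := 4) hs)) => N.
  have := zpart_even_odd (fun m => ((w + m%:~R) ^+ 2)^-1) N.
  rewrite /= => <-; rewrite mulrDr.
  rewrite !zpartZ; congr (_ + _); congr zpart; apply/funext => m.
    have -> : w / 2 + m%:~R = (w + (2 * m)%:~R) / 2 by rewrite intrM; field.
    by rewrite expr_div_n invf_div -natrX.
  have -> : (w + 1) / 2 + m%:~R = (w + (2 * m + 1)%:~R) / 2 by rewrite intrD intrM; field.
  by rewrite expr_div_n invf_div -natrX.
have h_bd w : nonint w -> cn (h w) <= 48 * pi ^+ 2 + 16.
  have [m ms] := strip w; move=> wi; rewrite -(h_shift w m wi).
  have := nonint_shift m wi; move: (w + m%:~R) ms => {m wi}w ws wi.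
  have w0 : w != 0 by have := wi 0; rewrite addr0.
  have -> : h w = (phiq w - (w ^+ 2)^-1) - (F w - (w ^+ 2)^-1) by rewrite /h; ring.
  apply: le_trans (cnB _ _) _; apply: lerD.
    rewrite phiq_csinh //.
    have -> : ipi ^+ 2 / csinh (ipi * w) ^+ 2 - (w ^+ 2)^-1 =
       ipi ^+ 2 * ((csinh (ipi * w) ^+ 2)^-1 - ((ipi * w) ^+ 2)^-1).
      move: (csinh _) (csinh_neq0 wi) => s s0; field.
      by rewrite w0 s0 ipi_neq0.
    rewrite cnM mulrC; apply: ler_pM; rewrite ?cn_ge0 //.
      apply: csinh_pole; first by rewrite mulf_neq0 // ipi_neq0.
      rewrite Im_ipi normrM ger0_norm ?pi_ge0 //; have := @pi_gt0 R; nra.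
    by rewrite cnX cnM cn_i mulr1 cn_real real_normK ?num_real.
  have b := bsumsZ (_ : 0 <= 8) (bsums_invsqr R); have {}b := b (ler0n _ 8).
  apply: (@le_trans _ _ (8 * 2)); last by lra.
  have bd k : cn (symz (fun m => ((w + m%:~R) ^+ 2)^-1) k.+1) <= 8 * (k.+1%:R ^+ 2)^-1.
    rewrite /= mulrNz; have [h1 h2] := strip_dist k ws.
    have k2 : 0 < k.+1%:R / 2 :> R by rewrite divr_gt0.
    apply: le_trans (cnD _ _) _.
    apply: le_trans (lerD (cn_invsqr_le k2 h1) (cn_invsqr_le k2 h2)) _.
    have -> : ((k.+1%:R / 2) ^+ 2)^-1 = 4 * (k.+1%:R ^+ 2)^-1 :> R.
      by move: (k.+1%:R) k2 => x x2; field; rewrite gt_eqF //; lra.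
    by rewrite -mulrDl -natrD.
  apply: (sums_cn_le b bd); apply/sumsE.
  apply: (tends_ext _ (tendsB (FP _ wi) (tends_cst (w ^+ 2)^-1))) => N.
  by rewrite /zpart big_ord_recl /= addr0 addrAC subrr add0r.
have h_small w n : nonint w -> cn (h w) <= (48 * pi ^+ 2 + 16) / 2 ^+ n.
  elim: n w => [|n IHn] w wi; first by rewrite divr1 h_bd.
  have [w0i w1i] := nonint_half wi.
  have := lerD (IHn _ w0i) (IHn _ w1i).
  have := cnD (h (w / 2)) (h ((w + 1) / 2)); rewrite h_dup // cnM cn_nat.
  rewrite [2 ^+ n.+1]exprS invfM; set e := _ / 2 ^+ n; have -> : (48 * pi ^+ 2 + 16) * (2^-1 / 2 ^+ n) = e / 2.
    by rewrite /e; field; rewrite expf_neq0.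
  lra.
move=> zi; suff -> : phiq z = F z by exact: FP.
apply/eqP; rewrite -subr_eq0 -cn_eq0 -/(h z) eq_le cn_ge0 andbT.
set B := 48 * pi ^+ 2 + 16 in h_small.
apply/ler_addgt0Pr => e e0; rewrite add0r.
have B0 : 0 < B by rewrite ltr_pwDr // mulr_ge0 // sqr_ge0.
pose n := Num.bound (B / e).
apply: le_trans (h_small z n zi) _; rewrite ler_pdivrMr ?exprn_gt0 //.
rewrite mulrC -ler_pdivrMr //; apply: le_trans (ltW (archi_boundP _)) _.
  by rewrite divr_ge0 // ltW.
by rewrite -natrX ler_nat ltnW // ltn_expl.
Qed.

Lemma phiq_half : phiq (1 / 2) = (pi ^+ 2)%:C.
Proof.
rewrite /phiq mul1r cexp_pi c2piE /ipi rmorphXn /=.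
have : 'i ^+ 2 = -1 :> C by rewrite sqr_i.
set I : C := 'i => I2.
have -> : (pi%:C * I + pi%:C * I) ^+ 2 * -1 / (1 - -1) ^+ 2 = - pi%:C ^+ 2 * I ^+ 2.
  by field.
by rewrite I2; ring.
Qed.

(** Splitting the sum by parity gives itself over 4 plus the sum over the odd
    integers, which is the expansion above at z = 1/2 over 4. The summand at 0 is
    0, since 0^-1 = 0. *)
Lemma zsums_zeta2 : zsums (fun m => ((m%:~R : C) ^+ 2)^-1) (pi ^+ 2 / 3)%:C.
Proof.
have hi : nonint (1 / 2 : C).
  move=> m; have -> : 1 / 2 + m%:~R = (2 * m + 1)%:~R / 2 :> C by rewrite intrD intrM; field.
  rewrite mulf_neq0 ?invr_eq0 ?pnatr_eq0 // intr_eq0; lia.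
have ho := zsums_sqr hi; rewrite phiq_half in ho.
have [l hl _] : exists2 l, zsums (fun m => ((m%:~R : C) ^+ 2)^-1) l & cn l <= 4 * 4.
  apply: zsums_bounded => m; have [->|m0] := eqVneq m 0.
    by rewrite expr0n invr0 cn0 divr_ge0 ?exprn_ge0 // addr_ge0 ?absR_ge0.
  have m1 : 1 <= absR m by rewrite /absR ler1z; lia.
  rewrite cnV cnX cn_intE -[4 / _]invf_div lef_pV2 ?posrE; last 2 first.
  - by rewrite exprn_gt0 //; lra.
  - by rewrite divr_gt0 // exprn_gt0 //; lra.
  by nra.
have hs : tends (fun N => zpart (fun m => ((m%:~R : C) ^+ 2)^-1) N.*2 +
      ((0 + N.*2.+1%:R) ^+ 2)^-1) (l + 0).
  apply: tendsD.
    by apply: (tends_sub _ hl) => n; rewrite -addnn leq_addr.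
  apply: (@tends_sub _ (fun n => ((0 + n%:R) ^+ 2)^-1) _ (fun n => n.*2.+1)).
    by move=> n; rewrite -addnn -addnS leq_addr.
  exact: tends_invsqr_nat.
have hd := tendsD (tendsZ (c := 4^-1) hl) (tendsZ (c := 4^-1) ho).
have e : l + 0 = 4^-1 * l + 4^-1 * (pi ^+ 2)%:C.
  apply: tends_unique hs _; apply: (tends_ext _ hd) => N.
  have := zpart_even_odd (fun m => ((m%:~R : C) ^+ 2)^-1) N.
  rewrite add0r => <-; rewrite !zpartZ; congr (_ + _); congr zpart; apply/funext => m.
    rewrite intrM; have [->|m0] := eqVneq m 0; first by rewrite mulr0 expr0n invr0 mulr0.
    by field; rewrite intr_eq0.
  have -> : 1 / 2 + m%:~R = (2 * m + 1)%:~R / 2 :> C by rewrite intrD intrM; field.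
  by rewrite -invfM; congr (_^-1); field.
have -> : (pi ^+ 2 / 3)%:C = l; last exact: hl.
have -> : ((pi : R) ^+ 2 / 3)%:C = ((pi : R) ^+ 2)%:C / 3 by rewrite rmorphM fmorphV /= rmorph_nat.
move: e; rewrite addr0 => e.
have {}e : 4 * l = l + (pi ^+ 2)%:C by rewrite {1}e; field.
have -> : (pi ^+ 2)%:C = 3 * l by rewrite -[LHS](addKr l) -e; ring.
by field.
Qed.

End IntegerSums.

(** * The partial fraction expansion of the cotangent *)

Section Cotangent.
Variable R : realType.
Local Notation C := R[i].
Implicit Types (z w l : C).

(** Cutting [0, 1] into n parts bounds the total increment by n K / n^2. *)
Lemma flat_path (f : R -> C) (K e : R) : 0 < e ->
  (forall s t, 0 <= s <= 1 -> 0 <= t <= 1 -> `|s - t| <= e ->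
     cn (f s - f t) <= K * (s - t) ^+ 2) -> f 1 = f 0.
Proof.
move=> e0 fK.
have step (n : nat) : e^-1 <= n.+1%:R -> cn (f 1 - f 0) <= K / n.+1%:R.
  move=> en; have n0 : 0 < n.+1%:R :> R by [].
  have tele (k : nat) : (k <= n.+1)%N -> cn (f (k%:R / n.+1%:R) - f 0) <= k%:R * (K / n.+1%:R ^+ 2).
    elim: k => [|k IHk] kn; first by rewrite mul0r subrr cn0 mul0r.
    have -> : f (k.+1%:R / n.+1%:R) - f 0 = (f (k.+1%:R / n.+1%:R) - f (k%:R / n.+1%:R)) +
       (f (k%:R / n.+1%:R) - f 0) by ring.
    apply: le_trans (cnD _ _) _.
    rewrite -[k.+1%:R in leRHS]natr1 mulrDl mul1r addrC; apply: lerD; first exact/IHk/ltnW.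
    have E : k.+1%:R / n.+1%:R - k%:R / n.+1%:R = n.+1%:R^-1 :> R.
      by rewrite -mulrBl -natr1 addrAC subrr add0r mul1r.
    have := fK (k.+1%:R / n.+1%:R) (k%:R / n.+1%:R); rewrite E exprVn; apply.
    - by rewrite divr_ge0 //= ler_pdivrMr // mul1r ler_nat.
    - by rewrite divr_ge0 //= ler_pdivrMr // mul1r ler_nat ltnW.
    - by rewrite ger0_norm ?invr_ge0 // -[leRHS]invrK lef_pV2 ?posrE ?invr_gt0.
  have := tele n.+1 (leqnn _); rewrite divff ?gt_eqF //.
  suff -> : n.+1%:R * (K / n.+1%:R ^+ 2) = K / n.+1%:R by [].
  by move: (n.+1%:R) n0 => x x0; field; rewrite gt_eqF.
apply/eqP; rewrite -subr_eq0 -cn_eq0 eq_le cn_ge0 andbT.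
apply/ler_addgt0Pr => d d0; rewrite add0r.
have K0 : 0 <= K.
  have en : e^-1 <= (Num.bound e^-1).+1%:R.
    apply: le_trans (ltW (archi_boundP _)) _; first by rewrite invr_ge0 ltW.
    by rewrite ler_nat.
  have := step _ en; rewrite ler_pdivlMr //; apply: le_trans.
  by rewrite mulr_ge0 ?cn_ge0.
pose n := (Num.bound e^-1 + Num.bound (K / d))%N.
apply: le_trans (step n _) _.
  apply: le_trans (ltW (archi_boundP _)) _; first by rewrite invr_ge0 ltW.
  by rewrite ler_nat /n leqW // leq_addr.
rewrite ler_pdivrMr // mulrC -ler_pdivrMr //.
apply: le_trans (ltW (archi_boundP _)) _; first by rewrite divr_ge0 // ltW.
by rewrite ler_nat /n leqW // leq_addl.
Qed.

(** pi cot (pi z), written in q = exp (2 pi i z). *)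
Definition cotq z : C := let q := cexp (c2pi R * z) in ipi R * (q + 1) / (q - 1).

Lemma zsums_inv_ex z : nonint z -> exists l, zsums (fun m => (z + m%:~R)^-1) l.
Proof.
move=> zi; have [d d0 dz] := nonint_dist zi.
set K := 2 * cn z / d ^+ 2 + d^-1.
have K0 : 0 <= K by rewrite addr_ge0 ?invr_ge0 ?divr_ge0 ?mulr_ge0 ?cn_ge0 ?sqr_ge0 // ltW.
have b := bsumsZ K0 (bsums_invsqr R).
have sb k : cn (symz (fun m => (z + m%:~R)^-1) k) <= K * (k.+1%:R ^+ 2)^-1.
  case: k => [|k].
    rewrite expr1n invr1 mulr1 cnV; apply: (@le_trans _ _ d^-1).
      have := dz 0; rewrite /absR normr0 addr0 mulr1 => dz0.
      by rewrite lef_pV2 ?posrE //; apply: lt_le_trans dz0.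
    by rewrite lerDr divr_ge0 ?sqr_ge0 // mulr_ge0 // cn_ge0.
  rewrite /=.
  have -> : (z + k.+1%:Z%:~R)^-1 + (z + (- k.+1%:Z)%:~R)^-1 =
      2 * z / ((z + k.+1%:Z%:~R) * (z + (- k.+1%:Z)%:~R)).
    have -> : 2 * z = (z + k.+1%:Z%:~R) + (z + (- k.+1%:Z)%:~R) by rewrite mulrNz; ring.
    move: (z + k.+1%:Z%:~R) (z + (- k.+1%:Z)%:~R) (zi k.+1%:Z) (zi (- k.+1%:Z)) => u v u0 v0.
    by field; rewrite u0 v0.
  rewrite 2!cnM cn_nat cnV cnM.
  have h1 := dz k.+1%:Z; have h2 := dz (- k.+1%:Z).
  rewrite absRN absR_nat nat1r in h1 h2.
  have k0 : 0 < d * k.+2%:R by rewrite mulr_gt0.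
  apply: (@le_trans _ _ (2 * cn z / (d * k.+2%:R) ^+ 2)).
    apply: ler_wpM2l; first by rewrite mulr_ge0 // cn_ge0.
    have p0 : 0 < (d * k.+2%:R) ^+ 2 by rewrite exprn_gt0.
    have hp : (d * k.+2%:R) ^+ 2 <= cn (z + k.+1%:Z%:~R) * cn (z + (- k.+1%:Z)%:~R).
      by rewrite expr2 ler_pM // ltW.
    by rewrite lef_pV2 ?posrE //; apply: lt_le_trans hp.
  rewrite exprMn invfM mulrA ler_wpM2r ?invr_ge0 ?sqr_ge0 //.
  by rewrite lerDl invr_ge0 ltW.
have [l hl] := sums_bounded b sb.
by exists l; apply/zsums_sums.
Qed.

Lemma zsums_inv_fun :
  exists c : C -> C, forall z, nonint z -> zsums (fun m => (z + m%:~R)^-1) (c z).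
Proof.
have cex (w : C) : exists l, nonint w -> zsums (fun m => (w + m%:~R)^-1) l.
  have [wi|nwi] := pselect (nonint w); last by exists 0 => /nwi.
  by have [l hl] := zsums_inv_ex wi; exists l.
by have [c cP] := boolp.choice cex; exists c.
Qed.

(** The derivative of the series is - phiq, with a remainder estimate: that of
    1 / (z + m) is - (z - w)^2 / ((z + m)^2 (w + m)). *)
Lemma inv_quad z w lz lw (d : R) : 0 < d ->
  (forall m, d * (1 + absR R m) <= cn (z + m%:~R)) ->
  (forall m, d * (1 + absR R m) <= cn (w + m%:~R)) ->
  zsums (fun m => (z + m%:~R)^-1) lz -> zsums (fun m => (w + m%:~R)^-1) lw ->
  cn (lz - lw + (z - w) * phiq z) <= 4 / d ^+ 3 * cn (z - w) ^+ 2.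
Proof.
move=> d0 dz dw hz hw.
have m1 m : 0 < 1 + absR R m by rewrite ltr_pwDl ?absR_ge0.
have nz (u : C) : (forall m, d * (1 + absR R m) <= cn (u + m%:~R)) -> nonint u.
  by move=> du m; rewrite -cn_gt0; apply: lt_le_trans (du m); rewrite mulr_gt0.
have zi := nz z dz; have wi := nz w dw.
have hs := zsums_lin (c := 1) (d := z - w) (zsums_lin (c := 1) (d := -1) hz hw) (zsums_sqr zi).
have [|l hl lb] := @zsums_bounded R (fun m => 1 * (1 * (z + m%:~R)^-1 + -1 * (w + m%:~R)^-1) +
    (z - w) * ((z + m%:~R) ^+ 2)^-1) (cn (z - w) ^+ 2 / d ^+ 3).
  move=> m.
  have -> : 1 * (1 * (z + m%:~R)^-1 + -1 * (w + m%:~R)^-1) + (z - w) * ((z + m%:~R) ^+ 2)^-1 =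
     - (z - w) ^+ 2 / ((z + m%:~R) ^+ 2 * (w + m%:~R)).
    by field; rewrite (zi m) (wi m).
  rewrite cnM cnN cnX cnV cnM cnX -mulrA -invfM.
  apply: ler_wpM2l; first exact: sqr_ge0.
  have p0 : 0 < d * (1 + absR R m) by rewrite mulr_gt0.
  have hp : (d * (1 + absR R m)) ^+ 2 * (d * (1 + absR R m)) <= cn (z + m%:~R) ^+ 2 * cn (w + m%:~R).
    apply: ler_pM => //; rewrite ?sqr_ge0 ?(ltW p0) //.
    by rewrite lerXn2r ?nnegrE ?cn_ge0 ?(ltW p0).
  have q0 : 0 < d ^+ 3 * (1 + absR R m) ^+ 2 by apply: mulr_gt0; apply: exprn_gt0.
  have q1 : 0 < cn (z + m%:~R) ^+ 2 * cn (w + m%:~R).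
    by apply: mulr_gt0; [apply: exprn_gt0|]; rewrite cn_gt0.
  rewrite lef_pV2 ?posrE //.
  apply: le_trans hp; rewrite exprMn [d ^+ 3]exprSr.
  have x1 : 1 <= 1 + absR R m by rewrite lerDl absR_ge0.
  rewrite (_ : d ^+ 2 * (1 + absR R m) ^+ 2 * _ = d ^+ 2 * d * (1 + absR R m) ^+ 2 * (1 + absR R m)); last by ring.
  by rewrite ler_peMr // mulr_ge0 ?sqr_ge0 // mulr_ge0 ?sqr_ge0 // ltW.
have -> : lz - lw + (z - w) * phiq z = 1 * (1 * lz + -1 * lw) + (z - w) * phiq z by ring.
rewrite (tends_unique hs hl); apply: le_trans lb _.
by rewrite le_eqVlt; apply/orP; left; apply/eqP; ring.
Qed.

(** The same estimate for the closed form, from the first-order expansion of the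
    exponential. *)
Lemma cotq_quad z w (B : R) :
  cn (cexp (c2pi R * z)) <= 1 -> 1 <= B * cn (cexp (c2pi R * z) - 1) ->
  1 <= B * cn (cexp (c2pi R * w) - 1) -> cn (c2pi R * (w - z)) <= 1 / 2 ->
  cn (cotq z - cotq w + (z - w) * phiq z) <=
    (2 * pi * B ^+ 3 * 9 * (2 * pi) ^+ 2) * cn (z - w) ^+ 2.
Proof.
set q := cexp (c2pi R * z); set p := cexp (c2pi R * w) => q1 bq bp t2.
set t := c2pi R * (w - z).
have pE : p = q * cexp t by rewrite /p /q /t mulrBr cexpD cexpN mulrCA mulfV ?cexp_neq0 // mulr1.
have nq : q - 1 != 0.
  by apply: contraTneq bq => ->; rewrite cn0 mulr0 -ltNge.
have np : p - 1 != 0.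
  by apply: contraTneq bp => ->; rewrite cn0 mulr0 -ltNge.
have -> : cotq z - cotq w + (z - w) * phiq z =
   c2pi R * q * (((q - 1) * (q - 1) * (p - 1))^-1 * ((q - 1) * (cexp t - 1 - t) - q * t * (cexp t - 1))).
  have tz : (z - w) * c2pi R = - t by rewrite /t; ring.
  have n1q : 1 - q != 0 by rewrite -opprB oppr_eq0.
  have -> : (z - w) * phiq z = - t * c2pi R * q / (1 - q) ^+ 2.
    by rewrite /phiq -/q -tz; field.
  rewrite /cotq -/q -/p [in RHS]c2piE c2piE.
  have -> : cexp t = p / q by rewrite pE mulrC mulKf // cexp_neq0.
  have q0 : q != 0 := cexp_neq0 _.
  by field; rewrite q0 n1q nq np.
have inv1 (u : C) : 1 <= B * cn u -> (cn u)^-1 <= B.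
  move=> h; have u0 : 0 < cn u.
    by rewrite lt0r cn_ge0 andbT; apply: contraTneq h => ->; rewrite mulr0 -ltNge.
  by rewrite -[leLHS]mul1r ler_pdivrMr.
have B0 : 0 <= B by apply: le_trans (inv1 _ bq); rewrite invr_ge0 cn_ge0.
have tE : cn t = 2 * pi * cn (z - w) by rewrite /t cnM cn_c2pi -[cn (z - w)]cnN opprB.
rewrite -/t in t2; clearbody q p t.
rewrite cnM [cn (c2pi R * q)]cnM cn_c2pi cnM cnV 2!cnM.
have i1 : (cn (q - 1) * cn (q - 1) * cn (p - 1))^-1 <= B ^+ 3.
  rewrite !invfM exprSr expr2; apply: ler_pM; rewrite ?mulr_ge0 ?invr_ge0 ?cn_ge0 ?inv1 //.
  by apply: ler_pM; rewrite ?invr_ge0 ?cn_ge0 ?inv1.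
have i2 : cn ((q - 1) * (cexp t - 1 - t) - q * t * (cexp t - 1)) <= 9 * cn t ^+ 2.
  apply: le_trans (cnB _ _) _; rewrite !cnM.
  have e1 := cexp_quad t2; have e2 := cexp_lip t2.
  have h1 : cn (q - 1) <= 2 by apply: le_trans (cnB _ _) _; rewrite cn1; lra.
  have h3 : cn (q - 1) * cn (cexp t - 1 - t) <= 2 * (3 * cn t ^+ 2).
    by apply: ler_pM; rewrite ?cn_ge0.
  have h4 : cn q * cn t * cn (cexp t - 1) <= (1 * cn t) * (3 * cn t).
    by apply: ler_pM; rewrite ?mulr_ge0 ?cn_ge0 // ler_wpM2r ?cn_ge0.
  by apply: le_trans (lerD h3 h4) _; rewrite le_eqVlt; apply/orP; left; apply/eqP; ring.
have pi0 := @pi_ge0 R.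
apply: (@le_trans _ _ ((2 * pi * 1) * (B ^+ 3 * (9 * cn t ^+ 2)))).
  apply: ler_pM; rewrite ?mulr_ge0 ?invr_ge0 ?mulr_ge0 ?cn_ge0 //.
    by rewrite ler_wpM2l // mulr_ge0.
  by apply: ler_pM; rewrite ?invr_ge0 ?mulr_ge0 ?cn_ge0.
by rewrite tE le_eqVlt; apply/orP; left; apply/eqP; ring.
Qed.

(** Both sides of the cotangent expansion have derivative - phiq, so their
    difference is constant along segments. *)
Lemma cot_segment (c : C -> C) z0 z1 (d B : R) : 0 < d ->
  (forall z, nonint z -> zsums (fun m => (z + m%:~R)^-1) (c z)) ->
  (forall s, 0 <= s <= 1 -> let z := z0 + s%:C * (z1 - z0) in
     [/\ forall m, d * (1 + absR R m) <= cn (z + m%:~R),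
         cn (cexp (c2pi R * z)) <= 1 & 1 <= B * cn (cexp (c2pi R * z) - 1)]) ->
  c z1 - cotq z1 = c z0 - cotq z0.
Proof.
move=> d0 cP path.
pose zz (s : R) := z0 + s%:C * (z1 - z0).
pose g z := c z - cotq z.
set D := cn (z1 - z0).
have D0 : 0 <= D := cn_ge0 _.
set K := 4 / d ^+ 3 + 2 * pi * B ^+ 3 * 9 * (2 * pi) ^+ 2.
have p0 := @pi_gt0 R.
have zzB s t : zz s - zz t = (s - t)%:C * (z1 - z0) by rewrite /zz rmorphB /=; ring.
suff : g (zz 1) = g (zz 0).
  have -> : zz 1 = z1 by rewrite /zz rmorph1 mul1r addrC subrK.
  by have -> : zz 0 = z0 by rewrite /zz rmorph0 mul0r addr0.
apply: (@flat_path (g \o zz) (K * D ^+ 2) ((4 * pi * (D + 1))^-1)).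
  by rewrite invr_gt0 mulr_gt0 ?mulr_gt0 // ltr_wpDl.
move=> s t s01 t01 st /=.
have [ds q1 qB] := path s s01; have [dt q1' qB'] := path t t01.
rewrite -/(zz s) -/(zz t) in ds q1 qB dt q1' qB'.
have m1 m : 0 < 1 + absR R m by rewrite ltr_pwDl ?absR_ge0.
have nz (u : C) : (forall m, d * (1 + absR R m) <= cn (u + m%:~R)) -> nonint u.
  by move=> du m; rewrite -cn_gt0; apply: lt_le_trans (du m); rewrite mulr_gt0.
have h1 := inv_quad d0 ds dt (cP _ (nz _ ds)) (cP _ (nz _ dt)).
have t2 : cn (c2pi R * (zz t - zz s)) <= 1 / 2.
  rewrite cnM cn_c2pi zzB cnM cn_real distrC -/D.
  have Dp : 0 < 4 * pi * (D + 1) by rewrite mulr_gt0 ?mulr_gt0 // ltr_wpDl.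
  have {}st : `|s - t| * (4 * pi * (D + 1)) <= 1 by rewrite -ler_pdivlMr // div1r.
  have : `|s - t| * D <= `|s - t| * (D + 1) by rewrite ler_wpM2l // lerDl.
  nra.
have h2 := cotq_quad q1 qB qB' t2.
have -> : g (zz s) - g (zz t) = (c (zz s) - c (zz t) + (zz s - zz t) * phiq (zz s)) -
   (cotq (zz s) - cotq (zz t) + (zz s - zz t) * phiq (zz s)) by rewrite /g; ring.
apply: le_trans (cnB _ _) _; apply: le_trans (lerD h1 h2) _.
rewrite zzB cnM cn_real -/D exprMn real_normK ?num_real // -mulrDl -/K.
by rewrite le_eqVlt; apply/orP; left; apply/eqP; ring.
Qed.

(** The terms of index m and - m - 1 cancel. *)
Lemma zpart_half N : zpart (fun m => ((1 / 2 : C) + m%:~R)^-1) N = (1 / 2 + N%:R)^-1.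
Proof.
elim: N => [|N IHN]; first by rewrite zpart0.
rewrite zpartS IHN mulrNz.
have -> : (1 / 2 - N.+1%:R : C) = - (1 / 2 + N%:R) by rewrite -natr1; field.
by rewrite invrN [_ + - _]addrC addrA subrr add0r.
Qed.

Lemma half_dist (x : C) m : complex.Re x = 1 / 2 -> 1 / 4 * (1 + absR R m) <= cn (x + m%:~R).
Proof.
move=> x2; apply: le_trans (cn_Re _); rewrite ReD x2 intr_complex /= /absR.
rewrite intr_norm.
have : m = 0 \/ 1 <= m \/ m <= -1 by lia.
case=> [->|[m1|m1]].
- by rewrite normr0 !addr0 mulr1 ger0_norm //; lra.
- have h : 1 <= m%:~R :> R by rewrite ler1z.
  by rewrite !ger0_norm; lra.
have h : m%:~R <= -1 :> R by rewrite -(ler_int R) in m1.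
by rewrite !ler0_norm; lra.
Qed.

(** Both sides vanish at 1/2, which is joined to z by a vertical and a horizontal
    segment. *)
Lemma zsums_cot z : 0 < complex.Im z -> zsums (fun m => (z + m%:~R)^-1) (cotq z).
Proof.
move=> y0; have p0 := @pi_gt0 R.
have [c cP] := zsums_inv_fun.
have Hnon (w : C) : 0 < complex.Im w -> nonint w.
  move=> w0 m; apply: contraTneq w0 => /(congr1 (@complex.Im R)).
  by rewrite ImD intr_complex /= addr0 => ->; rewrite ltxx.
have hi : nonint (1 / 2 : C).
  move=> m; rewrite -cn_gt0; apply: lt_le_trans (half_dist m _).
    by rewrite mulr_gt0 // ltr_pwDl ?absR_ge0.
  by rewrite Re_half.
suff e : c z - cotq z = 0.
  by have := cP z (Hnon z y0); move/eqP: e; rewrite subr_eq0 => /eqP ->.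
have c2 : c (1 / 2) - cotq (1 / 2) = 0.
  have -> : c (1 / 2) = 0.
    apply: tends_unique (cP _ hi) _; apply: (tends_ext _ (tends_inv_nat (1 / 2))) => N.
    by rewrite zpart_half.
  by rewrite /cotq mul1r cexp_pi addNr mulr0 mul0r subr0.
set y := complex.Im z in y0; set x := complex.Re z.
(* the corner of the path *)
pose z1 : C := (1 / 2) +i* y.
have half_E : (1 / 2 : C) = (1 / 2) +i* 0.
  by apply: complexP; rewrite ?Re_half ?Im_half /= ?mul0r.
have s1 : c z1 - cotq z1 = c (1 / 2) - cotq (1 / 2).
  apply: (@cot_segment c _ _ (1 / 4) 1) => // s /andP[s0 s1].
  set w := _ + _; have wE : w = (1 / 2) +i* (s * y).
    by rewrite /w half_E /z1; apply: complexP; rewrite /=; ring.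
  (* q is negative on the vertical segment, so |q - 1| >= 1 *)
  have ew : cexp (c2pi R * w) = (- expR (- (2 * pi * (s * y))))%:C.
    rewrite cexpE Re_c2pi Im_c2pi wE /=.
    have -> : 2 * pi * (1 / 2) = pi :> R by field.
    by rewrite cospi sinpi; apply: complexP; rewrite /= ?mulr0 ?mulrN1.
  split.
  - by move=> m; apply: half_dist; rewrite wE.
  - rewrite ew cn_real normrN ger0_norm ?expR_ge0 // expR_le1 oppr_le0.
    by rewrite !mulr_ge0 // ltW.
  rewrite ew mul1r -(rmorph1 (real_complex R)) -rmorphB cn_real -opprD normrN ger0_norm.
    by rewrite lerDr expR_ge0.
  by rewrite addr_ge0 // expR_ge0.
set A := 1 / 2 + `|x|.
have A0 : 0 <= A by rewrite addr_ge0.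
have s2 : c z - cotq z = c z1 - cotq z1.
  have e1 : 0 < 1 - expR (- (2 * pi * y)) by rewrite subr_gt0 expR_lt1 oppr_lt0 !mulr_gt0.
  apply: (@cot_segment c _ _ ((1 + (1 + A) / y)^-1) ((1 - expR (- (2 * pi * y)))^-1)) => //.
    by rewrite invr_gt0 ltr_pwDl // divr_ge0 ?addr_ge0 // ltW.
  move=> s /andP[s0 s1'].
  set w := _ + _.
  have wE : w = (1 / 2 + s * (x - 1 / 2)) +i* y.
    by rewrite /w /z1 [z]complexE -/x -/y; apply: complexP; rewrite /=; ring.
  (* |q| is constant and less than 1 on the horizontal segment *)
  have cw : cn (cexp (c2pi R * w)) = expR (- (2 * pi * y)).
    by rewrite cn_cexp Re_c2pi wE.
  split.
  - move=> m; rewrite mulrC ler_pdivrMr; last by rewrite ltr_pwDl // divr_ge0 ?addr_ge0 // ltW.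
    have h1 := cn_Im (w + m%:~R); have h2 := cn_Re (w + m%:~R).
    rewrite ImD ReD wE intr_complex /= addr0 ger0_norm ?(ltW y0) // in h1 h2.
    have h3 : absR R m <= cn (w + m%:~R) + A.
      rewrite wE intr_complex; apply: (@le_trans _ _ (`|1 / 2 + s * (x - 1 / 2) + m%:~R| + A)); last by rewrite lerD2r.
      have h4 : `|1 / 2 + s * (x - 1 / 2)| <= A.
        have -> : 1 / 2 + s * (x - 1 / 2) = (1 - s) * (1 / 2) + s * x by ring.
        apply: le_trans (ler_normD _ _) _; rewrite (normrM (1 - s)) (normrM s) /A.
        rewrite (ger0_norm s0) (ger0_norm (_ : 0 <= 1 - s)) ?subr_ge0 // (ger0_norm (_ : 0 <= 1 / 2 :> R)) //.
        have := normr_ge0 x; nra.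
      have := ler_normB (1 / 2 + s * (x - 1 / 2) + m%:~R) (1 / 2 + s * (x - 1 / 2)).
      rewrite addrAC subrr add0r /absR intr_norm; lra.
    have h5 : 1 <= cn (w + m%:~R) / y by rewrite ler_pdivlMr // mul1r wE intr_complex.
    rewrite mulrDr mulr1; apply: (@le_trans _ _ (cn (w + m%:~R) + (1 + A))); first lra.
    rewrite lerD2l mulrCA -[leLHS]mulr1; apply: ler_wpM2l => //; by rewrite addr_ge0.
  - by rewrite cw expR_le1 oppr_le0 !mulr_ge0 // ltW.
  rewrite mulrC ler_pdivlMr // mul1r -cw -[cn (_ - 1)]cnN opprB.
  by have := cn_leD 1 (- cexp (c2pi R * w)); rewrite cn1 cnN.
by rewrite s2 s1 c2.
Qed.

End Cotangent.

(** * Eisenstein's sum of weight 2 *)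

Section EisensteinSum.
Variable R : realType.
Local Notation C := R[i].
Implicit Types (z w : C).

Definition wt (m : int) : R := ((1 + absR R m) ^+ 2)^-1.

Lemma wt_ge0 m : 0 <= wt m.
Proof. by rewrite invr_ge0 exprn_ge0 // addr_ge0 // absR_ge0. Qed.

Lemma sums_symz (b : int -> int -> C) (r : int -> C) k :
  (forall m, zsums (b m) (r m)) ->
  sums (fun l => symz (fun m => symz (b m) l) k) (symz r k).
Proof.
move=> br; case: k => [|k] /=; first exact/zsums_sums.
have h1 := (zsums_sums _ _).1 (br k.+1%:Z); have h2 := (zsums_sums _ _).1 (br (- k.+1%:Z)).
apply/sumsE; apply: (tends_ext _ (tendsD ((sumsE _ _).1 h1) ((sumsE _ _).1 h2))) => N.
by rewrite big_split.
Qed.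

Lemma symzC (b : int -> int -> C) k l :
  symz (fun m => symz (b m) l) k = symz (fun n => symz (b^~ n) k) l.
Proof. by case: k => [|k]; case: l => [|l] //=; ring. Qed.

(** Pairing opposite indices in both variables reduces to natural indices. *)
Lemma zsums_exchange (b : int -> int -> C) (K : R) (r s : int -> C) X : 0 <= K ->
  (forall m n, cn (b m n) <= K * wt m * wt n) ->
  (forall m, zsums (b m) (r m)) -> (forall n, zsums (b^~ n) (s n)) ->
  zsums r X -> zsums s X.
Proof.
move=> K0 bK br bs /zsums_sums rX; apply/zsums_sums.
apply: (@sums_exchange R (fun k l => symz (fun m => symz (b m) l) k)
  (fun k => 4 * K * (k.+1%:R ^+ 2)^-1) (fun l => (l.+1%:R ^+ 2)^-1) (4 * K * 2) 2 (symz r) (symz s) X _ _ _ _ _ rX).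
- by apply: bsumsZ (bsums_invsqr R); rewrite mulr_ge0.
- exact: bsums_invsqr.
- move=> k l; have h m : cn (symz (b m) l) <= (2 * K * (l.+1%:R ^+ 2)^-1) * wt m.
    apply: le_trans (@symz_le R (b m) (K * wt m) l (bK m)) _.
    by rewrite le_eqVlt; apply/orP; left; apply/eqP; ring.
  apply: le_trans (@symz_le R (fun m => symz (b m) l) _ k h) _.
  by rewrite le_eqVlt; apply/orP; left; apply/eqP; ring.
- by move=> k; apply: sums_symz.
move=> l; apply: (@sums_ext R (fun k => symz (fun n => symz (b^~ n) k) l)); last exact: sums_symz.
by move=> k; rewrite symzC.
Qed.

(** The imaginary part of r tau + s bounds r, then the real part bounds s. *)
Lemma lattice_dist (tau : C) : 0 < complex.Im tau ->
  exists2 d : R, 0 < d & forall r s : R, d * (`|r| + `|s|) <= cn (r%:C * tau + s%:C).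
Proof.
set y := complex.Im tau; set x := complex.Re tau => y0.
set e := y^-1 + (1 + `|x| / y).
have e0 : 0 < e by rewrite ltr_pwDl ?invr_gt0 // addr_ge0 // divr_ge0 // ltW.
exists e^-1; first by rewrite invr_gt0.
move=> r s; rewrite mulrC ler_pdivrMr //.
set c := cn _.
have hI := cn_Im (r%:C * tau + s%:C); have hR := cn_Re (r%:C * tau + s%:C).
rewrite -/c ImD Im_mul /= mul0r !addr0 -/y in hI.
rewrite -/c ReD Re_mul /= mul0r subr0 -/x in hR.
have h1 : `|r| <= c / y.
  by rewrite ler_pdivlMr //; apply: le_trans hI; rewrite normrM (gtr0_norm y0).
have h2 : `|s| <= c + `|r| * `|x|.
  have := ler_normB (r * x + s) (r * x); rewrite addrAC subrr add0r normrM; lra.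
have h3 : `|r| * `|x| <= c / y * `|x| by rewrite ler_wpM2r.
have -> : c * e = c / y + (c + c / y * `|x|) by rewrite /e; ring.
lra.
Qed.

Lemma phiqN z : nonint z -> phiq (- z) = phiq z.
Proof.
move=> zi; have := q_neq1 zi; rewrite /phiq mulrN cexpN.
move: (cexp _) (cexp_neq0 (c2pi R * z)) => q q0 q1.
have n1 : 1 - q != 0 by rewrite subr_eq0 eq_sym.
have n2 : q - 1 != 0 by rewrite subr_eq0.
by field; rewrite q0 n1 n2.
Qed.

Lemma nonint_Im z : complex.Im z != 0 -> nonint z.
Proof.
move=> y0 m; apply: contraNneq y0 => /(congr1 (@complex.Im R)).
by rewrite ImD intr_complex /= addr0 => ->.
Qed.

Lemma Im_intM (m : int) (tau : C) : complex.Im (m%:~R * tau) = m%:~R * complex.Im tau.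
Proof. by rewrite intr_complex Im_mul /= mul0r addr0. Qed.

Lemma nonint_intM (m : int) (tau : C) : 0 < complex.Im tau -> m != 0 -> nonint (m%:~R * tau).
Proof.
move=> t0 m0; apply: nonint_Im; rewrite Im_intM mulf_neq0 ?intr_eq0 //.
by rewrite gt_eqF.
Qed.

(** The sum over n of 1 / (m tau + n)^2, without the summand at the origin. *)
Definition row_sum (tau : C) (m : int) : C :=
  if m == 0 then (pi ^+ 2 / 3)%:C else phiq (m%:~R * tau).

Lemma zsums_row (tau : C) (m : int) : 0 < complex.Im tau ->
  zsums (fun n => ((m%:~R * tau + n%:~R) ^+ 2)^-1) (row_sum tau m).
Proof.
move=> t0; rewrite /row_sum; case: eqP => [->|/eqP m0].
  by apply: (zsums_ext _ (@zsums_zeta2 R)) => n; rewrite mul0r add0r.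
exact/zsums_sqr/nonint_intM.
Qed.

Lemma row_even tau m : 0 < complex.Im tau -> row_sum tau (- m) = row_sum tau m.
Proof.
move=> t0; rewrite /row_sum oppr_eq0; case: eqP => // /eqP m0.
by rewrite mulrNz mulNr phiqN //; apply: nonint_intM.
Qed.

(** The summand 1 / x^2 made absolutely summable by a telescoping correction;
    at the origin the convention 0^-1 = 0 gives the value 4. *)
Definition corr (x : C) := (x ^+ 2)^-1 - (x ^+ 2 - 4^-1)^-1.

(** As x^2 - 1/4 = (x - 1/2) (x + 1/2), the summand has the order of the inverse
    fourth power of |m| + |n|, and this is at most a product of inverse squares. *)
Lemma corr_le (tau : C) : 0 < complex.Im tau -> exists2 K : R, 0 <= K &
  forall m n : int, cn (corr (m%:~R * tau + n%:~R)) <= K * wt m * wt n.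
Proof.
move=> t0; have [d d0 dl] := lattice_dist t0.
exists (4 + 16 / d ^+ 4) => [|m n].
  by rewrite addr_ge0 // divr_ge0 // exprn_ge0 // ltW.
have K0 : 0 <= 16 / d ^+ 4 by rewrite divr_ge0 // exprn_ge0 // ltW.
have [/andP[/eqP-> /eqP->]|mn0] := boolP ((m == 0) && (n == 0)).
  rewrite mul0r addr0 /corr /wt /absR normr0 addr0 expr1n invr1 !mulr1 expr0n /= invr0 !sub0r.
  by rewrite invrN invrK opprK cn_nat lerDl.
set a := absR R m; set b := absR R n; set X := m%:~R * tau + n%:~R.
have a0 : 0 <= a := absR_ge0 _ _; have b0 : 0 <= b := absR_ge0 _ _.
have b1 : b = 0 \/ 1 <= b.
  by rewrite /b; have [->|n0] := eqVneq n 0; [left; rewrite /absR normr0|right; rewrite /absR ler1z; lia].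
have ab1 : a + b >= 1.
  have := mn0; rewrite negb_and /a /b => /orP[m0|n0].
    have : 1 <= absR R m by rewrite /absR ler1z; lia.
    have := absR_ge0 R n; lra.
  have : 1 <= absR R n by rewrite /absR ler1z; lia.
  have := absR_ge0 R m; lra.
have aE : a = `|m%:~R| by rewrite /a /absR intr_norm.
have bE : b = `|n%:~R| by rewrite /b /absR intr_norm.
have shift (e : R) : `|e| <= 1 / 2 -> d * ((a + b) / 2) <= cn (X + e%:C).
  move=> e2; have := dl m%:~R (n%:~R + e); rewrite !rmorphD /= -!intr_complex -aE addrA => h.
  apply: le_trans h; rewrite ler_pM2l //.
  have := ler_normB (n%:~R + e) e; rewrite addrK -bE; case: b1; lra.
have hX : d * (a + b) <= cn X by have := dl m%:~R n%:~R; rewrite -!intr_complex -aE -bE.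
have S0 : 0 < d * (a + b) by rewrite mulr_gt0 //; lra.
have X0 : X != 0 by rewrite -cn_gt0; apply: lt_le_trans hX.
have h2E := @half_realE R.
have h1 := shift (1 / 2); have h2 := shift (- (1 / 2)).
rewrite rmorphN /= h2E normrN ger0_norm ?divr_ge0 // lexx in h1 h2.
have {}h1 := h1 isT; have {}h2 := h2 isT.
have S1 : 0 < d * ((a + b) / 2) by rewrite mulr_gt0 //; lra.
have Y1 : X + 1 / 2 != 0 by rewrite -cn_gt0; apply: lt_le_trans h1.
have Y2 : X - 1 / 2 != 0 by rewrite -cn_gt0; apply: lt_le_trans h2.
have -> : corr X = - (4^-1 * ((X ^+ 2) * ((X + 1 / 2) * (X - 1 / 2)))^-1).
  rewrite /corr (_ : X ^+ 2 - 4^-1 = (X + 1 / 2) * (X - 1 / 2)); last by field.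
  move: Y1 Y2; rewrite (_ : X + 1 / 2 = (2 * X + 1) / 2); last by field.
  rewrite (_ : X - 1 / 2 = (2 * X - 1) / 2); last by field.
  rewrite !mulf_eq0 !negb_or => /andP[Y1 _] /andP[Y2 _].
  by field; rewrite X0 Y1 Y2.
rewrite cnN cnM 2!cnV cn_nat (cnM (_ ^+ 2)) cnX (cnM (_ + _)).
have P0 : 0 < (d * (a + b)) ^+ 2 * ((d * ((a + b) / 2)) * (d * ((a + b) / 2))).
  by apply: mulr_gt0; [apply: exprn_gt0|apply: mulr_gt0].
have hP : (d * (a + b)) ^+ 2 * ((d * ((a + b) / 2)) * (d * ((a + b) / 2))) <=
   cn X ^+ 2 * (cn (X + 1 / 2) * cn (X - 1 / 2)).
  apply: ler_pM; first exact: sqr_ge0.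
  - by apply: mulr_ge0; apply: ltW.
  - by rewrite lerXn2r ?nnegrE ?cn_ge0 // ltW.
  by apply: ler_pM => //; apply: ltW.
apply: (@le_trans _ _ (4^-1 * ((d * (a + b)) ^+ 2 * ((d * ((a + b) / 2)) * (d * ((a + b) / 2))))^-1)).
  by rewrite ler_wpM2l ?invr_ge0 // lef_pV2 ?posrE //; apply: lt_le_trans hP.
apply: (@le_trans _ _ (16 / d ^+ 4 * wt m * wt n)); last first.
  by rewrite ler_wpM2r ?wt_ge0 // ler_wpM2r ?wt_ge0 // lerDr.
rewrite /wt -/a -/b.
have -> : 16 / d ^+ 4 * ((1 + a) ^+ 2)^-1 * ((1 + b) ^+ 2)^-1 =
   (d ^+ 4 * (((1 + a) / 2) ^+ 2 * ((1 + b) / 2) ^+ 2))^-1.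
  by field; rewrite !gt_eqF //; lra.
have -> : 4^-1 * ((d * (a + b)) ^+ 2 * ((d * ((a + b) / 2)) * (d * ((a + b) / 2))))^-1 =
   (d ^+ 4 * ((a + b) ^+ 2 * (a + b) ^+ 2))^-1.
  by field; rewrite !gt_eqF //; lra.
have d4 : 0 < d ^+ 4 by apply: exprn_gt0.
have ha : 0 < (1 + a) / 2 by lra.
have hb : 0 < (1 + b) / 2 by lra.
have hab : 0 < a + b by lra.
have pp (x y : R) : 0 < x -> 0 < y -> 0 < d ^+ 4 * (x ^+ 2 * y ^+ 2).
  by move=> x0 y0; apply: mulr_gt0 => //; apply: mulr_gt0; apply: exprn_gt0.
rewrite lef_pV2 ?posrE ?pp // ler_pM2l //.
by apply: ler_pM; rewrite ?sqr_ge0 // lerXn2r ?nnegrE ?(ltW ha) ?(ltW hb) ?(ltW hab) //; lra.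
Qed.

Lemma tends_inv_natN z : tends (fun n => (z - n%:R)^-1) 0.
Proof.
have := tendsZ (c := -1) (tends_inv_nat (- z)); rewrite mulr0; apply: tends_ext => n.
by rewrite mulN1r -invrN opprD opprK.
Qed.

(** 1 / (x^2 - 1/4) = 1 / (x - 1/2) - 1 / (x + 1/2) telescopes to 0 in n. *)
Lemma zsums_corr_row (tau : C) (m : int) : 0 < complex.Im tau ->
  zsums (fun n => corr (m%:~R * tau + n%:~R)) (row_sum tau m).
Proof.
move=> t0; set z := m%:~R * tau.
pose g (n : int) : C := (z - 1 / 2 + n%:~R)^-1.
have nz n : z - 1 / 2 + n%:~R != 0 :> C.
  have [m0|m0] := eqVneq m 0.
    rewrite /z m0 mul0r sub0r.
    have -> : - (1 / 2) + n%:~R = (2 * n - 1)%:~R / 2 :> C by rewrite intrD mulrNz intrM; field.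
    rewrite mulf_neq0 ?invr_eq0 ?pnatr_eq0 // intr_eq0; lia.
  apply: nonint_Im; rewrite ImB Im_half /= mul0r subr0 Im_intM.
  by apply: mulf_neq0; rewrite ?intr_eq0 // gt_eqF.
have tele : zsums (fun n => g n - g (n + 1)) 0.
  apply: (@tends_ext _ (fun N => g (- N%:Z) - g N.+1%:Z)) => [N|]; first by rewrite zpart_tele.
  rewrite -[0]subr0; apply: tendsB.
    by apply: (tends_ext _ (tends_inv_natN (z - 1 / 2))) => N; rewrite /g mulrNz.
  by apply: (tends_ext _ ((tendsS _ _).2 (tends_inv_nat (z - 1 / 2)))).
have := zsums_lin (c := 1) (d := -1) (zsums_row (m := m) t0) tele.
rewrite mulr0 addr0 mul1r; apply: zsums_ext => n.
have h1 := nz n; have h2 := nz (n + 1).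
rewrite /corr -/z /g.
rewrite (_ : (z + n%:~R) ^+ 2 - 4^-1 = (z - 1 / 2 + n%:~R) * (z - 1 / 2 + (n + 1)%:~R)); last first.
  by rewrite intrD; field.
have -> : z - 1 / 2 + (n + 1)%:~R = (z - 1 / 2 + n%:~R) + 1 by rewrite intrD addrA.
have h3 : (z - 1 / 2 + n%:~R) + 1 != 0 by have := h2; rewrite intrD addrA.
move: (z - 1 / 2 + n%:~R) h1 h3 => u u0 u1; rewrite mul1r; congr (_ + _).
by field; rewrite u0 u1.
Qed.

Lemma Im_oppV (tau : C) : 0 < complex.Im tau -> 0 < complex.Im (- tau^-1).
Proof.
case: tau => x y /= y0; rewrite opprK.
by rewrite divr_gt0 // ltr_wpDl ?sqr_ge0 // exprn_gt0.
Qed.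

(** Summed over m, the correction gives cotangents at (n - 1/2) / tau and
    (n + 1/2) / tau, whose difference telescopes only in the sum over n. *)
Lemma zsums_corr_col (tau : C) (c : C -> C) (n : int) : 0 < complex.Im tau ->
  (forall z, nonint z -> zsums (fun m => (z + m%:~R)^-1) (c z)) ->
  zsums (fun m => corr (m%:~R * tau + n%:~R))
   ((tau ^+ 2)^-1 * row_sum (- tau^-1) n
      - tau^-1 * (c ((n%:~R - 1 / 2) / tau) - c ((n%:~R + 1 / 2) / tau))).
Proof.
move=> t0 cP.
have tn0 : tau != 0 by apply: contraTneq t0 => ->; rewrite ltxx.
have t0' := Im_oppV t0.
have IV : complex.Im (tau^-1) != 0 by rewrite -oppr_eq0 -ImN gt_eqF.
have hn (e : R) : n%:~R + e != 0 -> nonint ((n%:~R + e%:C) / tau).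
  move=> e0; apply: nonint_Im; rewrite intr_complex -rmorphD Im_mul /= mul0r addr0.
  exact: mulf_neq0.
have h2E := @half_realE R.
have odd2 (b : int) : b = 1 \/ b = -1 -> n%:~R + b%:~R / 2 != 0 :> R.
  move=> b1; have -> : n%:~R + b%:~R / 2 = (2 * n + b)%:~R / 2 :> R by rewrite intrD intrM; field.
  rewrite mulf_neq0 ?invr_eq0 ?pnatr_eq0 // intr_eq0; lia.
have i1 := hn _ (odd2 (-1) (or_intror erefl)); have i2 := hn _ (odd2 1 (or_introl erefl)).
rewrite mulrNz mulNr rmorphN /= h2E in i1; rewrite /= h2E in i2.
have hr : zsums (fun m => (((- n)%:~R * - tau^-1 + m%:~R) ^+ 2)^-1) (row_sum (- tau^-1) n).
  by rewrite -(row_even n t0'); apply: zsums_row.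
have hs := zsums_lin (c := 1) (d := -1) (cP _ i1) (cP _ i2).
have := zsums_lin (c := (tau ^+ 2)^-1) (d := - tau^-1) hr hs.
have -> : (tau ^+ 2)^-1 * row_sum (- tau^-1) n + - tau^-1 *
   (1 * c ((n%:~R - 1 / 2) / tau) + -1 * c ((n%:~R + 1 / 2) / tau)) =
   (tau ^+ 2)^-1 * row_sum (- tau^-1) n - tau^-1 * (c ((n%:~R - 1 / 2) / tau) - c ((n%:~R + 1 / 2) / tau)).
  by ring.
apply: zsums_ext => m.
set x := m%:~R * tau + n%:~R.
have -> : (- n)%:~R * - tau^-1 + m%:~R = x / tau by rewrite /x mulrNz; field.
have e1 : (n%:~R - 1 / 2) / tau + m%:~R = (x - 1 / 2) / tau by rewrite /x; field.
have e2 : (n%:~R + 1 / 2) / tau + m%:~R = (x + 1 / 2) / tau by rewrite /x; field.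
have x1 : x - 1 / 2 != 0.
  have := i1 m; rewrite e1; apply: contraNneq => ->; by rewrite mul0r.
have x2 : x + 1 / 2 != 0.
  have := i2 m; rewrite e2; apply: contraNneq => ->; by rewrite mul0r.
rewrite e1 e2 /corr -invfM exprMn -exprMn; congr (_ + _).
  by rewrite -exprMn mulrC divfK.
rewrite (_ : x ^+ 2 - 4^-1 = (x - 1 / 2) * (x - 1 / 2 + 1)); last by field.
have x3 : x - 1 / 2 + 1 != 0 by rewrite (_ : _ + 1 = x + 1 / 2) //; field.
rewrite (_ : x + 1 / 2 = x - 1 / 2 + 1); last by field.
by move: (x - 1 / 2) x1 x3 => u u0 u1; field; rewrite u0 u1 tn0.
Qed.

Lemma zpart_opp (f : int -> C) N : zpart (fun m => f (- m)) N = zpart f N.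
Proof. by elim: N => [|N IHN]; rewrite ?zpart0 ?oppr0 // !zpartS IHN opprK; ring. Qed.

Lemma zsums_invN (w l : C) : zsums (fun m => (w + m%:~R)^-1) l ->
  zsums (fun m => (- w + m%:~R)^-1) (- l).
Proof.
move=> wl; have := tendsZ (c := -1) wl; rewrite mulN1r; apply: tends_ext => N.
rewrite -(zpart_opp (fun m => (w + m%:~R)^-1)) zpartZ; congr zpart; apply/funext => m.
by rewrite mulN1r -invrN mulrNz opprD opprK.
Qed.

Lemma cotq_lim (z : C) : 0 < complex.Im z ->
  tends (fun N => cotq ((N%:R + 1 / 2) * z)) (- ipi R).
Proof.
move=> y0; have p0 := @pi_gt0 R.
set y := complex.Im z in y0.
pose r := expR (- (2 * pi * y)).
have r1 : r < 1 by rewrite expR_lt1 oppr_lt0 !mulr_gt0.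
have r0 : 0 < r := expR_gt0 _.
pose s := expR (- (pi * y)).
have s1 : s < 1 by rewrite expR_lt1 oppr_lt0 !mulr_gt0.
apply: (@tends_bound _ _ _ (fun N => (2 * pi / (1 - s)) * r ^+ N)); last first.
  rewrite -[0](mulr0 (2 * pi / (1 - s))); apply: cvgM; first exact: cvg_cst.
  by apply: cvg_expr; rewrite ger0_norm // ltW.
move=> N; rewrite /cotq; set q := cexp _.
have qE : cn q = r ^+ N * s.
  rewrite /q cn_cexp Re_c2pi -expRM_natr -expRD; congr expR.
  have -> : (N%:R + 1 / 2 : C) = (N%:R + 1 / 2 : R)%:C.
    by rewrite rmorphD rmorph_nat /= half_realE.
  by rewrite Im_mul /= mul0r addr0 -/y; field.
have rN : r ^+ N <= 1 by rewrite exprn_ile1 // ltW.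
have rN0 : 0 <= r ^+ N by rewrite exprn_ge0 // ltW.
have s0 : 0 <= s := expR_ge0 _.
have q1 : 1 - s <= cn (q - 1).
  rewrite -cnN opprB; have := cn_leD 1 (- q); rewrite cn1 cnN qE.
  have : r ^+ N * s <= s by rewrite ler_piMl.
  lra.
have sp : 0 < 1 - s by rewrite subr_gt0.
have q2 : q - 1 != 0 by rewrite -cn_gt0; apply: lt_le_trans q1.
have -> : ipi R * (q + 1) / (q - 1) - - ipi R = c2pi R * q / (q - 1).
  by rewrite c2piE; field.
clearbody q.
rewrite 2!cnM cn_c2pi cnV qE.
have -> : 2 * pi / (1 - s) * r ^+ N = 2 * pi * r ^+ N / (1 - s) by ring.
apply: ler_pM.
- by apply: mulr_ge0; [apply: mulr_ge0 => //; exact: ltW|exact: mulr_ge0].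
- by rewrite invr_ge0 cn_ge0.
- apply: ler_wpM2l; first by apply: mulr_ge0 => //; exact: ltW.
  by rewrite ler_piMr // ltW.
by rewrite lef_pV2 ?posrE //; apply: lt_le_trans q1.
Qed.

(** The corrected sum is absolutely convergent, so its rows and columns add up
    to the same value. The rows give G; the columns give G' / tau^2 and the
    boundary terms of the telescoping cotangents, which tend to - pi i and pi i. *)
Lemma G2_inv (tau G G' : C) : 0 < complex.Im tau ->
  zsums (row_sum tau) G -> zsums (row_sum (- tau^-1)) G' ->
  G = (tau ^+ 2)^-1 * G' + c2pi R / tau.
Proof.
move=> t0 hG hG'; have [K K0 cK] := corr_le t0.
have [c cP] := @zsums_inv_fun R.
have tn0 : tau != 0 by apply: contraTneq t0 => ->; rewrite ltxx.
have t0' := Im_oppV t0.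
have pos N : 0 < complex.Im ((N%:R + 1 / 2) * - tau^-1).
  have -> : (N%:R + 1 / 2 : C) = (N%:R + 1 / 2 : R)%:C.
    by rewrite rmorphD rmorph_nat /= half_realE.
  by rewrite Im_mul /= mul0r addr0; apply: mulr_gt0 => //; rewrite ltr_wpDl.
have cols := fun n => zsums_corr_col (n := n) t0 cP.
have hs := zsums_exchange K0 cK (fun m => zsums_corr_row (m := m) t0) cols hG.
pose h (n : int) := c ((n%:~R - 1 / 2) / tau).
have hh n : c ((n%:~R + 1 / 2) / tau) = h (n + 1).
  by rewrite /h intrD; congr (c (_ / _)); field.
have lim1 : tends (fun N => h N.+1%:Z) (ipi R).
  have := tendsZ (c := -1) (cotq_lim t0'); rewrite mulN1r opprK.
  apply: tends_ext => N.
  have -> : h N.+1%:Z = c (- ((N%:R + 1 / 2) * - tau^-1)).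
    rewrite /h mulrN opprK; suff -> : N.+1%:Z%:~R - 1 / 2 = N%:R + 1 / 2 :> C by [].
    by rewrite -[N.+1%:~R]/(N.+1%:R) -natr1; field.
  rewrite mulN1r; apply: tends_unique (zsums_invN (zsums_cot (pos N))) (cP _ _).
  by apply: nonint_Im; rewrite ImN oppr_eq0 gt_eqF // pos.
have lim2 : tends (fun N => h (- N%:Z)) (- ipi R).
  apply: (tends_ext _ (cotq_lim t0')) => N.
  have -> : h (- N%:Z) = c ((N%:R + 1 / 2) * - tau^-1).
    by rewrite /h mulrNz -[N%:Z%:~R]/(N%:R) mulrN -mulNr opprD.
  by apply: tends_unique (zsums_cot (pos N)) (cP _ _); apply: nonint_Im; rewrite gt_eqF // pos.
apply: tends_unique hs _.
apply: (@tends_ext _ (fun N => (tau ^+ 2)^-1 * zpart (row_sum (- tau^-1)) N - tau^-1 * (h (- N%:Z) - h N.+1%:Z))).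
  move=> N; rewrite -zpart_tele !zpartZ.
  have := zpart_lin 1 (-1) (fun n => (tau ^+ 2)^-1 * row_sum (- tau^-1) n) (fun n => tau^-1 * (h n - h (n + 1))) N.
  rewrite [1 * zpart _ _]mul1r mulN1r => <-; congr zpart; apply/funext => n.
  by rewrite hh mul1r mulN1r.
have -> : (tau ^+ 2)^-1 * G' + c2pi R / tau = (tau ^+ 2)^-1 * G' - tau^-1 * (- ipi R - ipi R).
  by rewrite c2piE; field.
exact: (tendsB (tendsZ (c := (tau ^+ 2)^-1) hG') (tendsZ (c := tau^-1) (tendsB lim2 lim1))).
Qed.

End EisensteinSum.

(** * Quasi-modularity of E2 *)

Section Lambert.
Variable R : realType.
Local Notation C := R[i].

Lemma bsums_shift (a : nat -> R) B : bsums a B -> bsums (fun n => a n.+1) B.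
Proof.
move=> [a0 aB]; split=> // N; apply: le_trans (aB N.+1).
by rewrite big_ord_recl /= lerDr.
Qed.

Lemma sums_finite (u : nat -> C) M : (forall k, (M <= k)%N -> u k = 0) ->
  sums u (\sum_(k < M) u k).
Proof.
move=> u0; apply/sumsE; apply/tendsP.
apply: (@cvg_near_cst _ _ 0).
exists M => // N /= MN.
rewrite -!(big_mkord xpredT u) (@big_cat_nat _ _ _ M) //=.
rewrite addrAC subrr add0r big_nat_cond big1 ?cn0 // => k /andP[/andP[Mk _] _].
exact: u0.
Qed.

Lemma sums_deriv_geometric (x : C) t : 0 < t -> cn x = expR (- t) ->
  sums (fun d => d.+1%:R * x ^+ d.+1) (x / (1 - x) ^+ 2).
Proof.
move=> t0 xt; have x1 : cn x < 1 by rewrite xt expR_lt1 oppr_lt0.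
have n1 : 1 - x != 0.
  by apply: contraTneq x1 => /eqP; rewrite subr_eq0 => /eqP <-; rewrite cn1 ltxx.
have [B bB] := bsums_expR 1 t0.
have xb n : cn (n%:R * x ^+ n) <= n%:R ^+ 1 * expR (- t) ^+ n.
  by rewrite cnM cn_nat cnX xt expr1.
have [l h] := sums_bounded bB xb.
have h0 : tends (fun n => n%:R * x ^+ n) 0 := cvg_series_cvg_0 (cvgP _ h).
apply/sumsE.
(* closed form of the partial sums *)
apply: (@tends_ext _ (fun K => ((x - (K.+1%:R * x ^+ K.+1)) + (K%:R * x ^+ K) * (x * x)) / (1 - x) ^+ 2)).
  move=> K; apply: (mulIf (expf_neq0 2 n1)); rewrite divfK ?expf_neq0 //.
  elim: K => [|K IHK]; first by rewrite big_ord0 !mul0r addr0 expr1 mul1r subrr.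
  by rewrite big_ord_recr /= [RHS]mulrDl -IHK -[K.+2%:R]natr1 -[K.+1%:R]natr1 !exprS; ring.
rewrite (_ : x / (1 - x) ^+ 2 = ((x - 0) + 0 * (x * x)) / (1 - x) ^+ 2); last by rewrite subr0 mul0r addr0.
apply: tendsM (tends_cst _); apply: tendsD; last exact: tendsM h0 (tends_cst _).
by apply: tendsB (tends_cst _) _; apply/(tendsS (fun n => n%:R * x ^+ n)).
Qed.

(** d -> (n + 1) / d permutes the divisors of n + 1. *)
Lemma sum_divisors (n : nat) :
  (\sum_(m < n.+1 | (m.+1 %| n.+1)%N) n.+1 %/ m.+1 = \sum_(d <- divisors n.+1) d)%N.
Proof.
transitivity (\sum_(d <- [seq (n.+1 %/ m.+1)%N | m <- iota 0 n.+1 & (m.+1 %| n.+1)%N]) d)%N.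
  by rewrite big_map big_filter -(big_mkord (fun m => m.+1 %| n.+1)%N (fun m => n.+1 %/ m.+1)%N) /index_iota subn0.
apply: perm_big; apply: uniq_perm.
- rewrite map_inj_in_uniq ?filter_uniq ?iota_uniq // => m k.
  rewrite !mem_filter => /andP[mn _] /andP[kn _] e.
  have : (n.+1 %/ (n.+1 %/ m.+1) = n.+1 %/ (n.+1 %/ k.+1))%N by rewrite e.
  by rewrite !divnA // !mulKn // => -[].
- exact: divisors_uniq.
move=> d; rewrite -dvdn_divisors //; apply/mapP/idP.
  case=> m; rewrite mem_filter => /andP[mn _] ->.
  by apply/dvdnP; exists m.+1; rewrite mulnC divnK.
move=> dn; have d0 : (0 < d)%N by apply: dvdn_gt0 dn.
have nd0 : (0 < n.+1 %/ d)%N by rewrite divn_gt0 // dvdn_leq.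
exists (n.+1 %/ d).-1; rewrite ?mem_filter prednK //.
  by rewrite dvdn_div // mem_iota add0n /= prednK // leq_div.
by rewrite divnA // mulKn.
Qed.

(** Both series are iterated sums of (n / m) q^n over the pairs of positive
    integers such that m divides n: summing over n first gives the first one,
    summing over m first the second one. The terms are at most n^3 |q|^n / m^2. *)
Lemma lambert_sigma (q : C) t : 0 < t -> cn q = expR (- t) ->
  exists2 X : C, sums (fun m => q ^+ m.+1 / (1 - q ^+ m.+1) ^+ 2) X &
    sums (fun n => (\sum_(d <- divisors n.+1) d)%:R * q ^+ n.+1) X.
Proof.
move=> t0 qt.
pose f (m n : nat) : C := if (m.+1 %| n.+1)%N then (n.+1 %/ m.+1)%:R * q ^+ n.+1 else 0.
pose b n : R := n.+1%:R ^+ 3 * expR (- t) ^+ n.+1.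
pose a m : R := (m.+1%:R ^+ 2)^-1.
have aA := bsums_invsqr R.
have [B bB'] := bsums_expR 3 t0.
have bB : bsums b B := bsums_shift bB'.
have fab m n : cn (f m n) <= a m * b n.
  rewrite /f; case: ifP => [mn|_]; last first.
    by rewrite cn0 mulr_ge0 ?aA.1 ?bB.1.
  rewrite cnM cn_nat cnX qt /b mulrA ler_wpM2r ?exprn_ge0 ?expR_ge0 //.
  rewrite /a mulrC ler_pdivlMr ?exprn_gt0 // -!natrX -natrM ler_nat.
  have ml : (m.+1 <= n.+1)%N by rewrite dvdn_leq.
  move: (n.+1 %/ m.+1)%N (divnK mn) => k <-; rewrite expnMn leq_mul ?leq_pexp2l //.
  by case: k => // k; rewrite -{1}[k.+1]expn1 leq_pexp2l.
have rows m : sums (f m) (q ^+ m.+1 / (1 - q ^+ m.+1) ^+ 2).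
  have amb : bsums (fun n => a m * b n) (a m * B) := bsumsZ (aA.1 m) bB.
  have [l fl] := sums_bounded amb (fab m).
  have tm : 0 < m.+1%:R * t by rewrite mulr_gt0.
  have qm : cn (q ^+ m.+1) = expR (- (m.+1%:R * t)).
    by rewrite cnX qt -expRM_natr mulrC mulrN.
  have := sums_deriv_geometric tm qm; move/sumsE => hd.
  suff <- : l = q ^+ m.+1 / (1 - q ^+ m.+1) ^+ 2 by [].
  have hs : tends (fun K => \sum_(n < m.+1 * K) f m n) l.
    by apply: (tends_sub _ ((sumsE _ _).1 fl)) => K; rewrite leq_pmull.
  apply: tends_unique hs _; apply: (tends_ext _ hd) => K.
  elim: K => [|K IHK]; first by rewrite muln0 !big_ord0.
  rewrite big_ord_recr /= IHK -!(big_mkord xpredT (f m)).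
  rewrite (@big_cat_nat _ _ _ (m.+1 * K) 0 (m.+1 * K.+1)) ?leq_mul //=; congr (_ + _).
  have -> : (m.+1 * K.+1 = (m.+1 * K + m).+1)%N by lia.
  rewrite big_nat_recr /=; last by lia.
  rewrite big_nat_cond big1 ?add0r => [|n /andP[/andP[n1 n2] _]].
    rewrite /f (_ : (m.+1 * K + m).+1 = m.+1 * K.+1)%N; last by lia.
    by rewrite dvdn_mulr // mulKn // exprM.
  rewrite /f; case: ifP => // /dvdnP[k nk]; exfalso.
  have : (k * m.+1 > K * m.+1)%N by lia.
  have : (k * m.+1 < K.+1 * m.+1)%N by lia.
  by rewrite !ltn_pmul2r //; lia.
have cols n : sums (f^~ n) ((\sum_(d <- divisors n.+1) d)%:R * q ^+ n.+1).
  have := @sums_finite (f^~ n) n.+1.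
  rewrite (_ : \sum_(k < n.+1) f k n = (\sum_(d <- divisors n.+1) d)%:R * q ^+ n.+1).
    apply=> k nk; rewrite /f; case: ifP => // /dvdn_leq; lia.
  rewrite -sum_divisors natr_sum mulr_suml big_mkcond.
  by rewrite [RHS]big_mkcond /=.
have rowsX : exists X : C, sums (fun m => q ^+ m.+1 / (1 - q ^+ m.+1) ^+ 2) X.
  have B0 := bsums_ge0 bB.
  apply: (@sums_bounded R _ (fun m => B * a m) _ (bsumsZ B0 aA)) => m.
  by rewrite [B * _]mulrC; apply: (sums_cn_le (bsumsZ (aA.1 m) bB) (fab m) (rows m)).
have [X hX] := rowsX; exists X => //.
exact: (@sums_exchange R f a b _ _ _ _ X aA bB fab rows cols hX).
Qed.

End Lambert.

Section E2Law.
Variable R : realType.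
Local Notation C := R[i].
Local Notation H := (upper_half R).

Lemma qpar_cn (tau : H) : exists2 t : R, 0 < t & cn (qpar tau) = expR (- t).
Proof.
exists (2 * pi * complex.Im (tau : C)); last by rewrite cn_qpar.
by rewrite mulr_gt0 ?uh_valP // mulr_gt0 // pi_gt0.
Qed.

Definition sigma_coef (n : nat) : C :=
  if n is k.+1 then - 24 * (\sum_(d <- divisors k.+1) d)%:R else 1.

Lemma E2_sums (tau : H) : exists2 X : C,
  sums (fun m => qpar tau ^+ m.+1 / (1 - qpar tau ^+ m.+1) ^+ 2) X &
  E2 tau = 1 - 24 * X /\
  sums (fun n => (\sum_(d <- divisors n.+1) d)%:R * qpar tau ^+ n.+1) X.
Proof.
have [t t0 qt] := qpar_cn tau; have [X hX1 hX2] := lambert_sigma t0 qt.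
exists X => //; split=> //; rewrite /E2; congr (_ - _ * _).
exact: (@norm_cvg_lim _ C^o).
Qed.

Lemma qseries_E2 : qseries (@E2 R) sigma_coef.
Proof.
move=> tau; have [X _ [-> hX]] := E2_sums tau.
apply/sumsE/tendsS.
have := tendsD (tends_cst (1 : C)) (tendsZ (c := - 24) ((sumsE _ _).1 hX)).
rewrite mulNr; apply: tends_ext => N; rewrite big_ord_recl /= mulr1; congr (_ + _).
by rewrite mulr_sumr; apply: eq_bigr => n _; rewrite mulrA.
Qed.

Lemma c2pi_sqr : c2pi R ^+ 2 = - 4 * (pi ^+ 2)%:C.
Proof.
rewrite /c2pi exprMn sqr_i -rmorphXn /= exprMn rmorphM /= rmorphXn /= rmorph_nat.
by ring.
Qed.

Lemma c2pi_neq0 : c2pi R != 0.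
Proof. by rewrite -cn_gt0 cn_c2pi mulr_gt0 // pi_gt0. Qed.

(** The rows m and - m agree, so the positive rows form a Lambert series; the
    row 0 is the constant term. *)
Lemma G2_E2 (tau : H) : zsums (row_sum (tau : C)) ((pi ^+ 2 / 3)%:C * E2 tau).
Proof.
have [X hX [-> _]] := E2_sums tau.
apply/zsums_sums/sumsE/tendsS.
have e : (pi ^+ 2 / 3)%:C * (1 - 24 * X) = (pi ^+ 2 / 3)%:C + (2 * c2pi R ^+ 2) * X.
  rewrite c2pi_sqr.
  have -> : ((pi : R) ^+ 2 / 3)%:C = ((pi : R) ^+ 2)%:C / 3 by rewrite rmorphM fmorphV /= rmorph_nat.
  by field.
rewrite e.
have := tendsD (tends_cst (pi ^+ 2 / 3)%:C) (tendsZ (c := 2 * c2pi R ^+ 2) ((sumsE _ _).1 hX)).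
apply: tends_ext => N; rewrite big_ord_recl /= mulr_sumr; congr (_ + _).
apply: eq_bigr => m _.
rewrite /bump leq0n add1n /= row_even ?uh_valP // /row_sum /= /phiq.
have -> : cexp (c2pi R * (m.+1%:Z%:~R * (tau : C))) = qpar tau ^+ m.+1.
  by rewrite -[m.+1%:Z%:~R]/(m.+1%:R) mulrCA cexpMn qparE.
ring.
Qed.

(** The factor 12 / (2 pi i) of the anomaly. *)
Definition kappa : C := 12 / c2pi R.

Lemma E2_inv (t t' : H) : (t' : C) = - (t : C)^-1 ->
  E2 t' = (t : C) ^+ 2 * E2 t + kappa * (t : C).
Proof.
move=> tt; have h' := @G2_E2 t'; rewrite tt in h'.
have := G2_inv (uh_valP t) (@G2_E2 t) h'.
have t0 : (t : C) != 0.
  by have := uh_valP t; apply: contraTneq => ->; rewrite ltxx.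
have p0 : (pi : R)%:C != 0 :> C by rewrite -cn_gt0 cn_real normr_gt0 gt_eqF // pi_gt0.
have c0 := c2pi_neq0; have c2 := c2pi_sqr.
have -> : ((pi : R) ^+ 2 / 3)%:C = - c2pi R ^+ 2 / 12.
  rewrite c2 rmorphM fmorphV /= rmorph_nat rmorphXn /=; by field.
rewrite /kappa; move: (t : C) t0 (E2 t) (E2 t') (c2pi R) c0 => z z0 e e' k k0 h.
have {}h := congr1 (fun x => x * z ^+ 2 * (- 12 / k ^+ 2)) h.
have {h} : z ^+ 2 * e = e' - 12 / k * z.
  apply: etrans (etrans h _); first by field; rewrite k0.
  by field; rewrite z0 k0.
by move=> ->; ring.
Qed.

Lemma inv_uh (t : H) : exists t' : H, (t' : C) = - (t : C)^-1.
Proof. by exists (UpperHalf (Im_oppV (uh_valP t))). Qed.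

Lemma E2_shift (t t' : H) (m : int) : (t' : C) = (t : C) + m%:~R -> E2 t' = E2 t.
Proof. by move=> tt; rewrite /E2 !qparE tt cexp_shift. Qed.

Lemma sl2_ex (a b c d : int) : a * d - b * c = 1 ->
  exists g : SL2Z, [/\ g 0 0 = a, g 0 1 = b, g 1 0 = c & g 1 1 = d].
Proof.
move=> h; pose M : 'M[int]_2 := \matrix_(i, j)
  if i == 0 then if j == 0 then a else b else if j == 0 then c else d.
have hM : \det M == 1 by rewrite det_mx2 !mxE /= h.
by exists (MkSL2Z hM); split; rewrite /= mxE.
Qed.

(** Induction on the bottom left entry c, by the Euclidean algorithm: if k is the
    quotient of the top left entry by c, then g = T^k S g', where the bottom left
    entry of g' is, up to sign, the remainder. *)
Lemma E2_mobius (g : SL2Z) (tau : H) :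
  E2 (mobius g tau) = autj g tau ^+ 2 * E2 tau + kappa * (g 1 0)%:~R * autj g tau.
Proof.
have [n] := ubnP (absz (g 1 0)); elim: n g tau => // n IHn g tau gn.
have dg := det_SL2Z g.
have j0 := autj_neq0 g tau.
have [c0|c0] := eqVneq (g 1 0) 0.
  have ad : g 0 0 * g 1 1 = 1 by move: dg; rewrite c0 mulr0 subr0.
  have jE : autj g tau = (g 1 1)%:~R by rewrite /autj c0 mul0r add0r.
  have d1 : g 1 1 = 1 \/ g 1 1 = -1.
    have := congr1 absz ad; rewrite abszM => /eqP; rewrite muln_eq1 => /andP[_ /eqP].
    lia.
  have d2 : g 1 1 ^+ 2 = 1 by case: d1 => ->.
  rewrite (@E2_shift tau _ (g 0 1 * g 1 1)).
    by rewrite c0 mulr0 mul0r addr0 jE -rmorphXn /= d2 mul1r.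
  rewrite /= /mobius_fun jE; have dd : ((g 1 1)%:~R : C) != 0 by rewrite -jE.
  apply: (mulIf dd); rewrite divfK //.
  rewrite mulrDl -intrM -mulrA -expr2 d2 mulr1; congr (_ + _).
  have -> : g 0 0 = g 1 1 by case: d1 ad => ->; lia.
  by rewrite mulrC.
pose k := divz (g 0 0) (g 1 0); pose r := modz (g 0 0) (g 1 0).
have rE : r = g 0 0 - k * g 1 0 by rewrite /r /k {2}(divz_eq (g 0 0) (g 1 0)) addrAC subrr add0r.
have r0 : 0 <= r by apply: modz_ge0.
have rlt : r < `|g 1 0| by apply: ltz_mod.
have [s sE] : exists s, s = g 0 1 - k * g 1 1 by eexists.
clearbody r k.
have [|g' [ga gb gc gd]] := @sl2_ex (g 1 0) (g 1 1) (- r) (- s).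
  by rewrite rE sE; move: dg; move: (g 0 0) (g 0 1) (g 1 0) (g 1 1) => a b c d <-; ring.
have := IHn g' tau; rewrite gc => IH.
have rn : (absz (- r) < n)%N by rewrite abszN; lia.
have {}IH := IH rn.
have j'0 := autj_neq0 g' tau.
have wE : (mobius g' tau : C) = autj g tau / autj g' tau by rewrite /= /mobius_fun ga gb.
have [v vE] := inv_uh (mobius g' tau).
have det' : r%:~R * (g 1 1)%:~R - (g 1 0)%:~R * s%:~R = 1 :> C.
  rewrite -!intrM -intrB -[RHS](mulr1z 1); congr (_%:~R).
  by rewrite rE sE; move: dg; move: (g 0 0) (g 0 1) (g 1 0) (g 1 1) => a b c d <-; ring.
have j'E : autj g' tau = - (r%:~R * (tau : C) + s%:~R) by rewrite /autj gc gd !mulrNz; ring.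
have e1 : E2 (mobius g tau) = E2 v.
  apply: (@E2_shift _ _ k); rewrite vE wE invf_div /= /mobius_fun.
  apply: (mulIf j0); rewrite divfK // mulrDl mulNr divfK // j'E /autj.
  have -> : (g 0 0)%:~R = r%:~R + k%:~R * (g 1 0)%:~R :> C by rewrite -intrM -intrD rE subrK.
  have -> : (g 0 1)%:~R = s%:~R + k%:~R * (g 1 1)%:~R :> C by rewrite -intrM -intrD sE subrK.
  by ring.
rewrite e1 (E2_inv vE) IH wE mulrNz.
have jj : 1 - r%:~R * autj g tau = (g 1 0)%:~R * autj g' tau.
  transitivity ((r%:~R * (g 1 1)%:~R - (g 1 0)%:~R * s%:~R) - r%:~R * autj g tau).
    by rewrite det'.
  by rewrite j'E /autj; ring.
have -> : kappa * (g 1 0)%:~R * autj g tau =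
  kappa * ((g 1 0)%:~R * autj g' tau) * (autj g tau / autj g' tau) by field.
by rewrite -jj; field.
Qed.

End E2Law.

(** * Operators on a quasi-vertex operator algebra *)

Section LinearAlgebra.
Variables (K : fieldType) (V : lmodType K).

Lemma linear_props (U W : lmodType K) (f : U -> W) : linear f ->
  [/\ f 0 = 0, (forall u v, f (u + v) = f u + f v) & forall c u, f (c *: u) = c *: f u].
Proof.
move=> lf; have fD u v : f (u + v) = f u + f v by have := lf 1 u v; rewrite !scale1r.
have f0 : f 0 = 0 by apply: (addrI (f 0)); rewrite -fD !addr0.
by split=> // c u; have := lf c u 0; rewrite f0 !addr0.
Qed.

Lemma span_sum (S : set V) (I : eqType) (r : seq I) (F : I -> V) :
  (forall i, i \in r -> lspan S (F i)) -> lspan S (\sum_(i <- r) F i).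
Proof.
elim: r => [|i r IHr] rS; first by rewrite big_nil; apply: Defs.span0.
rewrite big_cons; apply: Defs.spanD; first by apply: rS; rewrite mem_head.
by apply: IHr => j jr; apply: rS; rewrite inE jr orbT.
Qed.

(** If a vector x of the spanning list is not in the span of the others, then the
    coefficient of x in p w is unique, hence linear in w, and can be split off. *)
Lemma finite_rank (s : seq V) (p : V -> V) : linear p ->
  (forall w, lspan [set` s] (p w)) ->
  exists t : seq ((V -> K^o) * V), (forall x, x \in t -> linear x.1) /\
    forall w, p w = \sum_(x <- t) x.1 w *: x.2.
Proof.
elim: s p => [|x s IHs] p lp ps.
  exists [::]; split=> // w; rewrite big_nil.
  by have [[|y r] [rs ->]] := ps w; rewrite ?big_nil //; have := rs y (mem_head _ _).
have ex w : exists a : K, lspan [set` s] (p w - a *: x).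
  have [r [rS ->]] := ps w; elim: r rS => [|y r IHr] rS.
    by exists 0; rewrite big_nil scale0r subr0; apply: Defs.span0.
  have [|a ha] := IHr; first by move=> z zr; apply: rS; rewrite inE zr orbT.
  have := rS y (mem_head _ _); rewrite /= inE => /orP[/eqP yx|ys].
    by exists (y.1 + a); rewrite big_cons yx scalerDl opprD addrACA subrr add0r.
  exists a; rewrite big_cons -addrA.
  have ys' : [set` s] y.2 by [].
  exact: Defs.spanD (Defs.spanZ y.1 (Defs.sub_span ys')) ha.
have [xs|xns] := pselect (lspan [set` s] x).
  apply: IHs lp _ => w; have [a ha] := ex w.
  by rewrite -(subrK (a *: x) (p w)); apply: Defs.spanD => //; apply: Defs.spanZ.
have [a ha] := boolp.choice ex.
have uniq w b : lspan [set` s] (p w - b *: x) -> b = a w.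
  move=> hb; apply/eqP; rewrite -subr_eq0; apply/eqP; apply: contrapT => /eqP n0; apply: xns.
  have := Defs.spanD (ha w) (Defs.spanZ (-1) hb).
  rewrite scaleN1r opprB addrACA [- _ + _]addrC addrACA subrr add0r -scalerBl => h.
  by have := Defs.spanZ (b - a w)^-1 h; rewrite scalerA mulVf // scale1r.
have [p0 pD pZ] := linear_props lp.
have la0 c u v : a (c *: u + v) = c * a u + a v.
  apply/esym/uniq; rewrite lp scalerDl -scalerA opprD addrACA -scalerBr.
  by apply: Defs.spanD (ha v); apply: Defs.spanZ.
have lp' : linear (fun w => p w - a w *: x).
  by move=> c u v; rewrite lp la0 scalerDl -scalerA opprD addrACA -scalerBr.
have [t [tl tp]] := IHs _ lp' ha.
exists ((a : V -> K^o, x) :: t); split.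
  by move=> y; rewrite inE => /orP[/eqP -> c u v|/tl //]; apply: la0.
by move=> w; rewrite big_cons /= -tp addrC subrK.
Qed.

Lemma sum_triangle (F : nat -> nat -> V) N :
  \sum_(n < N) \sum_(i < n.+1) F i (n - i)%N = \sum_(i < N) \sum_(j < N - i) F i j.
Proof.
elim: N => [|N IHN]; first by rewrite !big_ord0.
rewrite big_ord_recr /= IHN [RHS]big_ord_recr /= subSn // subnn big_ord1.
rewrite big_ord_recr /= subnn addrA; congr (_ + _).
rewrite -big_split /=; apply: eq_bigr => i _.
by rewrite subSn 1?ltnW // big_ord_recr.
Qed.

End LinearAlgebra.

Section FiniteSums.
Variable V : zmodType.

Lemma fsum_nat (f : nat -> V) N : (forall n, (N <= n)%N -> f n = 0) ->
  \sum_(n \in [set: nat]) f n = \sum_(n < N) f n.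
Proof.
move=> f0; rewrite (@fsbigE _ _ _ _ setT (index_iota 0 N)) ?iota_uniq //.
  by rewrite big_mkcond -(big_mkord xpredT f); apply: eq_bigr => i _; rewrite in_setT.
by move=> i _; rewrite mem_index_iota /= -leqNgt => /f0.
Qed.

Lemma fsum_seq (I : choiceType) (f : I -> V) r : uniq r ->
  (forall n, n \notin r -> f n = 0) ->
  \sum_(n \in [set: I]) f n = \sum_(n <- r) f n.
Proof.
move=> ur f0; rewrite (@fsbigE _ _ _ _ setT r) //; last by move=> i _ /f0.
by rewrite big_mkcond; apply: eq_bigr => i _; rewrite in_setT.
Qed.

End FiniteSums.

Section QvoaAction.
Variables (R : realType).
Local Notation C := R[i].
Variables (V : lmodType C) (Q : qvoa V).
Local Notation pr := (hproj (qgr Q)).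
Local Notation L n v := (iter n (opL1 Q) v).

Lemma iterL_linear n : linear (fun v => L n v).
Proof. by move=> c u v; elim: n => //= n ->; rewrite linearP. Qed.

Lemma iterL0 n : L n 0 = 0. Proof. by have [] := linear_props (iterL_linear n). Qed.
Lemma iterLD n u v : L n (u + v) = L n u + L n v.
Proof. by have [] := linear_props (iterL_linear n). Qed.
Lemma iterLZ n c u : L n (c *: u) = c *: L n u.
Proof. by have [] := linear_props (iterL_linear n). Qed.
Lemma expL1_big t v N : (forall n, (N <= n)%N -> L n v = 0) ->
  expL1 Q t v = \sum_(n < N) (t ^+ n / n`!%:R) *: L n v.
Proof. by move=> v0; apply: fsum_nat => n /v0 ->; rewrite scaler0. Qed.

Lemma expL1_linear t : linear (expL1 Q t).
Proof.
move=> c u v; have [M uM] := opL1_nilpotent Q u; have [N vN] := opL1_nilpotent Q v.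
have u0 n : (M + N <= n)%N -> L n u = 0 by move=> h; apply: uM; lia.
have v0 n : (M + N <= n)%N -> L n v = 0 by move=> h; apply: vN; lia.
rewrite (expL1_big _ u0) (expL1_big _ v0) (@expL1_big _ _ (M + N)); last first.
  by move=> n h; rewrite iterLD iterLZ u0 // v0 // scaler0 addr0.
rewrite scaler_sumr -big_split /=; apply: eq_bigr => n _.
by rewrite iterLD iterLZ scalerDr !scalerA mulrC.
Qed.

Lemma expL1D t u v : expL1 Q t (u + v) = expL1 Q t u + expL1 Q t v.
Proof. by have [] := linear_props (expL1_linear t). Qed.
Lemma expL1Z t c u : expL1 Q t (c *: u) = c *: expL1 Q t u.
Proof. by have [] := linear_props (expL1_linear t). Qed.
Lemma expL10 t : expL1 Q t 0 = 0.
Proof. by have [] := linear_props (expL1_linear t). Qed.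
Lemma expL1_sum t (I : Type) (r : seq I) (F : I -> V) :
  expL1 Q t (\sum_(i <- r) F i) = \sum_(i <- r) expL1 Q t (F i).
Proof. by elim/big_rec2: _ => [|i x y _ <-]; rewrite ?expL10 ?expL1D. Qed.

(** The terms with i + j >= N vanish, so the double sum may be taken over i + j < N;
    its part with i + j = n is an instance of the binomial theorem. *)
Lemma expL1_add s t v : expL1 Q s (expL1 Q t v) = expL1 Q (s + t) v.
Proof.
have [N vN] := opL1_nilpotent Q v.
rewrite (expL1_big _ vN) expL1_sum (expL1_big _ vN).
transitivity (\sum_(i < N) \sum_(j < N - i) (t ^+ i / i`!%:R * (s ^+ j / j`!%:R)) *: L (i + j) v).
  apply: eq_bigr => i _; rewrite expL1Z (@expL1_big _ _ (N - i)).
    by rewrite scaler_sumr; apply: eq_bigr => j _; rewrite scalerA -iterD addnC.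
  by move=> n h; rewrite -iterD; apply: vN; have := ltn_ord i; lia.
rewrite -(@sum_triangle _ _ (fun i j => (t ^+ i / i`!%:R * (s ^+ j / j`!%:R)) *: L (i + j) v)).
apply: eq_bigr => n _.
have -> : \sum_(i < n.+1) (t ^+ i / i`!%:R * (s ^+ (n - i) / (n - i)`!%:R)) *: L (i + (n - i)) v =
  \sum_(i < n.+1) (t ^+ i / i`!%:R * (s ^+ (n - i) / (n - i)`!%:R)) *: L n v.
  by apply: eq_bigr => i _; rewrite subnKC // -ltnS.
rewrite -scaler_suml; congr (_ *: _).
rewrite exprDn mulr_suml; apply: eq_bigr => i _.
have ni : (i <= n)%N by rewrite -ltnS.
have nz k : (k`!)%:R != 0 :> C by rewrite pnatr_eq0 -lt0n fact_gt0.
have := congr1 (fun k => k%:R : C) (bin_fact ni); rewrite !natrM => <-.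
have b0 : ('C(n, i))%:R != 0 :> C by rewrite pnatr_eq0 -lt0n bin_gt0.
rewrite -[_ *+ 'C(n, i)]mulr_natr; move: (nz i) (nz (n - i)%N).
move: (i`!%:R : C) ((n - i)`!%:R : C) ('C(n, i)%:R : C) b0 => a b c c0 a0 b0.
move: (s ^+ (n - i)) (t ^+ i) => x y.
by field; rewrite a0 b0 c0.
Qed.

Lemma expL1_0 v : expL1 Q 0 v = v.
Proof.
have [N vN] := opL1_nilpotent Q v.
rewrite (@expL1_big _ _ N.+1) => [|n h]; last by apply: vN; apply: ltnW.
rewrite big_ord_recl expr0 fact0 divr1 scale1r big1 ?addr0 // => i _.
by rewrite /= expr0n mul0r scale0r.
Qed.

Lemma expL1K t v : expL1 Q (- t) (expL1 Q t v) = v.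
Proof. by rewrite expL1_add addNr expL1_0. Qed.

Lemma hproj_seq v : exists2 r : seq int, uniq r & forall n, n \notin r -> pr n v = 0.
Proof.
exists (finmap.enum_fset (fset_set [set n | pr n v != 0])); first exact: finmap.fset_uniq.
move=> n; rewrite in_fset_set; last exact: hproj_fin.
by move=> nr; apply: contraNeq nr => h; rewrite inE.
Qed.

Lemma hproj_sum_seq v r : uniq r -> (forall n, n \notin r -> pr n v = 0) ->
  v = \sum_(n <- r) pr n v.
Proof. by move=> ur vr; rewrite -[LHS](hproj_sum (qgr Q)) (fsum_seq ur). Qed.

Lemma piece_hproj n v : piece (qgr Q) n (pr n v).
Proof. by rewrite /piece /= hproj_idem eqxx. Qed.

Lemma hproj_piece m n v : piece (qgr Q) n v -> pr m v = if m == n then v else 0.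
Proof. by rewrite /piece /= => <-; rewrite hproj_idem. Qed.

(** Reduces identities between operators to homogeneous vectors. *)
Lemma homogeneous_ext (W : lmodType C) (f g : V -> W) : linear f -> linear g ->
  (forall n v, piece (qgr Q) n v -> f v = g v) -> f =1 g.
Proof.
move=> /linear_props[f0 fD _] /linear_props[g0 gD _] fg v.
have [r ur vr] := hproj_seq v; rewrite (hproj_sum_seq ur vr) {ur vr}.
elim: r => [|n r IHr]; first by rewrite big_nil f0 g0.
by rewrite big_cons fD gD IHr (fg n) //; apply: piece_hproj.
Qed.

Lemma pow2L0_big j v r : uniq r -> (forall n, n \notin r -> pr n v = 0) ->
  pow2L0 Q j v = \sum_(n <- r) j ^ (2 * n) *: pr n v.
Proof. by move=> ur vr; apply: fsum_seq => // n /vr ->; rewrite scaler0. Qed.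

Lemma pow2L0_linear j : linear (pow2L0 Q j).
Proof.
move=> c u v; have [r _ ru] := hproj_seq u; have [s _ sv] := hproj_seq v.
have ut : uniq (undup (r ++ s)) by apply: undup_uniq.
have u0 n : n \notin undup (r ++ s) -> pr n u = 0.
  by rewrite mem_undup mem_cat negb_or => /andP[/ru].
have v0 n : n \notin undup (r ++ s) -> pr n v = 0.
  by rewrite mem_undup mem_cat negb_or => /andP[_ /sv].
rewrite (pow2L0_big _ ut u0) (pow2L0_big _ ut v0) (pow2L0_big _ ut); last first.
  by move=> n h; rewrite linearP u0 // v0 // scaler0 addr0.
rewrite scaler_sumr -big_split /=; apply: eq_bigr => n _.
by rewrite linearP scalerDr !scalerA mulrC.
Qed.

Lemma pow2L0_piece j n v : piece (qgr Q) n v -> pow2L0 Q j v = j ^ (2 * n) *: v.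
Proof.
move=> vn; rewrite (@pow2L0_big _ _ [:: n]) //.
  by rewrite big_seq1 (hproj_piece _ vn) eqxx.
by move=> m; rewrite inE => mn; rewrite (hproj_piece _ vn) (negbTE mn).
Qed.

Lemma iterL_piece m n v : piece (qgr Q) n v -> piece (qgr Q) (n - m%:Z) (L m v).
Proof.
move=> vn; elim: m => [|m IHm] /=; first by rewrite subr0.
rewrite (_ : n - m.+1%:Z = n - m%:Z - 1); last by lia.
exact: L1_piece.
Qed.

(** L(1) lowers the degree by 1, so j^(2 L(0)) L(1) = j^-2 L(1) j^(2 L(0)). *)
Lemma pow2L0_expL1 j s v : j != 0 ->
  pow2L0 Q j (expL1 Q (j ^+ 2 * s) v) = expL1 Q s (pow2L0 Q j v).
Proof.
move=> j0; move: v.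
have [p0 pD pZ] := linear_props (pow2L0_linear j).
apply: homogeneous_ext => [c u v|c u v|n v vn].
- by rewrite expL1_linear pow2L0_linear.
- by rewrite pow2L0_linear expL1_linear.
have [N vN] := opL1_nilpotent Q v.
rewrite (pow2L0_piece _ vn) expL1Z !(expL1_big _ vN) scaler_sumr.
rewrite (big_morph _ pD p0); apply: eq_bigr => m _.
rewrite pZ (pow2L0_piece _ (iterL_piece m vn)) !scalerA; congr (_ *: _).
have -> : 2 * (n - m%:Z) = 2 * n + - (2 * m)%:Z by lia.
rewrite expfzDr // -exprnN exprMn -exprM.
have jm : j ^+ (2 * m) != 0 by rewrite expf_neq0.
have fm : (m`!)%:R != 0 :> C by rewrite pnatr_eq0 -lt0n fact_gt0.
move: (j ^ (2 * n)) => J.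
by field; rewrite jm fm.
Qed.

Lemma hproj_pow2L0 j n v : pr n (pow2L0 Q j v) = j ^ (2 * n) *: pr n v.
Proof.
move: v; apply: homogeneous_ext => [c u v|c u v|m v vm].
- by rewrite pow2L0_linear linearP.
- by rewrite linearP scalerDr !scalerA mulrC.
rewrite (pow2L0_piece _ vm) linearZ /= (hproj_piece n vm).
by case: eqP => [->|_] //; rewrite !scaler0.
Qed.

Lemma hproj_iterL n m v : pr n (L m v) = L m (pr (n + m%:Z) v).
Proof.
move: v; apply: homogeneous_ext => [c u v|c u v|k v vk].
- by rewrite iterL_linear linearP.
- by rewrite linearP iterL_linear.
rewrite (hproj_piece _ (iterL_piece m vk)) (hproj_piece _ vk).
have -> : (n == k - m%:Z) = (n + m%:Z == k) by lia.
by case: ifP => // _; rewrite iterL0.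
Qed.

Lemma hproj_eq0 v : (forall n, pr n v = 0) -> v = 0.
Proof. by move=> v0; rewrite [v](@hproj_sum_seq _ [::]) ?big_nil. Qed.

Lemma iterL_filt N m v : filt Q N v -> filt Q N (L m v).
Proof. by move=> vN n Nn; rewrite hproj_iterL vN ?iterL0 //; lia. Qed.

Lemma filtD N u v : filt Q N u -> filt Q N v -> filt Q N (u + v).
Proof. by move=> uN vN n Nn; rewrite linearD uN // vN // addr0. Qed.
Lemma filtZ N c u : filt Q N u -> filt Q N (c *: u).
Proof. by move=> uN n Nn; rewrite linearZ /= uN // scaler0. Qed.
Lemma filt0 N : filt Q N 0. Proof. by move=> n _; rewrite linear0. Qed.
Lemma filt_sum N (I : Type) (r : seq I) (F : I -> V) :
  (forall i, filt Q N (F i)) -> filt Q N (\sum_(i <- r) F i).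
Proof. by move=> FN; elim/big_ind: _ => // [|u v]; [apply: filt0|apply: filtD]. Qed.
Lemma filt_le M N v : M <= N -> filt Q M v -> filt Q N v.
Proof. by move=> MN vM n Nn; apply: vM; apply: le_lt_trans Nn. Qed.

(** The degrees are bounded below, and L(1) lowers them. *)
Lemma iterL_bounded N : exists B, forall v, filt Q N v -> forall m, (B <= m)%N -> L m v = 0.
Proof.
have [low lowP] := piece_bounded Q.
exists (absz (N - low + 1)) => v vN m Bm; apply: hproj_eq0 => n; rewrite hproj_iterL.
have [h|h] := ltP N (n + m%:Z); first by rewrite vN ?iterL0.
have nl : n < low by lia.
have := lowP n nl (L m (pr (n + m%:Z) v)); apply.
have := iterL_piece m (piece_hproj (n + m%:Z) v).
by rewrite addrK.
Qed.

Lemma expL1_filt N t v : filt Q N v -> filt Q N (expL1 Q t v).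
Proof.
move=> vN; have [B /(_ v vN) vB] := iterL_bounded N.
by rewrite (expL1_big _ vB); apply: filt_sum => i; apply: filtZ; apply: iterL_filt.
Qed.

End QvoaAction.

(** * The isomorphism P *)

Section QExpansions.
Variable R : realType.
Local Notation C := R[i].
Local Notation H := (upper_half R).
Implicit Types (f g : H -> C) (a b : nat -> C).

Lemma qseries_ext f g a : f =1 g -> qseries f a -> qseries g a.
Proof. by move=> fg; have -> : g = f by apply/funext => t; rewrite fg. Qed.

Lemma qseriesD f g a b : qseries f a -> qseries g b ->
  qseries (fun t => f t + g t) (fun n => a n + b n).
Proof.
move=> fa gb t; apply/sumsE.
apply: (tends_ext _ (tendsD ((sumsE _ _).1 (fa t)) ((sumsE _ _).1 (gb t)))) => N.
by rewrite -big_split; apply: eq_bigr => n _; rewrite /= mulrDl.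
Qed.

Lemma qseriesZ c f a : qseries f a -> qseries (fun t => c * f t) (fun n => c * a n).
Proof.
move=> fa t; apply/sumsE.
apply: (tends_ext _ (tendsZ (c := c) ((sumsE _ _).1 (fa t)))) => N.
by rewrite mulr_sumr; apply: eq_bigr => n _; rewrite /= mulrA.
Qed.

Lemma qseries0 : qseries (fun _ : H => 0) (fun=> 0).
Proof.
move=> t; apply/sumsE; apply: (tends_ext _ (tends_cst 0)) => N.
by rewrite big1 // => n _; rewrite mul0r.
Qed.

Lemma qseries_sum (I : Type) (r : seq I) (F : I -> H -> C) (A : I -> nat -> C) :
  (forall i, qseries (F i) (A i)) ->
  qseries (fun t => \sum_(i <- r) F i t) (fun n => \sum_(i <- r) A i n).
Proof.
move=> FA; elim: r => [|i r IHr].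
  have -> : (fun n => \sum_(i <- [::]) A i n) = fun=> 0 by apply/funext => n; rewrite big_nil.
  by apply: qseries_ext qseries0 => t; rewrite big_nil.
have -> : (fun n => \sum_(j <- i :: r) A j n) = fun n => A i n + \sum_(j <- r) A j n.
  by apply/funext => n; rewrite big_cons.
by apply: qseries_ext (qseriesD (FA i) IHr) => t; rewrite big_cons.
Qed.

Lemma qseries1 : qseries (fun _ : H => 1) (fun n => (n == 0%N)%:R).
Proof.
move=> t; apply/sumsE/tendsS; apply: (tends_ext _ (tends_cst 1)) => N.
rewrite big_ord_recl eqxx expr0 mulr1 big1 ?addr0 // => n _.
by rewrite /= mul0r.
Qed.

Lemma qseries_E2X m : exists a, qseries (fun t : H => E2 t ^+ m) a.
Proof.
elim: m => [|m [a IHm]]; first by eexists; exact: qseries1.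
eexists; apply: qseries_ext (qseriesM (@qseries_E2 R) IHm) => t.
by rewrite exprS.
Qed.

(** The transformation law for the matrix - 1 reads f = - f. *)
Lemma modular_form_odd (k : int) f : modular_form (2 * k + 1) f -> f =1 (fun=> 0).
Proof.
case=> _ fm _ t; have [|g [ga gb gc gd]] := @sl2_ex (-1) 0 0 (-1); first by [].
have gt : mobius g t = t.
  apply: val_inj; rewrite /= /mobius_fun /autj ga gb gc gd.
  by rewrite mulrNz mul0r add0r addr0 mulN1r invrN invr1 mulrN1 opprK.
have := fm g t; rewrite gt /autj gc gd mul0r add0r mulrNz.
rewrite expfzDr ?oppr_eq0 ?oner_eq0 // -exprz_exp.
have -> : (-1 : C) ^ (2 : int) = 1 by rewrite -[LHS]/((-1) ^+ 2) sqrrN expr1n.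
rewrite exp1rz mul1r expr1z mulN1r => /eqP; rewrite -addr_eq0 -mulr2n mulrn_eq0 /=.
by move/eqP.
Qed.

Lemma modular_form_span (k : int) f : modular_form k f -> f \in in_span (@even_forms R).
Proof.
move=> fm; apply/in_spanP; move: fm.
have [[l ->]|[l ->]] : (exists l, k = 2 * l) \/ (exists l, k = 2 * l + 1).
  have : k = 2 * divz k 2 \/ k = 2 * divz k 2 + 1 by lia.
  by case=> e; [left|right]; exists (divz k 2).
- move=> fm; have ef : @even_forms R f by exists l.
  exact: Defs.sub_span ef.
move=> fm; have -> : f = 0 by apply/funext => t; rewrite (modular_form_odd fm).
exact: Defs.span0.
Qed.

End QExpansions.

Section MainMap.
Variables (R : realType).
Local Notation C := R[i].
Variables (V : lmodType C) (Q : qvoa V).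
Local Notation H := (upper_half R).
Local Notation pr := (hproj (qgr Q)).
Local Notation L n v := (iter n (opL1 Q) v).
Local Notation M := (modforms R).
Local Notation T := (tensor M V).

Definition alpha : C := - ((2 * pi)%:C * 'i / 12).

Lemma alpha_kappa : alpha * kappa R = -1.
Proof. by rewrite /alpha /kappa -/(c2pi R); field; apply: c2pi_neq0. Qed.

(** The function P(f (x) v) = f exp (alpha E2 L(1)) v. *)
Definition Pval (f : M) (v : V) : H -> V :=
  fun tau => f tau *: expL1 Q (alpha * E2 tau) v.

Lemma Pval_linl v : linear (Pval^~ v).
Proof.
move=> c f g; apply/funext => tau; rewrite /Pval !fctE scalerA -scalerDl; congr (_ *: _).
Qed.

Lemma Pval_linr f : linear (Pval f).
Proof.
move=> c u v; apply/funext => tau; rewrite /Pval !fctE expL1_linear scalerDr.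
by rewrite !scalerA mulrC.
Qed.

Definition Pmap : T -> (H -> V) := tlift Pval.

Lemma Pmap_is_linear : linear Pmap.
Proof. exact: tlift_is_linear Pval_linl Pval_linr. Qed.

HB.instance Definition _ :=
  GRing.isLinear.Build C T (H -> V) *:%R Pmap Pmap_is_linear.

Lemma Pmap_tens f v : Pmap (tens f v) = Pval f v.
Proof. exact: tlift_tens Pval_linl Pval_linr _ _. Qed.

Lemma Pmap0 : Pmap 0 = 0. Proof. exact: linear0. Qed.
Lemma PmapD x y : Pmap (x + y) = Pmap x + Pmap y. Proof. exact: linearD. Qed.
Lemma PmapZ c x : Pmap (c *: x) = c *: Pmap x. Proof. exact: linearZ. Qed.

Lemma tensor_seq (x : T) : exists s : seq (M * V), x = \sum_(p <- s) tens p.1 p.2.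
Proof.
have [s [sS ->]] := tensor_span x; elim: s sS => [|y s IHs] sS.
  by exists [::]; rewrite !big_nil.
have [|r rE] := IHs; first by move=> z zs; apply: sS; rewrite inE zs orbT.
have [f [v yE]] := sS y (mem_head _ _).
by exists ((y.1 *: f, v) :: r); rewrite !big_cons rE /= yE tensZl.
Qed.

(** A coefficient function that is nonzero somewhere expresses its vector through
    the others, which shortens the sum. *)
Lemma tensor_eval_inj n (s : seq (M * V)) : size s = n ->
  (forall tau, \sum_(p <- s) (p.1 : M) tau *: p.2 = 0) ->
  \sum_(p <- s) tens p.1 p.2 = 0.
Proof.
elim: n s => [|n IHn] [|[f v] s] //= sn s0; first by rewrite big_nil.
have [f0|/existsNP[t /eqP ft]] := pselect (forall t, f t = 0).
  have -> : f = 0 by apply: val_inj; apply/funext => t; apply: f0.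
  rewrite big_cons /= (_ : tens 0 v = 0) ?add0r.
    apply: IHn => [|tau]; first by case: sn.
    by have := s0 tau; rewrite big_cons /= f0 scale0r add0r.
  by rewrite -(scale0r 0) tensZl scale0r.
have vE : v = \sum_(p <- s) (- (p.1 t / f t)) *: p.2.
  have := s0 t; rewrite big_cons /= => /eqP; rewrite addr_eq0 => /eqP h.
  apply: (scalerI ft); rewrite h scaler_sumr -sumrN; apply: eq_bigr => p _.
  by rewrite scalerA mulrN mulrCA divff // mulr1 scaleNr.
pose s' : seq (M * V) := [seq ((p.1 : M) - ((p.1 : M) t / f t) *: (f : M) : M, p.2) | p <- s].
have s'E : \sum_(p <- ((f, v) :: s : seq (M * V))) tens p.1 p.2 = \sum_(p <- s') tens p.1 p.2.
  rewrite big_cons big_map /= {1}vE.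
  have -> : tens f (\sum_(p <- s) (- (p.1 t / f t)) *: p.2) = \sum_(p <- s) (- (p.1 t / f t)) *: tens f p.2.
    elim: (s) => [|p r IHr]; first by rewrite !big_nil -(scale0r 0) tensZr scale0r.
    by rewrite !big_cons tensDr tensZr IHr.
  rewrite -big_split; apply: eq_bigr => p _ /=.
  by rewrite tensDl -(scaleNr _ f) tensZl addrC.
rewrite s'E; apply: IHn; first by rewrite size_map; case: sn.
move=> tau; rewrite big_map /=; apply: etrans (s0 tau); rewrite big_cons /=.
have -> : f tau *: v = \sum_(p <- s) (f tau * - ((p.1 : M) t / f t)) *: p.2.
  by rewrite {1}vE scaler_sumr; apply: eq_bigr => p _; rewrite scalerA.
rewrite -big_split; apply: eq_bigr => p _ /=.
rewrite -scalerDl; congr (_ *: _).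
rewrite -[LHS]/((p.1 : M) tau - ((p.1 : M) t / f t) * f tau).
by rewrite addrC mulrN [f tau * _]mulrC.
Qed.

Lemma Pmap_inj : injective Pmap.
Proof.
move=> x y xy; apply/eqP; rewrite -subr_eq0; apply/eqP.
have [s sE] := tensor_seq (x - y); rewrite sE; apply: (tensor_eval_inj (erefl _)) => tau.
have h : Pmap (x - y) tau = 0 by rewrite linearB /= xy subrr.
rewrite -[LHS](expL1K Q (alpha * E2 tau)).
suff -> : expL1 Q (alpha * E2 tau) (\sum_(p <- s) (p.1 : M) tau *: p.2) = 0 by rewrite expL10.
apply: etrans h; rewrite sE linear_sum /= fct_sumE expL1_sum; apply: eq_bigr => p _.
by rewrite expL1Z Pmap_tens.
Qed.

Lemma Pmap_act g x tau : Pmap (tensor_act g x) tau = g tau *: Pmap x tau.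
Proof.
have [s ->] := tensor_seq x.
have [a0 aD _] := linear_props (@tensor_act_is_linear R V g).
rewrite (big_morph _ aD a0) !linear_sum /= !fct_sumE scaler_sumr; apply: eq_bigr => p _.
by rewrite tensor_act_tens !Pmap_tens /Pval scalerA.
Qed.

(** Holomorphy follows from the q-expansion. *)
Lemma modular_V_intro k N (f : H -> V) (a : nat -> V) :
  (forall tau, filt Q N (f tau)) -> (forall n, filt Q N (a n)) ->
  (forall (g : SL2Z) tau, slash Q k f g tau = f tau) ->
  (forall phi : {linear V -> C^o}, qseries (phi \o f) (phi \o a)) ->
  modular_V Q k f.
Proof.
move=> fN aN fk fa; exists N; split; [exact: fN| |exact: fk|].
  by move=> phi; apply: qseries_holomorphic (fa phi).
by exists a; split; [exact: aN|exact: fa].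
Qed.

Lemma modular_V_linear k c (f g : H -> V) :
  modular_V Q k f -> modular_V Q k g -> modular_V Q k (c *: f + g).
Proof.
move=> [Nf [fN _ fk [a [aN fa]]]] [Ng [gN _ gk [b [bN gb]]]].
apply: (@modular_V_intro _ (`|Nf| + `|Ng|) _ (fun n => c *: a n + b n)).
- move=> tau; apply: filtD; first apply: filtZ.
    by apply: (filt_le _ (fN tau)); lia.
  by apply: (filt_le _ (gN tau)); lia.
- move=> n; apply: filtD; first apply: filtZ.
    by apply: (filt_le _ (aN n)); lia.
  by apply: (filt_le _ (bN n)); lia.
- move=> s tau; rewrite -[RHS]/(c *: f tau + g tau) -(fk s) -(gk s) /slash.
  rewrite -[(c *: f + g) _]/(c *: f (mobius s tau) + g (mobius s tau)).
  by rewrite expL1_linear pow2L0_linear scalerDr !scalerA mulrC.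
move=> phi; have -> : phi \o (fun n => c *: a n + b n) = fun n => c * phi (a n) + phi (b n).
  by apply/funext => n; rewrite /= linearP.
apply: qseries_ext (qseriesD (qseriesZ (c := c) (fa phi)) (gb phi)) => tau.
by rewrite /= linearP.
Qed.

Lemma modular_V0 k : modular_V Q k (fun=> 0).
Proof.
have p0 j : pow2L0 Q j 0 = 0 by have [] := linear_props (pow2L0_linear Q j).
apply: (@modular_V_intro _ 0 _ (fun=> 0)) => [tau|n|g tau|phi]; try exact: filt0.
  by rewrite /slash expL10 p0 scaler0.
have -> : phi \o (fun=> 0) = (fun=> 0) :> (nat -> C) by apply/funext => n; rewrite /= linear0.
by apply: qseries_ext (@qseries0 R) => tau; rewrite /= linear0.
Qed.

Lemma piece_filt n v : piece (qgr Q) n v -> filt Q n v.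
Proof.
by move=> vn m nm; rewrite (hproj_piece m vn) (gt_eqF nm).
Qed.

(** The anomaly of alpha E2 is - c j, by alpha_kappa; it cancels against the
    exponential of the slash action. *)
Lemma slash_E2 (g : SL2Z) (tau : H) :
  (g 1 0)%:~R * autj g tau + alpha * E2 (mobius g tau) = autj g tau ^+ 2 * (alpha * E2 tau).
Proof.
rewrite E2_mobius; have := alpha_kappa; move: (alpha) (kappa R) => a k ak.
transitivity ((g 1 0)%:~R * autj g tau * (1 + a * k) + autj g tau ^+ 2 * (a * E2 tau)).
  by ring.
by rewrite ak subrr mulr0 add0r.
Qed.

(** By slash_E2 the slash action turns exp (alpha E2 L(1)) v into
    j^(2 L(0)) exp (j^2 alpha E2 L(1)) v, and commuting the two operators leaves
    the factor j^(2 n) that matches the weight k + 2 n. *)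
Lemma modular_Pval k n (f : M) v : modular_form k f -> piece (qgr Q) n v ->
  modular_V Q (k + 2 * n) (Pval f v).
Proof.
move=> [_ fm [b fb]] vn; have vN := piece_filt vn.
have [B vB] := opL1_nilpotent Q v.
have ex m : exists e : nat -> C, qseries (fun t : H => E2 t ^+ m * f t) e.
  by have [a ha] := qseries_E2X R m; eexists; apply: (qseriesM ha fb).
have [e eP] := boolp.choice ex.
pose a j := \sum_(m < B) (alpha ^+ m / m`!%:R * e m j) *: L m v.
apply: (@modular_V_intro _ n _ a).
- by move=> tau; apply: filtZ; apply: expL1_filt.
- by move=> j; apply: filt_sum => m; apply: filtZ; apply: iterL_filt.
- move=> g tau; have j0 := autj_neq0 g tau.
  have [_ _ pZ] := linear_props (pow2L0_linear Q (autj g tau)).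
  rewrite /slash /Pval expL1Z expL1_add slash_E2 pZ pow2L0_expL1 //.
  rewrite (pow2L0_piece _ vn) expL1Z !scalerA fm; congr (_ *: _).
  move: (autj g tau) (f tau) j0 => j x j0.
  transitivity (j ^ (- (k + 2 * n)) * j ^ k * j ^ (2 * n) * x).
    by move: (j ^ _) (j ^ _) (j ^ _) => *; ring.
  by rewrite -!expfzDr // (_ : - (k + 2 * n) + k + 2 * n = 0) ?expr0z ?mul1r //; lia.
move=> phi.
have -> : phi \o a = fun j => \sum_(m < B) (alpha ^+ m / m`!%:R * phi (L m v)) * e m j.
  apply/funext => j; rewrite /= linear_sum; apply: eq_bigr => m _.
  by rewrite linearZ /= -[LHS]/(_ * _) mulrAC.
have h := qseries_sum (r := index_enum 'I_B)
  (fun m : 'I_B => qseriesZ (c := alpha ^+ m / m`!%:R * phi (L m v)) (eP m)).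
apply: (qseries_ext _ h) => tau.
rewrite /= /Pval (expL1_big _ vB) linearZ linear_sum /=.
rewrite scaler_sumr; apply: eq_bigr => m _.
rewrite linearZ /= -[RHS]/(_ * (_ * _)) exprMn; ring.
Qed.

Lemma Pmap_piece k x : tensor_piece Q k x -> modular_V Q k (Pmap x).
Proof.
elim/Defs.span_ind => [|u v Pu Pv|c v [k' [l [f [w [kl fk wl ->]]]]]].
- by rewrite Pmap0; apply: modular_V0.
- by rewrite PmapD -[Pmap u]scale1r; exact: modular_V_linear.
have P1 : modular_V Q k (Pmap (tens f w)).
  move: wl; rewrite /doubled_piece; case: ifP => [l2 wl|_ ->].
    rewrite Pmap_tens -kl (_ : l = 2 * divz l 2); last by lia.
    exact: modular_Pval.
  by rewrite -(scale0r 0) tensZr scale0r Pmap0; apply: modular_V0.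
by rewrite PmapZ -[_ *: _]addr0; apply: modular_V_linear P1 (modular_V0 k).
Qed.

Lemma qseries_functional (F : H -> V) (a : nat -> V) (p : V -> C^o) : linear p ->
  (forall phi : {linear V -> C^o}, qseries (phi \o F) (phi \o a)) ->
  qseries (p \o F) (p \o a).
Proof.
move=> lp Fa.
pose m := GRing.isLinear.Build C V C^o *:%R p lp.
pose phi : {linear V -> C^o} := HB.pack p m.
exact: (Fa phi).
Qed.

Lemma graded_seq N : exists2 r : seq int, uniq r &
  forall v, filt Q N v -> forall n, n \notin r -> pr n v = 0.
Proof.
have [low lowP] := piece_bounded Q.
exists [seq low + (i : nat)%:Z | i <- iota 0 (absz (N - low + 1))].
  by rewrite map_inj_uniq ?iota_uniq // => i j /addrI [].
move=> w wN n nr; have [h|h] := ltP N n; first exact: wN.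
have [nl|ln] := ltP n low; first exact: lowP nl _ (piece_hproj Q n w).
case/negP: nr; apply/mapP; exists (absz (n - low)); last by lia.
by rewrite mem_iota; lia.
Qed.

(** The function G = exp (- alpha E2 L(1)) F satisfies
    G(g tau) = j^(k - 2 L(0)) G(tau). So its component of degree n is a modular form
    of weight k - 2 n with values in the finite-dimensional V_n, that is, a sum of
    f v with f scalar, and F is the image of the sum of all these f (x) v. *)
Lemma modular_V_image k (F : H -> V) : modular_V Q k F ->
  exists2 x, tensor_piece Q k x & Pmap x = F.
Proof.
move=> [N [FN _ Fk [a [aN Fa]]]].
pose G tau := expL1 Q (- (alpha * E2 tau)) (F tau).
have GN tau : filt Q N (G tau) by apply: expL1_filt.
have FG tau : F tau = expL1 Q (alpha * E2 tau) (G tau).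
  by rewrite /G expL1_add subrr expL1_0.
have Gpr n (g : SL2Z) tau : pr n (G (mobius g tau)) = autj g tau ^ (k - 2 * n) *: pr n (G tau).
  have j0 := autj_neq0 g tau; set j := autj g tau in j0 *.
  have GE : G tau = j ^ (- k) *: pow2L0 Q j (G (mobius g tau)).
    rewrite {1}/G -(Fk g tau) /slash -/j expL1Z FG; congr (_ *: _).
    rewrite expL1_add slash_E2 -/j pow2L0_expL1 // expL1_add addNr expL1_0 //.
  rewrite GE linearZ /= hproj_pow2L0 !scalerA -!expfzDr //.
  rewrite -[LHS]scale1r -(expr0z j); congr (_ ^ _ *: _); lia.
have [B LB] := iterL_bounded Q N.
have Gq (p : V -> C^o) : linear p -> exists b, qseries (p \o G) b.
  move=> lp; have [p0 pD pZ] := linear_props lp.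
  have term m : exists b, qseries (fun tau => ((- alpha) ^+ m / m`!%:R) * (E2 tau ^+ m * p (L m (F tau)))) b.
    have [e he] := qseries_E2X R m.
    have lpm : linear (fun v => p (L m v) : C^o) by move=> c u v; rewrite iterL_linear lp.
    eexists; apply: qseriesZ; apply: qseriesM he _.
    exact: (qseries_functional lpm Fa).
  have [b hb] := boolp.choice term.
  exists (fun n => \sum_(m < B) b m n).
  apply: (qseries_ext _ (qseries_sum (r := index_enum 'I_B) (fun m : 'I_B => hb m))) => tau.
  rewrite /= /G (expL1_big _ (LB _ (FN tau))) (big_morph p pD p0).
  apply: eq_bigr => m _; rewrite pZ -[RHS]/(_ * _) -mulNr exprMn; ring.
have [r ur rP] := graded_seq N.
have comp n : exists2 x, tensor_piece Q k x &
    forall tau, Pmap x tau = expL1 Q (alpha * E2 tau) (pr n (G tau)).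
  have [s sP] := piece_findim Q n.
  have lpr : linear (pr n : V -> V) by move=> c u v; rewrite linearP.
  have [t [tl tE]] := finite_rank lpr (fun w => sP _ (piece_hproj Q n w)).
  have term (y : (V -> C^o) * V) : y \in t -> exists2 x, tensor_piece Q k x &
      forall tau, Pmap x tau = y.1 (pr n (G tau)) *: expL1 Q (alpha * E2 tau) (pr n y.2).
    move=> yt; have yl := tl y yt; have [_ _ yZ] := linear_props yl.
    have fm : modular_form (k - 2 * n) (fun tau => y.1 (pr n (G tau))).
      have [b hb] : exists b, qseries (fun tau => y.1 (pr n (G tau))) b.
        by apply: (Gq (fun v => y.1 (pr n v))) => c u v; rewrite linearP yl.
      split; [exact: qseries_holomorphic hb| |by exists b].
      by move=> g tau; rewrite Gpr yZ.
    pose f : M := ModForms (modular_form_span fm).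
    exists (tens f (pr n y.2)); last by move=> tau; rewrite Pmap_tens.
    apply: Defs.sub_span; exists (k - 2 * n), (2 * n), f, (pr n y.2).
    split=> //; first by rewrite subrK.
    rewrite /doubled_piece (_ : (2 %| 2 * n)%Z); last by rewrite dvdz_mulr.
    by rewrite mulKz //; apply: piece_hproj.
  have [x xP xE] : exists2 x, tensor_piece Q k x & forall tau,
     Pmap x tau = \sum_(y <- t) y.1 (pr n (G tau)) *: expL1 Q (alpha * E2 tau) (pr n y.2).
    elim: t {tE tl} term => [|y t IHt] term.
      exists 0; first exact: Defs.span0.
      by move=> tau; rewrite big_nil Pmap0.
    have [x1 x1P x1E] := term y (mem_head _ _).
    have [|x2 x2P x2E] := IHt; first by move=> z zt; apply: term; rewrite inE zt orbT.
    exists (x1 + x2); first exact: Defs.spanD.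
    by move=> tau; rewrite big_cons PmapD -x1E -x2E.
  exists x => // tau; rewrite xE.
  have wE w : pr n w = \sum_(y <- t) y.1 (pr n w) *: pr n y.2.
    transitivity (pr n (pr n (pr n w))); first by rewrite !(hproj_idem, eqxx).
    rewrite [pr n (pr n w)]tE linear_sum; apply: eq_bigr => y _.
    by rewrite linearZ.
  apply: etrans (congr1 (expL1 Q _) (esym (wE (G tau)))).
  by rewrite expL1_sum; apply: eq_bigr => y _; rewrite expL1Z.
have [x xP xE] : exists2 x, tensor_piece Q k x & forall tau,
    Pmap x tau = expL1 Q (alpha * E2 tau) (\sum_(n <- r) pr n (G tau)).
  elim: (r) => [|n r' [x2 x2P x2E]].
    exists 0; first exact: Defs.span0.
    by move=> tau; rewrite big_nil Pmap0 expL10.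
  have [x1 x1P x1E] := comp n.
  exists (x1 + x2); first exact: Defs.spanD.
  by move=> tau; rewrite big_cons PmapD expL1D -x1E -x2E.
exists x => //; apply/funext => tau; rewrite xE FG.
by rewrite -(hproj_sum_seq ur (rP _ (GN tau))).
Qed.

Lemma Pmap_modforms x : modforms_V Q (Pmap x).
Proof.
have [s ->] := tensor_seq x; rewrite linear_sum.
apply: span_sum => -[f v] _; rewrite /= Pmap_tens.
have : lspan (@even_forms R) f by apply/in_spanP; apply: mf_valP.
rewrite /Pval; move: (mf_val f) => {}f; elim/Defs.span_ind => [|g h Pg Ph|c g [k gk]].
- rewrite (_ : (fun _ => _) = 0); first exact: Defs.span0.
  by apply/funext => tau; rewrite scale0r.
- rewrite (_ : (fun _ => _) = (fun tau => g tau *: expL1 Q (alpha * E2 tau) v) +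
     (fun tau => h tau *: expL1 Q (alpha * E2 tau) v)); first exact: Defs.spanD.
  by apply/funext => tau; rewrite -[RHS]/(_ *: _ + _ *: _) -scalerDl.
pose gM : M := ModForms (modular_form_span gk).
have [r ur rv] := hproj_seq Q v.
rewrite (_ : (fun _ => _) = c *: \sum_(n <- r) Pval gM (pr n v)).
  apply: Defs.spanZ; apply: span_sum => n _; apply: Defs.sub_span.
  exists (2 * k + 2 * n) => //.
  have gMk : modular_form (2 * k) gM := gk.
  exact: modular_Pval gMk (piece_hproj Q n v).
apply/funext => tau; rewrite {1}(hproj_sum_seq ur rv).
rewrite -[RHS]/(c *: (\sum_(n <- r) Pval gM (pr n v)) tau) fct_sumE expL1_sum !scaler_sumr.
by apply: eq_bigr => n _; rewrite /Pval scalerA.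
Qed.

End MainMap.

Theorem theorem1p2 (R : realType) (V : lmodType R[i]) (Q : qvoa V) :
  exists P : {linear tensor (modforms R) V -> (upper_half R -> V)},
    [/\ forall (f : modforms R) (v : V) (tau : upper_half R),
          P (tens f v) tau =
          \sum_(n \in [set: nat])
             ((n`!%:R)^-1 * (- ((2 * pi)%:C * 'i / 12)) ^+ n
                * (E2 tau ^+ n * f tau)) *: iter n (opL1 Q) v,
        forall (g : modforms R) (x : tensor (modforms R) V) (tau : upper_half R),
          P (tensor_act g x) tau = g tau *: P x tau,
        injective P,
        range P = modforms_V Q
      & forall k : int, P @` tensor_piece Q k = modular_V Q k].
Proof.
have imk k : Pmap Q @` tensor_piece Q k = modular_V Q k.
  apply/seteqP; split=> [F [x xk <-]|F /modular_V_image[x xk <-]]; first exact: Pmap_piece.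
  by exists x.
exists (Pmap Q); split=> /=.
- move=> f v tau; rewrite Pmap_tens /Pval.
  have [N vN] := opL1_nilpotent Q v.
  rewrite (expL1_big _ vN) (@fsum_nat _ _ N) => [|n /vN ->]; last by rewrite scaler0.
  rewrite scaler_sumr; apply: eq_bigr => n _; rewrite scalerA /alpha exprMn.
  by congr (_ *: _); ring.
- exact: Pmap_act.
- exact: Pmap_inj.
- apply/seteqP; split=> [F [x _ <-]|F]; first exact: Pmap_modforms.
  elim/Defs.span_ind => [|u v [x _ <-] [y _ <-]|c v [k _ /modular_V_image[x _ <-]]].
  + by exists 0; rewrite // Pmap0.
  + by exists (x + y); rewrite // PmapD.
  by exists (c *: x); rewrite // PmapZ.
exact: imk.
Qed.
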